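(* Let $p$ be an odd prime and let $\Pi$ be the depth zero supercuspidal representation of $GL_2(\mathbb{Q}_p)$ with central character $\omega$ associated to a character $\nu:\mathbb{F}_{p^2}^*\to\mathbb{C}^*$, $\nu\neq\nu^p$. Let $\nu=\nu(a,b)$ with $a+b$ even and $a>b$. Let $\chi$ denote a character of $K^*$, where $K/\mathbb{Q}_p$ is the unramified quadratic extension, such that $\chi$ is trivial on $1+p\mathcal{O}_K$ and agrees with $\omega$ on $\mathbb{Q}_p^*$ (so that, viewed as a character of $\mathbb{F}_{p^2}^*$, $\chi$ agrees with $\nu$ on $\mathbb{F}_p^*$). Define characters of $\mathbb{F}_p^*$ by $\mu_1(x)=x^{(a+b)/2}$, $\mu_2(x)=x^{(a+b+p-1)/2}$, $\mu_3(x)=x^{(a+b)/2-1}$, $\mu_4(x)=x^{(a+b+p-1)/2-1}$, and for $i=1,2$ let $\chi_i=\mu_i\circ\mathbf{N}$, with $\mathbf{N}:\mathbb{F}_{p^2}^*\to\mathbb{F}_p^*$ the norm. Then: 1. $v_{\mu_1}$ is a test vector for $\chi_1$ if and only if $t_{\chi_1}$ is odd. The character $\chi_1$ is of Type 1. 2. $v_{\mu_2}$ is a test vector for $\chi_2$ if and only if $t_{\chi_2}$ is odd. The character $\chi_2$ is of Type 2. 3. More generally, $v_{\mu_1}$ is a test vector for all characters $\chi$ of Type 1 such that $t_\chi$ is odd, and $v_{\mu_2}$ is a test vector for all characters $\chi$ of Type 2 such that $t_\chi$ is odd. 4. Neither $v_{\mu_1}$ nor $v_{\mu_2}$ is a test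 vector for any character $\chi$ with $t_\chi$ even. 5. $v_{\mu_3}$ is a test vector for all characters $\chi$ of Type 1 such that $t_\chi$ is even. 6. $v_{\mu_4}$ is a test vector for all characters $\chi\neq\nu,\nu^p$ of Type 2 such that $t_\chi$ is even.
   Context: Representations. For a character $\nu:\mathbb{F}_{p^2}^*\to\mathbb{C}^*$ with $\nu\ne\nu^p$, $\rho(\nu)$ is the irreducible cuspidal complex representation of $GL_2(\mathbb{F}_p)$ of dimension $p-1$ attached to $\nu$ (central character $\nu|_{\mathbb{F}_p^*}$; trace $-(\nu(z)+\nu(z)^p)$ at an element with eigenvalues $z,z^p$, $z\in\mathbb{F}_{p^2}\setminus\mathbb{F}_p$); $\rho(\nu)\cong\rho(\nu^p)$. Given a character $\omega$ of $\mathbb{Q}_p^*$ whose restriction to $\mathbb{Z}_p^*$ is the inflation of $\nu|_{\mathbb{F}_p^*}$, the depth zero supercuspidal representation $\Pi$ associated to $\nu$ (and $\omega$) is the irreducible smooth admissible supercuspidal representation of $GL_2(\mathbb{Q}_p)$ with central character $\omega$ whose type $V(\Pi)$, i.e. its space of vectors fixed by the matrices in $GL_2(\mathbb{Z}_p)$ congruent to $1$ modulo $p$, is as a representation of $GL_2(\mathbb{Z}_p)$ the inflation of $\rho(\nu)$. Torus and test vectors. Fix a non-square unit $\xi\in\mathbb{Z}_p^*$. $T=K^*$ is embedded in $GL_2(\mathbb{Q}_p)$ as the matrices $\begin{pmatrix} x&y\\ y\xi&x\end{pmatrix}$; reduction mod $p$ embeds $\mathbb{F}_{p^2}^*$ in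 $GL_2(\mathbb{F}_p)$. Characters of $K^*$ trivial on $1+p\mathcal{O}_K$ and agreeing with $\omega$ on $\mathbb{Q}_p^*$ are identified with characters of $\mathbb{F}_{p^2}^*\cong\mathcal{O}_K^*/(1+p\mathcal{O}_K)$ agreeing with $\nu$ on $\mathbb{F}_p^*$ (the value at $p$ being $\omega(p)$). A vector $v\in V(\Pi)$ is a test vector for $\chi$ if its projection to the $\chi$-eigenspace of $T$ in $\Pi$ is nonzero (equivalently, a nonzero $T$-equivariant functional $\ell_\chi:\Pi\to\chi$ exists and $\ell_\chi(v)\neq0$). For a character $\mu$ of $\mathbb{F}_p^*$, $v_\mu\in V(\Pi)$ is a nonzero vector, unique up to scalar, on which $\begin{pmatrix} x&0\\0&1\end{pmatrix}$, $x\in\mathbb{F}_p^*$, acts by $\mu(x)$ via $\rho(\nu)$. Labelling. Fix a prime of $\overline{\mathbb{Q}}$ above $p$, so that the complex $(p^2-1)$-th roots of unity are identified with $\mathbb{F}_{p^2}^*$; formulas such as $\mu_1(x)=x^{(a+b)/2}$ use this identification. Every character $\chi$ of $\mathbb{F}_{p^2}^*$ is $x\mapsto x^{r+ps}$ with $0\le r,s\le p-1$, unique once $(p-1,p-1)$ is excluded in favour of $(0,0)$; write $\chi=\chi(r,s)$ and $k_\chi=r+ps$. After possibly interchanging $\nu$ and $\nu^p$, $\nu=\nu(a,b)$ with $a>b$, and $k_\nu=a+pb<k_{\nu^p}=b+pa$. If $\chi$ agrees with $\nu$ on $\mathbb{F}_p^*$, then $k_\chi\equiv k_\nu \pmod{p-1}$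 and $t_\chi=(k_\chi-k_\nu)/(p-1)$ (well defined modulo $p+1$). The character $\chi$ is of Type 1 if $k_\nu<k_\chi<k_{\nu^p}$, and of Type 2 otherwise. *)

(* Defs.v *)
From HB Require Import structures.
From mathcomp Require Import all_boot all_order all_algebra all_fingroup.
From mathcomp Require Import all_character all_field.
From mathcomp Require Import fraction boolp reals complex.

Set Implicit Arguments.
Unset Strict Implicit.
Unset Printing Implicit Defensive.

Import Order.TTheory GRing.Theory Num.Theory.
Local Open Scope ring_scope.

(* Z_p is the inverse limit of the Z/p^n: a p-adic integer is the sequence of
   its canonical representatives x n in {0, ..., p^n - 1}. The reduction on the
   right-hand side forces x n to be canonical. *)
Definition coherent (p : nat) (x : nat -> int) : Prop :=
  forall n, x n = (x n.+1 %% (p ^ n)%N)%Z.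

Record padicZ (p : nat) (pr : prime p) : Type := PadicZ {
  padicZ_seq :> nat -> int;
  padicZ_coherent : `[< coherent p padicZ_seq >] }.

HB.instance Definition _ (p : nat) (pr : prime p) :=
  [isSub for @padicZ_seq p pr].
HB.instance Definition _ (p : nat) (pr : prime p) :=
  [Choice of padicZ pr by <:].

Lemma padicZ_ext (p : nat) (pr : prime p) (x y : padicZ pr) :
  (forall n, x n = y n) -> x = y.
Proof. by move=> xy; apply/val_inj/funext. Qed.

Lemma padicZE (p : nat) (pr : prime p) (x : padicZ pr) n :
  (x n.+1 %% (p ^ n)%N)%Z = x n.
Proof. by have /asboolP h := padicZ_coherent x; rewrite [RHS]h. Qed.

Lemma padicZ_mod (p : nat) (pr : prime p) (x : padicZ pr) n :
  (x n %% (p ^ n)%N)%Z = x n.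
Proof. by rewrite -padicZE modz_mod. Qed.

Lemma modz_expS (p n : nat) (z : int) :
  ((z %% (p ^ n.+1)%N)%Z %% (p ^ n)%N)%Z = (z %% (p ^ n)%N)%Z.
Proof.
rewrite [in RHS](divz_eq z (p ^ n.+1)%N).
by rewrite {3}expnS PoszM mulrA modzMDl.
Qed.

Lemma coherent_mod (p : nat) (f : nat -> int) :
  (forall n, f n.+1 = f n %[mod (p ^ n)%N])%Z ->
  `[< coherent p (fun n => (f n %% (p ^ n)%N)%Z) >].
Proof. by move=> h; apply/asboolP => n; rewrite modz_expS h. Qed.

Fact padicZ_const_subproof (p : nat) (pr : prime p) (z : int) :
  `[< coherent p (fun n => (z %% (p ^ n)%N)%Z) >].
Proof. exact: coherent_mod. Qed.
Definition padicZ_const (p : nat) (pr : prime p) (z : int) : padicZ pr :=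
  PadicZ pr (padicZ_const_subproof pr z).

Fact padicZ_add_subproof (p : nat) (pr : prime p) (x y : padicZ pr) :
  `[< coherent p (fun n => ((x n + y n) %% (p ^ n)%N)%Z) >].
Proof. by apply: coherent_mod => n; rewrite -modzDm !padicZE. Qed.
Definition padicZ_add (p : nat) (pr : prime p) (x y : padicZ pr) : padicZ pr :=
  PadicZ pr (padicZ_add_subproof x y).

Fact padicZ_opp_subproof (p : nat) (pr : prime p) (x : padicZ pr) :
  `[< coherent p (fun n => ((- x n) %% (p ^ n)%N)%Z) >].
Proof. by apply: coherent_mod => n; rewrite -modzNm padicZE. Qed.
Definition padicZ_opp (p : nat) (pr : prime p) (x : padicZ pr) : padicZ pr :=
  PadicZ pr (padicZ_opp_subproof x).

Fact padicZ_mul_subproof (p : nat) (pr : prime p) (x y : padicZ pr) :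
  `[< coherent p (fun n => ((x n * y n) %% (p ^ n)%N)%Z) >].
Proof. by apply: coherent_mod => n; rewrite -modzMm !padicZE. Qed.
Definition padicZ_mul (p : nat) (pr : prime p) (x y : padicZ pr) : padicZ pr :=
  PadicZ pr (padicZ_mul_subproof x y).

Fact padicZ_addA (p : nat) (pr : prime p) : associative (@padicZ_add p pr).
Proof.
by move=> x y z; apply: padicZ_ext => n /=; rewrite modzDml modzDmr addrA.
Qed.
Fact padicZ_addC (p : nat) (pr : prime p) : commutative (@padicZ_add p pr).
Proof. by move=> x y; apply: padicZ_ext => n /=; rewrite addrC. Qed.
Fact padicZ_add0 (p : nat) (pr : prime p) :
  left_id (padicZ_const pr 0) (@padicZ_add p pr).
Proof.
by move=> x; apply: padicZ_ext => n /=; rewrite mod0z add0r padicZ_mod.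
Qed.
Fact padicZ_addN (p : nat) (pr : prime p) :
  left_inverse (padicZ_const pr 0) (@padicZ_opp p pr) (@padicZ_add p pr).
Proof. by move=> x; apply: padicZ_ext => n /=; rewrite modzDml addNr. Qed.

HB.instance Definition _ (p : nat) (pr : prime p) :=
  GRing.isZmodule.Build (padicZ pr)
    (@padicZ_addA p pr) (@padicZ_addC p pr)
    (@padicZ_add0 p pr) (@padicZ_addN p pr).

Fact padicZ_mulA (p : nat) (pr : prime p) : associative (@padicZ_mul p pr).
Proof.
by move=> x y z; apply: padicZ_ext => n /=; rewrite modzMml modzMmr mulrA.
Qed.
Fact padicZ_mulC (p : nat) (pr : prime p) : commutative (@padicZ_mul p pr).
Proof. by move=> x y; apply: padicZ_ext => n /=; rewrite mulrC. Qed.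
Fact padicZ_mul1 (p : nat) (pr : prime p) :
  left_id (padicZ_const pr 1) (@padicZ_mul p pr).
Proof.
by move=> x; apply: padicZ_ext => n /=; rewrite modzMml mul1r padicZ_mod.
Qed.
Fact padicZ_mulDl (p : nat) (pr : prime p) :
  left_distributive (@padicZ_mul p pr) (@padicZ_add p pr).
Proof.
move=> x y z; apply: padicZ_ext => n /=.
by rewrite modzMml modzDml modzDmr mulrDl.
Qed.
Fact padicZ_1neq0 (p : nat) (pr : prime p) :
  padicZ_const pr 1 != padicZ_const pr 0.
Proof.
apply/eqP => /(congr1 (fun x : padicZ pr => x 1%N)) /=.
rewrite expn1 mod0z modz_small //= ltz_nat prime_gt1 //.
Qed.

HB.instance Definition _ (p : nat) (pr : prime p) :=
  GRing.Zmodule_isComNzRing.Build (padicZ pr)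
    (@padicZ_mulA p pr) (@padicZ_mulC p pr) (@padicZ_mul1 p pr)
    (@padicZ_mulDl p pr) (@padicZ_1neq0 p pr).

Definition padicZ_unit (p : nat) (pr : prime p) : pred (padicZ pr) :=
  fun x => `[< exists y, y * x = 1 >].
Definition padicZ_inv (p : nat) (pr : prime p) (x : padicZ pr) : padicZ pr :=
  match pselect (exists y, y * x = 1) with
  | left ex => projT1 (cid ex)
  | right _ => x
  end.

Fact padicZ_mulV (p : nat) (pr : prime p) :
  {in @padicZ_unit p pr, left_inverse 1 (@padicZ_inv p pr) *%R}.
Proof.
move=> x /asboolP ux; rewrite /padicZ_inv.
by case: pselect => // ex; exact: (projT2 (cid ex)).
Qed.
Fact padicZ_unitP (p : nat) (pr : prime p) (x y : padicZ pr) :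
  y * x = 1 -> padicZ_unit x.
Proof. by move=> yx1; apply/asboolP; exists y. Qed.
Fact padicZ_inv_out (p : nat) (pr : prime p) :
  {in [predC @padicZ_unit p pr], @padicZ_inv p pr =1 id}.
Proof.
move=> x /negP ux; rewrite /padicZ_inv; case: pselect => // ex.
by case: ux; apply/asboolP.
Qed.

HB.instance Definition _ (p : nat) (pr : prime p) :=
  GRing.ComNzRing_hasMulInverse.Build (padicZ pr)
    (@padicZ_mulV p pr) (@padicZ_unitP p pr) (@padicZ_inv_out p pr).

Lemma padicZ_neq0P (p : nat) (pr : prime p) (x : padicZ pr) :
  x != 0 -> exists n, x n != 0.
Proof.
move=> x0; apply: contrapT => h; case/eqP: x0; apply: padicZ_ext => n /=.
by rewrite mod0z; apply: contrapT => /eqP xn; apply: h; exists n.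
Qed.

Lemma padicZ_modk (p : nat) (pr : prime p) (x : padicZ pr) n k :
  (x (n + k)%N %% (p ^ n)%N)%Z = x n.
Proof.
elim: k => [|k IHk]; first by rewrite addn0 padicZ_mod.
rewrite addnS [in LHS](divz_eq (x (n + k).+1) (p ^ (n + k))%N).
by rewrite {2}expnD mulnC PoszM mulrA modzMDl padicZE.
Qed.

Lemma padicZ_ndvd (p : nat) (pr : prime p) (x : padicZ pr) n k :
  x n != 0 -> ~~ (p ^ n %| `|x (n + k)%N|)%N.
Proof.
apply: contra => d; rewrite -(padicZ_modk x n k); apply/eqP/dvdz_mod0P.
by rewrite /dvdz.
Qed.

Lemma ndvdn_pfactorM (p n m a b : nat) : prime p ->
  ~~ (p ^ n %| a)%N -> ~~ (p ^ m %| b)%N -> ~~ (p ^ (n + m) %| a * b)%N.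
Proof.
move=> pr na mb.
have a0 : (0 < a)%N by case: a na => //; rewrite dvdn0.
have b0 : (0 < b)%N by case: b mb => //; rewrite dvdn0.
move: na mb; rewrite !pfactor_dvdn ?muln_gt0 ?a0 // lognM //.
by rewrite -!ltnNge => la lb; rewrite (leq_trans _ (leq_add la (ltnW lb))).
Qed.

Fact padicZ_idomain (p : nat) (pr : prime p) (x y : padicZ pr) :
  x * y = 0 -> (x == 0) || (y == 0).
Proof.
move=> xy0; apply: contraT; rewrite negb_or => /andP[/padicZ_neq0P[n xn]].
move=> /padicZ_neq0P[m ym].
have := congr1 (fun z : padicZ pr => z (n + m)%N) xy0; rewrite /= mod0z.
move/dvdz_mod0P; rewrite dvdzE abszM /= => d.
have := ndvdn_pfactorM pr (padicZ_ndvd m xn) (padicZ_ndvd n ym).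
by rewrite (addnC m n) d.
Qed.

HB.instance Definition _ (p : nat) (pr : prime p) :=
  GRing.ComUnitRing_isIntegral.Build (padicZ pr) (@padicZ_idomain p pr).

Definition padicQ (p : nat) (pr : prime p) : fieldType := {fraction padicZ pr}.

Definition ZtoQ (p : nat) (pr : prime p) (x : padicZ pr) : padicQ pr :=
  FracField.tofrac x.

Definition residue (p : nat) (pr : prime p) (x : padicZ pr) : 'F_p :=
  (x 1%N)%:~R.

Definition mx2 (A : Type) (a b c d : A) : 'M[A]_2 :=
  \matrix_(i, j) if i == 0 then (if j == 0 then a else b)
                 else (if j == 0 then c else d).

(* A character k^* -> C^* is a function on k; its value at 0 is irrelevant.
   The equations force nonzero values on k^*. *)
Definition is_char (k C : fieldType) (f : k -> C) : Prop :=
  f 1 = 1 /\ forall x y, x != 0 -> y != 0 -> f (x * y) = f x * f y.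

Definition eq_char (F : finFieldType) (C : fieldType) (f g : F -> C) : bool :=
  [forall x, (x != 0) ==> (f x == g x)].

Definition algint (C : fieldType) (x : C) : Prop :=
  integralOver (intr : int -> C) x.

(* P is a prime ideal, containing p, of the ring of algebraic integers in C. *)
Record prime_over (p : nat) (C : fieldType) (P : C -> Prop) : Prop := {
  prime_over_int : forall x, P x -> algint x;
  prime_over_p : P p%:R;
  prime_over_sub : forall x y, P x -> P y -> P (x - y);
  prime_over_mul : forall a x, algint a -> P x -> P (a * x);
  prime_over_neq1 : ~ P 1;
  prime_over_prime :
    forall x y, algint x -> algint y -> P (x * y) -> P x \/ P y }.

(* The identification of F^* with the roots of unity of order prime to p:
   x |-> tau x mod P is an embedding of F in the residue field of P. *)
Record teichmuller (F : finFieldType) (C : fieldType) (P : C -> Prop)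
    (tau : F -> C) : Prop := {
  teichmuller_char : is_char tau;
  teichmuller_0 : tau 0 = 0;
  teichmuller_add : forall x y, P (tau (x + y) - (tau x + tau y)) }.

Definition Fp_in (p : nat) (F : finFieldType) (c : 'F_p) : F := (c : nat)%:R.
Arguments Fp_in {p} F c.

(* The norm z z^p, as an element of the prime field. *)
Definition Fnorm (p : nat) (F : finFieldType) (z : F) : 'F_p :=
  odflt 0 [pick c : 'F_p | Fp_in F c == z * z ^+ p].

Definition chi_rs (p : nat) (F : finFieldType) (C : fieldType) (tau : F -> C)
    (r s : nat) : F -> C :=
  fun x => tau x ^+ (r + p * s).

(* k_chi = r + p s for the unique (r, s) <> (p-1, p-1) with chi = chi(r, s);
   the default 0 is never reached when chi is a character and #|F| = p^2. *)
Definition k_of (p : nat) (F : finFieldType) (C : fieldType) (tau : F -> C)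
    (chi : F -> C) : nat :=
  if [pick rs : 'I_p * 'I_p |
        ~~ ((rs.1 == p.-1 :> nat) && (rs.2 == p.-1 :> nat))
        && eq_char chi (chi_rs p tau rs.1 rs.2)] is Some rs
  then (rs.1 + p * rs.2)%N else 0%N.

Definition t_of (p : nat) (F : finFieldType) (C : fieldType)
    (tau nu chi : F -> C) : int :=
  (((k_of p tau chi)%:Z - (k_of p tau nu)%:Z) %/ (p.-1)%:Z)%Z.

Definition oddz (t : int) : bool := ~~ (2 %| t)%Z.

Definition type1 (p : nat) (F : finFieldType) (C : fieldType)
    (tau nu chi : F -> C) : bool :=
  (k_of p tau nu < k_of p tau chi < k_of p tau (fun x => nu x ^+ p))%N.

Definition type2 (p : nat) (F : finFieldType) (C : fieldType)
    (tau nu chi : F -> C) : bool :=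
  ~~ type1 p tau nu chi.

(* The character x |-> x^e of F_p^*, with values in C through tau. *)
Definition mu_pow (p : nat) (F : finFieldType) (C : fieldType) (tau : F -> C)
    (e : nat) : 'F_p -> C :=
  fun c => tau (Fp_in F c) ^+ e.

(* A group representation acts on column vectors by u |-> rho g *m u. *)
Record cuspidal_rep (p : nat) (F : finFieldType) (C : fieldType) (nu : F -> C)
    (rho : mx_representation C [set: {'GL_2['F_p]}] p.-1) : Prop := {
  cuspidal_irr : mx_irreducible rho;
  cuspidal_unip : forall u : 'cV[C]_(p.-1),
    (forall (g : {'GL_2['F_p]}) (x : 'F_p),
       GLval g = mx2 1 x 0 1 -> rho g *m u = u) -> u = 0;
  cuspidal_central : forall (g : {'GL_2['F_p]}) (c : 'F_p),
    GLval g = c%:M -> rho g = (nu (Fp_in F c))%:M;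
  cuspidal_trace : forall (g : {'GL_2['F_p]}) (z : F),
    (forall c : 'F_p, z != Fp_in F c) ->
    eigenvalue (map_mx (Fp_in F) (GLval g)) z ->
    eigenvalue (map_mx (Fp_in F) (GLval g)) (z ^+ p) ->
    \tr (rho g) = - (nu z + nu z ^+ p) }.

(* A representation of GL_2(Q_p) is a map pi : 'M_2 -> V -> V, of which only
   the values on invertible matrices matter. *)
Record GL2_rep (p : nat) (pr : prime p) (C : fieldType) (V : lmodType C)
    (pi : 'M[padicQ pr]_2 -> V -> V) : Prop := {
  GL2_rep_linear : forall g, g \in unitmx ->
    forall (a : C) (u v : V), pi g (a *: u + v) = a *: pi g u + pi g v;
  GL2_rep_1 : forall v, pi 1%:M v = v;
  GL2_rep_mul : forall g h, g \in unitmx -> h \in unitmx ->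
    forall v, pi (g *m h) v = pi g (pi h v) }.

(* h in GL_2(Z_p) is congruent to 1 modulo p^n. *)
Definition congr_subgroup (p : nat) (pr : prime p) (n : nat)
    (h : 'M[padicZ pr]_2) : Prop :=
  h \in unitmx /\
  forall i j, exists c, h i j = (1%:M : 'M[padicZ pr]_2) i j + p%:R ^+ n * c.

Definition fixed_by (p : nat) (pr : prime p) (C : fieldType) (V : lmodType C)
    (pi : 'M[padicQ pr]_2 -> V -> V) (n : nat) (v : V) : Prop :=
  forall h, congr_subgroup n h -> pi (map_mx (@ZtoQ p pr) h) v = v.

Definition smooth (p : nat) (pr : prime p) (C : fieldType) (V : lmodType C)
    (pi : 'M[padicQ pr]_2 -> V -> V) : Prop :=
  forall v, exists n, fixed_by pi n v.

(* The congruence subgroups being a basis of neighbourhoods of 1, it is enough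
   that their spaces of fixed vectors be finite-dimensional. *)
Definition admissible (p : nat) (pr : prime p) (C : fieldType) (V : lmodType C)
    (pi : 'M[padicQ pr]_2 -> V -> V) : Prop :=
  forall n, exists e : seq V, forall v, fixed_by pi n v ->
    exists c : nat -> C, v = \sum_(i < size e) c i *: e`_i.

Definition irreducible_rep (p : nat) (pr : prime p) (C : fieldType)
    (V : lmodType C) (pi : 'M[padicQ pr]_2 -> V -> V) : Prop :=
  (exists v : V, v != 0) /\
  forall W : V -> Prop,
    W 0 ->
    (forall (a : C) (u v : V), W u -> W v -> W (a *: u + v)) ->
    (forall g v, g \in unitmx -> W v -> W (pi g v)) ->
    (forall v, W v) \/ (forall v, W v -> v = 0).

(* The Jacquet module vanishes: V is spanned by the pi(n) w - w, with n in the
   unipotent radical of the Borel subgroup. *)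
Definition supercuspidal (p : nat) (pr : prime p) (C : fieldType)
    (V : lmodType C) (pi : 'M[padicQ pr]_2 -> V -> V) : Prop :=
  forall v : V, exists s : seq (padicQ pr * V),
    v = \sum_(xw <- s) (pi (mx2 1 xw.1 0 1) xw.2 - xw.2).

(* phi identifies rho, inflated to GL_2(Z_p), with the vectors of V fixed by
   the matrices congruent to 1 modulo p. *)
Definition type_is_inflation (p : nat) (pr : prime p) (C : fieldType)
    (V : lmodType C) (pi : 'M[padicQ pr]_2 -> V -> V)
    (rho : mx_representation C [set: {'GL_2['F_p]}] p.-1) : Prop :=
  exists phi : {linear 'cV[C]_(p.-1) -> V},
    [/\ injective phi,
        forall v, fixed_by pi 1 v <-> exists u, v = phi u
      & forall (h : 'M[padicZ pr]_2) (g : {'GL_2['F_p]}) (u : 'cV[C]_(p.-1)),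
          h \in unitmx -> GLval g = map_mx (@residue p pr) h ->
          pi (map_mx (@ZtoQ p pr) h) (phi u) = phi (rho g *m u)].

Record depth_zero_supercuspidal (p : nat) (pr : prime p) (F : finFieldType)
    (C : fieldType) (nu : F -> C) (omega : padicQ pr -> C) (V : lmodType C)
    (pi : 'M[padicQ pr]_2 -> V -> V) : Prop := {
  dz_rep : GL2_rep pi;
  dz_smooth : smooth pi;
  dz_admissible : admissible pi;
  dz_irreducible : irreducible_rep pi;
  dz_supercuspidal : supercuspidal pi;
  dz_central : forall (x : padicQ pr) (v : V),
    x != 0 -> pi x%:M v = omega x *: v;
  dz_type : exists2 rho : mx_representation C [set: {'GL_2['F_p]}] p.-1,
    cuspidal_rep nu rho & type_is_inflation pi rho }.

(* omega restricted to Z_p^* is the inflation of nu restricted to F_p^*. *)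
Definition extends_residual (p : nat) (pr : prime p) (F : finFieldType)
    (C : fieldType) (nu : F -> C) (omega : padicQ pr -> C) : Prop :=
  forall u : padicZ pr, u \is a GRing.unit ->
    omega (ZtoQ u) = nu (Fp_in F (residue u)).

(* K is Q_p(sqrt xi), sK being the square root of xi; the element x + y sK of K
   corresponds to the matrix torus xi x y, and belongs to O_K exactly when
   x and y are in Z_p (p is odd). *)
Definition Kelt (p : nat) (pr : prime p) (K : fieldExtType (padicQ pr))
    (sK : K) (x y : padicQ pr) : K :=
  x%:A + y *: sK.

Definition torus (p : nat) (pr : prime p) (xi : padicZ pr)
    (x y : padicQ pr) : 'M[padicQ pr]_2 :=
  mx2 x y (y * ZtoQ xi) x.

Definition eigenvector (p : nat) (pr : prime p) (xi : padicZ pr)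
    (K : fieldExtType (padicQ pr)) (sK : K) (C : fieldType) (V : lmodType C)
    (pi : 'M[padicQ pr]_2 -> V -> V) (chi : K -> C) (v : V) : Prop :=
  forall x y : padicQ pr, (x, y) != (0, 0) ->
    pi (torus xi x y) v = chi (Kelt sK x y) *: v.

(* w is the projection of v to the chi-eigenspace of K^*, that is, v - w is a
   sum of eigenvectors for characters of K^* other than chi. *)
Definition eigenprojection (p : nat) (pr : prime p) (xi : padicZ pr)
    (K : fieldExtType (padicQ pr)) (sK : K) (C : fieldType) (V : lmodType C)
    (pi : 'M[padicQ pr]_2 -> V -> V) (chi : K -> C) (v w : V) : Prop :=
  eigenvector xi sK pi chi w /\
  exists2 s : seq V, v = w + \sum_(u <- s) u &
    forall u, u \in s -> exists chi' : K -> C,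
      [/\ is_char chi', exists2 z, z != 0 & chi' z != chi z
        & eigenvector xi sK pi chi' u].

Definition test_vector (p : nat) (pr : prime p) (xi : padicZ pr)
    (K : fieldExtType (padicQ pr)) (sK : K) (C : fieldType) (V : lmodType C)
    (pi : 'M[padicQ pr]_2 -> V -> V) (chi : K -> C) (v : V) : Prop :=
  exists2 w, eigenprojection xi sK pi chi v w & w != 0.

(* chi is a character of K^*, trivial on 1 + p O_K and equal to omega on Q_p^*;
   chib is chi viewed as a character of the multiplicative group of the residue
   field F = F_p(sF), where sF is the reduction of sK. *)
Record tame_char (p : nat) (pr : prime p) (K : fieldExtType (padicQ pr))
    (sK : K) (F : finFieldType) (sF : F) (C : fieldType)
    (omega : padicQ pr -> C) (chi : K -> C) (chib : F -> C) : Prop := {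
  tame_char_K : is_char chi;
  tame_char_1 : forall x y : padicZ pr,
    chi (Kelt sK (ZtoQ (1 + p%:R * x)) (ZtoQ (p%:R * y))) = 1;
  tame_char_omega : forall x : padicQ pr, x != 0 -> chi x%:A = omega x;
  tame_char_F : is_char chib;
  tame_char_red : forall x y : padicZ pr,
    let z := Fp_in F (residue x) + Fp_in F (residue y) * sF in
    z != 0 -> chi (Kelt sK (ZtoQ x) (ZtoQ y)) = chib z }.

Definition torus_vector (p : nat) (pr : prime p) (C : fieldType)
    (V : lmodType C) (pi : 'M[padicQ pr]_2 -> V -> V) (mu : 'F_p -> C)
    (v : V) : Prop :=
  [/\ v != 0, fixed_by pi 1 v
    & forall u : padicZ pr, u \is a GRing.unit ->
        pi (mx2 (ZtoQ u) 0 0 1) v = mu (residue u) *: v].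

(* Main.v *)
Require Import Defs.
From HB Require Import structures.
From mathcomp Require Import all_boot all_order all_algebra all_fingroup.
From mathcomp Require Import all_character all_field.
From mathcomp Require Import fraction boolp reals complex.
From mathcomp Require Import generic_quotient cyclic ring zify.

Set Implicit Arguments.
Unset Strict Implicit.
Unset Printing Implicit Defensive.

Import Order.TTheory GRing.Theory Num.Theory.
Local Open Scope ring_scope.

(** The weight vectors lie in the space of vectors fixed by the matrices
    congruent to 1 modulo p, which is the cuspidal representation [rho] of
    GL_2(F_p); there the torus acts, up to the central character, through the
    nonsplit torus F^* of GL_2(F_p). A vector of weight [mu] spans the image of
    the rank one projection e_mu for the split torus, so its [chi]-component is
    nonzero as soon as tr (e_chi e_mu) is nonzero. Up to factors prime to p,
    this trace is a sum of values of the character of [rho] times roots of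
    unity; the idea is to compute it modulo the prime [P] above p.

    Cuspidality determines the character of [rho]: the sum of the operators of
    the unipotent subgroup vanishes, which gives the value 0 on split regular
    elements and -1 on unipotents ([tr_split], [tr_unip]). Hence modulo [P] the
    character is that of a sum of two twisted symmetric powers,
    Sym^(a-b-2) times det^(b+1) and Sym^(p-1-(a-b)) times det^a
    ([tr_reduces]). No lattice has to be reduced, since traces are enough.

    In Sym^n, after diagonalising the nonsplit torus over F, averaging over
    both tori leaves the product of an entry of Sym^n(Q) and one of
    Sym^n(Q^-1), where Q is the matrix of eigenvectors of the nonsplit torus
    ([constituent_sum]). The row of the middle weight consists of the
    coefficients of (X^2 - 1)^(n/2), which are nonzero exactly at even
    exponents; the next row is that of (X^2 - 1)^(n/2-1) (X - 1)^2, nonzero at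
    odd exponents ([symmx_middle_neq0], [symmx_next_neq0]). The column entry
    is handled by a reciprocity between Sym^n(g) and Sym^n of the transpose
    ([symmx_tr]). In terms of the label t, the first symmetric power carries
    the characters with 0 < t < a - b, those of Type 1, and the second those
    with a - b < t <= p; the exponent is even exactly when t is odd. This
    proves all the nonvanishing assertions ([torus_sum_neq0]).

    Vanishing is an exact statement in characteristic zero. The square root of
    [xi] lies in the nonsplit torus and is antidiagonal. Since mu_1 and mu_2
    are self-dual with respect to the central character, it multiplies the
    weight vector by a scalar c, and chi can occur only if its value there is
    c. These values are proportional to (-1)^t, and an odd t does occur, so no
    even t does ([undetected_not_test]).

    On the p-adic side, every element of K^* is a p-adic number times a
    primitive x + y sqrt(xi), whose class modulo p is nonzero because [xi] is
    not a square modulo p, by Newton iteration ([padicQ_primitive],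
    [residue_square]). So residual eigenprojections are eigenprojections for
    K^* ([test_vector_residual]), and independence of characters handles
    arbitrary decompositions ([eigenvectors_independent]). *)

(** * Symmetric powers of two by two matrices *)
Lemma mx2E (A : Type) (a b c d : A) :
  (mx2 a b c d 0 0 = a) * (mx2 a b c d 0 1 = b) *
  (mx2 a b c d 1 0 = c) * (mx2 a b c d 1 1 = d).
Proof. by rewrite !mxE. Qed.

Lemma mx2P (A : Type) (M N : 'M[A]_2) :
  M 0 0 = N 0 0 -> M 0 1 = N 0 1 -> M 1 0 = N 1 0 -> M 1 1 = N 1 1 -> M = N.
Proof.
move=> h00 h01 h10 h11; apply/matrixP.
have I2 (i : 'I_2) : i = 0 \/ i = 1.
  by case: i => [[|[|//]] Hi]; [left|right]; apply/val_inj.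
by move=> i j; case: (I2 i) => ->; case: (I2 j) => ->.
Qed.

Lemma mul_mx2 (A : pzRingType) (M N : 'M[A]_2) i j :
  (M *m N) i j = M i 0 * N 0 j + M i 1 * N 1 j.
Proof.
rewrite mxE big_ord_recl big_ord1; congr (_ + M i _ * N _ j); exact: val_inj.
Qed.

Lemma det_mx2E (A : comPzRingType) (M : 'M[A]_2) :
  \det M = M 0 0 * M 1 1 - M 0 1 * M 1 0.
Proof.
rewrite (expand_det_row _ 0) big_ord_recl big_ord1 /cofactor !det_mx11 !mxE /=.
rewrite /bump /= addn0 expr0 expr1 mul1r mulN1r mulrN.
by congr (M _ _ * M _ _ - M _ _ * M _ _); apply/val_inj.
Qed.

(** Row [i] is the image of [X^i Y^(n-i)] under the linear substitution given
    by [g], dehomogenised at [Y = 1]. *)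
Definition symrow (A : comNzRingType) n (g : 'M[A]_2) (i : nat) : {poly A} :=
  (g 0 0 *: 'X + (g 0 1)%:P) ^+ i * (g 1 0 *: 'X + (g 1 1)%:P) ^+ (n - i).

Definition symmx (A : comNzRingType) n (g : 'M[A]_2) : 'M[A]_n.+1 :=
  \matrix_(i, j) (symrow n g i)`_j.

(** Substitution of [U] and [V] for the variables of a form of degree [n]
    given by its dehomogenised polynomial; composing two such substitutions
    is what makes [symmx] multiplicative. *)
Definition homog_subst (A : comNzRingType) n (U V p : {poly A}) : {poly A} :=
  \sum_(k < n.+1) p`_k *: (U ^+ k * V ^+ (n - k)).

Lemma size_lin (A : comNzRingType) (a b : A) : (size (a *: 'X + b%:P)%R <= 2)%N.
Proof. by rewrite -mul_polyC size_MXaddC; case: ifP => // _;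
  rewrite ltnS size_polyC leq_b1. Qed.

Lemma size_lin_exp (A : comNzRingType) (a b : A) i :
  (size ((a *: 'X + b%:P) ^+ i)%R <= i.+1)%N.
Proof.
apply: leq_trans (size_poly_exp_leq _ _) _; rewrite ltnS.
by rewrite -{2}(mul1n i) leq_mul2r -subn1 leq_subLR size_lin orbT.
Qed.

Lemma homog_subst_lin (A : comNzRingType) n (U V p : {poly A}) a b :
  (size p <= n.+1)%N ->
  homog_subst n.+1 U V ((a *: 'X + b%:P) * p) = (a *: U + b *: V) *
    homog_subst n U V p.
Proof.
move=> sp; rewrite mulrDl /homog_subst.
under eq_bigr do rewrite coefD -scalerAl coefZ mul_polyC coefZ coefXM scalerDl.
rewrite big_split /= big_ord_recl /= mulr0 scale0r add0r.
rewrite [X in _ + X]big_ord_recr /= [p`_n.+1]nth_default // mulr0 scale0r addr0.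
rewrite mulrDl !mulr_sumr; congr (_ + _); apply: eq_bigr => k _.
  by rewrite /bump /= add1n subSS -!(scalerAl, scalerAr) scalerA exprS mulrA.
rewrite -!(scalerAl, scalerAr) scalerA subSn; last by rewrite -ltnS.
by congr (_ *: _); rewrite exprS !mulrA [V * _]mulrC.
Qed.

Lemma homog_subst_lin_exp (A : comNzRingType) i j (U V : {poly A}) a b c d :
  homog_subst (i + j) U V ((a *: 'X + b%:P) ^+ i * (c *: 'X + d%:P) ^+ j)
  = (a *: U + b *: V) ^+ i * (c *: U + d *: V) ^+ j.
Proof.
elim: i => [|i IHi].
  rewrite !expr0 !mul1r add0n; elim: j => [|j IHj].
    by rewrite /homog_subst big_ord1 !expr0 mulr1 coef1 scale1r.
  by rewrite !exprS homog_subst_lin ?IHj // size_lin_exp.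
rewrite addSn !exprS -!mulrA homog_subst_lin ?IHi //.
apply: leq_trans (size_polyMleq _ _) _.
by rewrite -subn1 leq_subLR add1n -addnS -addSn leq_add ?size_lin_exp.
Qed.

Lemma symmxM (A : comNzRingType) n (g h : 'M[A]_2) :
  symmx n (g *m h) = symmx n g *m symmx n h.
Proof.
apply/matrixP => i j; rewrite !mxE.
have -> : symrow n (g *m h) i = \sum_(k < n.+1) (symrow n g i)`_k *: symrow n
  h k.
  have := homog_subst_lin_exp i (n - i) (h 0 0 *: 'X + (h 0 1)%:P)
    (h 1 0 *: 'X + (h 1 1)%:P) (g 0 0) (g 0 1) (g 1 0) (g 1 1).
  rewrite (subnKC (leq_ord i)) -/(symrow n g i) -/(symrow n h _) => eqh.
  rewrite /symrow !mul_mx2 [LHS](_ : _ = homog_subst n (h 0 0 *: 'X + (h 0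
    1)%:P)
    (h 1 0 *: 'X + (h 1 1)%:P) (symrow n g i)) // eqh.
  rewrite !scalerDr !scalerA -!mul_polyC !polyCD !polyCM !mulrDl !mul_polyC.
  by congr (_ ^+ _ * _ ^+ _); rewrite -!addrA; congr (_ + _);
     rewrite addrCA.
by rewrite coef_sum; apply: eq_bigr => k _; rewrite coefZ !mxE.
Qed.

Lemma symmx_diag (A : comNzRingType) n (a d : A) :
  symmx n (mx2 a 0 0 d) = diag_mx (\row_(i < n.+1) (a ^+ i * d ^+ (n - i))).
Proof.
apply/matrixP => i j; rewrite !mxE /symrow !mx2E scale0r addr0 add0r.
rewrite exprZn -polyC_exp mulrC mul_polyC !coefZ coefXn eq_sym mulrC.
by rewrite -!val_eqE /= eq_sym; case: eqP => _;
  rewrite ?mulr1 // mulr0 mul0r mulr0n.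
Qed.

Lemma tr_symmx_utri (A : comNzRingType) n (a x d : A) :
  \tr (symmx n (mx2 a x 0 d)) = \sum_(i < n.+1) a ^+ i * d ^+ (n - i).
Proof.
apply: eq_bigr => i _; rewrite mxE /symrow !mx2E scale0r add0r.
rewrite -polyC_exp mulrC mul_polyC coefZ mulrC; congr (_ * _).
rewrite exprDn coef_sum big_ord_recl /= subn0 bin0 mulr1n expr0 mulr1.
rewrite exprZn coefZ coefXn eqxx mulr1 big1 ?addr0 // => k _.
rewrite -polyC_exp mulrC coefMn mul_polyC coefZ exprZn coefZ coefXn.
rewrite /bump /= add1n [_ == _](_ : _ = false) ?mulr0 ?mul0rn //.
have i0 : (0 < i)%N by apply: leq_trans (ltn_ord k).
by rewrite eq_sym ltn_eqF // -subSn // subSS leq_subr.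
Qed.

(** A matrix entry is a coefficient of a two-variable form that is symmetric
    under transposition: both sides of the reciprocity are the coefficient of
    [U^i X^j] in the n-th power of the bilinear form of [g]. *)
Lemma symmx_tr (A : comNzRingType) n (g : 'M[A]_2) (i j : 'I_n.+1) :
  symmx n g i j *+ 'C(n, i) = symmx n g^T j i *+ 'C(n, j).
Proof.
pose E (h : 'M[A]_2) : {poly {poly A}} :=
  ((h 0 0 *: 'X + (h 0 1)%:P)%:P * 'X + (h 1 0 *: 'X + (h 1 1)%:P)%:P) ^+ n.
have coefE h (k l : 'I_n.+1) : (E h)`_k`_l = symmx n h k l *+ 'C(n, k).
  rewrite mxE -coefMn; congr (_ `_ l).
  rewrite /E addrC exprDn coef_sum (bigD1 k) //= big1 => [|m mk].
    rewrite addr0 coefMn exprMn -!polyC_exp mulrA -polyCM.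
    by rewrite coefCM coefXn eqxx mulr1 mulrC.
  rewrite coefMn exprMn -!polyC_exp mulrA -polyCM coefCM coefXn.
  by rewrite val_eqE eq_sym (negPf mk) mulr0 mul0rn.
rewrite -!coefE -coef_swapXY; suff -> : swapXY (E g) = E g^T by [].
rewrite /E rmorphXn /=; congr (_ ^+ n).
rewrite rmorphD rmorphM /= swapXY_X !swapXY_polyC !rmorphD /= !map_polyZ /=.
rewrite !map_polyX !map_polyC /= !mxE -!mul_polyC !polyCM !mulrDl -!addrA.
by congr (_ + _); [rewrite mulrAC|rewrite addrCA].
Qed.

Lemma natr_bin_neq0 (F : fieldType) p n k : p \in [pchar F] ->
  (n < p)%N -> (k <= n)%N -> 'C(n, k)%:R != 0 :> F.
Proof.
move=> pF np kn; have fact0 m : (m < p)%N -> m`!%:R != 0 :> F.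
  elim: m => [|m IHm] mp; first by rewrite oner_eq0.
  rewrite factS natrM mulf_neq0 ?IHm ?(ltnW mp) //.
  by rewrite -(dvdn_pcharf pF) gtnNdvd.
have := fact0 n np; apply: contra => /eqP C0.
by rewrite -(bin_fact kn) natrM C0 mul0r.
Qed.

Lemma coef_XsubC_exp (A : comNzRingType) h j :
  (('X - 1) ^+ h : {poly A})`_j = (-1) ^+ (h - j) *+ 'C(h, j).
Proof.
rewrite addrC exprDn coef_sum.
under eq_bigr do rewrite -polyCN -polyC_exp -mulrnAl -polyCMn coefCM coefXn.
case: (ltnP j h.+1) => jh; last first.
  rewrite bin_small // mulr0n big1 // => k _.
  by rewrite gtn_eqF ?mulr0 // (leq_trans (ltn_ord k)).
rewrite (bigD1 (Ordinal jh)) //= eqxx mulr1 big1 ?addr0 // => k kj.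
by rewrite [_ == _](_ : _ = false) ?mulr0 // eq_sym; apply: negPf kj.
Qed.

(** Writing the middle row as a polynomial in [X^2] separates the parities of
    the exponents. *)
Lemma square_sub_exp (A : comNzRingType) h :
  ('X + 1) ^+ h * ('X - 1) ^+ h = (('X - 1) ^+ h : {poly A}) \Po 'X^2.
Proof.
rewrite -exprMn rmorphXn /= rmorphB /= comp_polyX comp_polyC.
by rewrite mulrC -subr_sqr expr1n.
Qed.

Lemma coef_middle_row (A : comNzRingType) h j :
  (('X + 1) ^+ h * ('X - 1) ^+ h : {poly A})`_(j.*2)
  = (-1) ^+ (h - j) *+ 'C(h, j).
Proof.
rewrite square_sub_exp coef_comp_poly_Xn // -muln2 dvdn_mull // mulnK //.
exact: coef_XsubC_exp.
Qed.

Lemma coef_next_row (A : comNzRingType) h j :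
  (('X + 1) ^+ h * ('X - 1) ^+ h.+2 : {poly A})`_(j.*2.+1)
  = - ((-1) ^+ (h - j) *+ 'C(h, j)) *+ 2.
Proof.
rewrite -addn2 exprD mulrA square_sub_exp.
have odd0 k : odd k -> ((('X - 1) ^+ h : {poly A}) \Po 'X^2)`_k = 0.
  by move=> ok; rewrite coef_comp_poly_Xn // dvdn2 ok.
rewrite sqrrB expr1n mulr1 mulrDr mulrBr mulr1 coefD coefB coefMXn mulrnAr.
rewrite coefMn coefMX /= [if _ then _ else _](_ : _ = 0); last first.
  case: ltnP => // h2; apply: odd0.
  by case: j h2 => // j _; rewrite doubleS subSS subSS subn0 /= odd_double.
rewrite (odd0 j.*2.+1) ?add0r ?addr0 /= ?odd_double //.
by rewrite -square_sub_exp coef_middle_row mulNrn.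
Qed.

Lemma symrow_nonsplit (A : comNzRingType) n (c s : A) i :
  symrow n (mx2 c c s (- s)) i =
  (c ^+ i * s ^+ (n - i)) *: (('X + 1) ^+ i * ('X - 1) ^+ (n - i)).
Proof.
rewrite /symrow !mx2E.
have -> : c *: 'X + c%:P = c *: ('X + 1) by rewrite scalerDr alg_polyC.
have -> : s *: 'X + (- s)%:P = s *: ('X - 1).
  by rewrite scalerBr alg_polyC polyCN.
by rewrite !exprZn -scalerAl -scalerAr scalerA.
Qed.

Lemma symmx_nonsplit_tr (F : fieldType) p n (i j : 'I_n.+1) (c s : F) :
  p \in [pchar F] -> (n < p)%N ->
  symmx n (mx2 c c s (- s)) i j != 0 ->
  symmx n (mx2 c s c (- s)) j i != 0.
Proof.
move=> pF np; apply: contra => /eqP hji.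
have -> : mx2 c c s (- s) = (mx2 c s c (- s))^T.
  by apply: mx2P; rewrite !mxE.
have := symmx_tr (mx2 c s c (- s)) j i; rewrite hji mul0rn => /esym/eqP.
by rewrite -mulr_natr mulf_eq0 (negPf (natr_bin_neq0 pF np _)) ?orbF ?leq_ord.
Qed.

(** In coordinates where the nonsplit torus is diagonal, the middle weight
    vector is a power of [X^2 - 1]; only even exponents occur, and their
    binomial coefficients do not vanish modulo [p]. *)
Lemma symmx_middle_neq0 (F : fieldType) p h (i j : 'I_h.*2.+1) (c s : F) :
  p \in [pchar F] -> (h.*2 < p)%N -> c != 0 -> s != 0 ->
  i = h :> nat -> ~~ odd j ->
  symmx h.*2 (mx2 c c s (- s)) i j != 0.
Proof.
move=> pF hp c0 s0 ih oj; rewrite mxE symrow_nonsplit ih.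
have -> : (h.*2 - h = h)%N by rewrite -addnn addnK.
have -> : (j : nat) = (j./2).*2 by rewrite -{1}(odd_double_half j) (negPf oj).
have jh : (j./2 <= h)%N by rewrite -leq_double (leq_trans _ (leq_ord j)) //
  -{2}(odd_double_half j) leq_addl.
rewrite coefZ coef_middle_row -mulr_natr !mulf_neq0 ?expf_neq0 ?oppr_eq0
  ?oner_eq0 //.
by apply: natr_bin_neq0 pF _ jh; apply: leq_ltn_trans hp;
  rewrite -addnn leq_addr.
Qed.

(** One step off the middle, the factor [(X - 1)^2] contributes its cross term
    [-2 X], which is what the odd exponents see. *)
Lemma symmx_next_neq0 (F : fieldType) p h (i j : 'I_h.+1.*2.+1) (c s : F) :
  p \in [pchar F] -> (h.+1.*2 < p)%N -> c != 0 -> s != 0 ->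
  i = h :> nat -> odd j ->
  symmx h.+1.*2 (mx2 c c s (- s)) i j != 0.
Proof.
move=> pF hp c0 s0 ih oj; rewrite mxE symrow_nonsplit ih.
have -> : (h.+1.*2 - h = h.+2)%N by rewrite -addnn addSnnS addKn.
have ej : (j : nat) = (j./2).*2.+1 by rewrite -{1}(odd_double_half j) oj.
have jh : (j./2 <= h)%N.
  by rewrite -leq_double -ltnS -ej -ltnS -doubleS ltn_neqAle -ltnS ltn_ord
    andbT;
     apply: contraL oj => /eqP ->; rewrite odd_double.
have hp' : (2 < p)%N by apply: leq_ltn_trans hp.
have C0 : 'C(h, j./2)%:R != 0 :> F.
  apply: natr_bin_neq0 pF _ jh; apply: leq_ltn_trans hp.
  by rewrite -addnn addSnnS leq_addr.
have two0 : 2%:R != 0 :> F by rewrite -(dvdn_pcharf pF) gtnNdvd.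
rewrite coefZ ej coef_next_row -(mulr_natr _ 2) -(mulr_natr _ 'C(_, _)).
apply: mulf_neq0; first by rewrite mulf_neq0 ?expf_neq0.
by rewrite mulf_neq0 // oppr_eq0 mulf_neq0 // expf_neq0 // oppr_eq0 oner_eq0.
Qed.

(** * p-adic integers *)

Lemma intr_modz (A : pzRingType) (d z : int) :
  d%:~R = 0 :> A -> (z %% d)%Z%:~R = z%:~R :> A.
Proof.
by move=> d0; rewrite /modz intrB intrM d0 mulr0 subr0.
Qed.

Lemma expn1_Fp (p : nat) : prime p -> (p ^ 1)%N%:~R = 0 :> 'F_p.
Proof. by move=> pr; rewrite expn1 -pmulrn pchar_Fp_0. Qed.

Fact residue_zmod (p : nat) (pr : prime p) : zmod_morphism (@residue p pr).
Proof.
move=> x y; rewrite /residue /= modzDmr intr_modz ?expn1_Fp //.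
by rewrite -intrB.
Qed.

Fact residue_monoid (p : nat) (pr : prime p) : monoid_morphism (@residue p pr).
Proof.
by split=> [|x y]; rewrite /residue /= intr_modz ?expn1_Fp // intrM.
Qed.

HB.instance Definition _ (p : nat) (pr : prime p) :=
  GRing.isZmodMorphism.Build (padicZ pr) 'F_p (@residue p pr)
    (@residue_zmod p pr).
HB.instance Definition _ (p : nat) (pr : prime p) :=
  GRing.isMonoidMorphism.Build (padicZ pr) 'F_p (@residue p pr)
    (@residue_monoid p pr).
HB.instance Definition _ (p : nat) (pr : prime p) :=
  GRing.RMorphism.copy (@ZtoQ p pr) (@FracField.tofrac (padicZ pr)).

Lemma padicZ_natE (p : nat) (pr : prime p) (m n : nat) :
  (m%:R : padicZ pr) n = (m%:Z %% (p ^ n)%N)%Z.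
Proof.
elim: m => [|m IHm] //; rewrite mulrS /= IHm modzDml modzDmr.
by rewrite -[m.+1%:Z]/((1 + m)%N%:Z) PoszD.
Qed.

Lemma residue_lift (p : nat) (pr : prime p) (c : 'F_p) :
  residue ((c : nat)%:R : padicZ pr) = c.
Proof. by rewrite rmorph_nat natr_Zp. Qed.

(** Divisibility by [p^n], the form in which congruences survive products. *)
Definition pdvd (p : nat) (pr : prime p) (n : nat) (x : padicZ pr) : Prop :=
  exists y, x = p%:R ^+ n * y.

Lemma pdvd_seq (p : nat) (pr : prime p) n (x : padicZ pr) :
  pdvd n x -> x n = 0.
Proof.
case=> y ->; rewrite -natrX /= padicZ_natE modzz.
by rewrite mul0r mod0z.
Qed.

Lemma pdvdM (p : nat) (pr : prime p) m n (x y : padicZ pr) :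
  pdvd m x -> pdvd n y -> pdvd (m + n) (x * y).
Proof. by case=> u -> [v ->]; exists (u * v); rewrite exprD mulrACA. Qed.

Lemma pdvdD (p : nat) (pr : prime p) n (x y : padicZ pr) :
  pdvd n x -> pdvd n y -> pdvd n (x + y).
Proof. by case=> u -> [v ->]; exists (u + v); rewrite mulrDr. Qed.

Lemma pdvdMr (p : nat) (pr : prime p) n (x y : padicZ pr) :
  pdvd n x -> pdvd n (x * y).
Proof. by case=> u ->; exists (u * y); rewrite mulrA. Qed.

Lemma pdvd_leq (p : nat) (pr : prime p) m n (x : padicZ pr) :
  (m <= n)%N -> pdvd n x -> pdvd m x.
Proof.
by move=> /subnKC <- [u ->]; exists (p%:R ^+ (n - m) * u); rewrite exprD mulrA.
Qed.

Lemma pdvd_eq (p : nat) (pr : prime p) n (x y : padicZ pr) :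
  pdvd n (x - y) -> x n = y n.
Proof.
move=> /pdvd_seq xy0; rewrite -[x in LHS](subrK y).
by rewrite -[LHS]/(((x - y) n + y n) %% _)%Z xy0 add0r padicZ_mod.
Qed.

(** The quotient by [p] of a coherent sequence is the shifted sequence
    [x (m + 1) / p]. *)
Lemma residue_eq0 (p : nat) (pr : prime p) (x : padicZ pr) :
  residue x = 0 -> exists y, x = p%:R * y.
Proof.
move=> rx0; have p0 : (0 < p)%N := prime_gt0 pr.
have x1 : x 1%N = 0.
  have := padicZ_mod x 1; rewrite expn1 => x1.
  have := modz_ge0 (x 1%N) (_ : p%:Z != 0);
    have := ltz_pmod (x 1%N) (_ : 0 < p%:Z).
  rewrite x1 !eqz_nat -lt0n ltz_nat => /(_ p0) xp /(_ p0).
  move: rx0 xp; rewrite /residue; case: (x 1%N) => // m /eqP.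
  rewrite -pmulrn -(dvdn_pcharf (pchar_Fp pr)) => dm mp _.
  by rewrite ltz_nat in mp; rewrite -(modn_small mp) (eqP dm).
have dvdx m : (p%:Z %| x m.+1)%Z.
  apply/dvdz_mod0P; rewrite -[X in (_ %% X)%Z]/((p%N)%:Z) -{2}(expn1 p).
  by have := padicZ_modk x 1 m; rewrite add1n x1.
have coh : `[< coherent p (fun m => (x m.+1 %/ p)%Z) >].
  apply/asboolP => m; have p0z : p%:Z != 0 by rewrite eqz_nat -lt0n.
  apply: (mulIf p0z); rewrite divzK // -padicZE.
  rewrite -{1}(divzK (dvdx m.+1)) expnS [(p * _)%N]mulnC PoszM.
  by rewrite /modz divzMpr ?ltz_nat // mulrA -mulrBl.
by exists (PadicZ pr coh); apply: padicZ_ext => m /=;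
  rewrite padicZ_natE modzMml mulrC divzK // padicZE.
Qed.

Lemma padicZ_lim (p : nat) (pr : prime p) (f : nat -> padicZ pr) :
  (forall n, f n.+1 n = f n n) -> exists y : padicZ pr, forall n, y n = f n n.
Proof.
move=> fS; have coh : `[< coherent p (fun n => f n n) >].
  by apply/asboolP => n; rewrite -fS -padicZE.
by exists (PadicZ pr coh).
Qed.

(** Newton iteration with the fixed slope [e], valid for any residue-preserving
    contraction; it serves both for inverses and for square roots. *)
Lemma padicZ_newton (p : nat) (pr : prime p) (G : padicZ pr -> padicZ pr)
    (e y0 : padicZ pr) :
  (forall (x y : padicZ pr) n, x n = y n -> G x n = G y n) ->
  pdvd 1 (G y0) ->
  (forall y n, residue y = residue y0 -> pdvd n.+1 (G y) ->
     pdvd n.+2 (G (y - G y * e))) ->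
  exists y, G y = 0.
Proof.
move=> G_seq G0 G_step; pose f n := iter n (fun y => y - G y * e) y0.
have f_inv n : residue (f n) = residue y0 /\ pdvd n.+1 (G (f n)).
  elim: n => [|n [IHr IHd]]; first by [].
  split; last exact: G_step.
  have [z Gz] := pdvd_leq (ltn0Sn n) IHd.
  by rewrite /= rmorphB rmorphM /= -/(f n) Gz expr1 rmorphM rmorph_nat /=
    pchar_Fp_0 // !mul0r subr0.
have [|y yf] := @padicZ_lim p pr f.
  move=> n; apply: pdvd_eq; rewrite /= -/(f n) addrAC subrr sub0r.
  have [_ /(pdvd_leq (leqnSn n))/pdvdMr d] := f_inv n.
  by rewrite -mulrN; exact: d.
exists y; apply: padicZ_ext => n; rewrite (G_seq _ (f n)) //.
rewrite (pdvd_seq (pdvd_leq (leqnSn n) (f_inv n).2)).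
by rewrite /= mod0z.
Qed.

Lemma pdvd1P (p : nat) (pr : prime p) (x : padicZ pr) :
  residue x = 0 -> pdvd 1 x.
Proof. by case/residue_eq0 => y ->; exists y; rewrite expr1. Qed.

Lemma residue_unit (p : nat) (pr : prime p) (x : padicZ pr) :
  (x \is a GRing.unit) = (residue x != 0).
Proof.
apply/idP/idP => [ux|rx0].
  by rewrite -unitfE; exact: rmorph_unit.
pose e : padicZ pr := ((residue x)^-1 : nat)%:R.
have xe : pdvd 1 (1 - x * e).
  by apply: pdvd1P; rewrite rmorphB rmorph1 rmorphM /= residue_lift mulfV
    ?subrr.
have [|||y /eqP] := @padicZ_newton p pr (fun y => x * y - 1) e e.
- by move=> u v n uv /=; rewrite uv.
- by case: xe => z ez; exists (- z); rewrite mulrN -ez opprB.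
- move=> u n _ dn; rewrite -addn1.
  have -> : x * (u - (x * u - 1) * e) - 1 = (x * u - 1) * (1 - x * e).
    by ring.
  exact: pdvdM.
by rewrite subr_eq0 => /eqP xy1; apply/unitrPr; exists y.
Qed.

Lemma residue_square (p : nat) (pr : prime p) (x : padicZ pr) (c : 'F_p) :
  odd p -> x \is a GRing.unit -> residue x = c ^+ 2 -> exists y, y ^+ 2 = x.
Proof.
move=> p_odd; rewrite residue_unit => ux xc.
have c0 : c != 0 by apply: contra ux => /eqP c0; rewrite xc c0 expr0n.
have two0 : 2%:R != 0 :> 'F_p.
  rewrite -(dvdn_pcharf (pchar_Fp pr)) dvdn_prime2 //.
  by apply: contraL p_odd => /eqP ->.
pose y0 : padicZ pr := (c : nat)%:R.
pose e : padicZ pr := ((2%:R * c)^-1 : nat)%:R.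
have [|||y /eqP] := @padicZ_newton p pr (fun y => y ^+ 2 - x) e y0.
- by move=> u v n uv /=; rewrite uv.
- by apply: pdvd1P; rewrite rmorphB rmorphXn /= residue_lift xc subrr.
- move=> u n ru dn; rewrite -addn1.
  have -> : (u - (u ^+ 2 - x) * e) ^+ 2 - x =
    (u ^+ 2 - x) * (1 - 2%:R * u * e) + (u ^+ 2 - x) * (u ^+ 2 - x) * e ^+ 2.
    by ring.
  apply: pdvdD; last by apply: pdvdMr; apply: pdvd_leq (pdvdM dn dn); lia.
  apply: pdvdM => //; apply: pdvd1P; rewrite rmorphB rmorph1 !rmorphM /=.
  by rewrite rmorph_nat ru !residue_lift mulfV ?subrr // mulf_neq0.
by rewrite subr_eq0 => /eqP yx; exists y.
Qed.

(** Descent on the first index where one of the two sequences is nonzero: each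
    division by [p] lowers it by one. *)
Lemma padicZ_primitive (p : nat) (pr : prime p) (x y : padicZ pr) :
  (x, y) != (0, 0) -> exists l x0 y0 : padicZ pr,
    [/\ l != 0, x = l * x0, y = l * y0 & (residue x0, residue y0) != (0, 0)].
Proof.
move=> xy0; have [n xyn] : exists n, (x n != 0) || (y n != 0).
  move: xy0; rewrite xpair_eqE negb_and.
  by case/orP => /padicZ_neq0P[n nz]; exists n; rewrite nz ?orbT.
have p0 : p%:R != 0 :> padicZ pr.
  apply/eqP => /(congr1 (fun z : padicZ pr => z 2%N)); rewrite padicZ_natE.
  rewrite /= mod0z modz_small ?ltz_nat ?ltn_Pmull ?prime_gt1 ?prime_gt0 //.
    by move=> [p0]; move: (prime_gt0 pr); rewrite p0.
have pM (z : padicZ pr) m : (p%:R * z) m.+1 != 0 -> z m != 0.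
  apply: contra => /eqP zm; rewrite /= padicZ_natE modzMml.
  move: (padicZE z m); rewrite zm => /eqP zm0.
  have /dvdzP[q ->] : (((p ^ m)%N)%:Z %| z m.+1)%Z by apply/dvdz_mod0P/eqP.
  by rewrite mulrC -mulrA -PoszM -expnSr modzMl.
elim: n => [|n IHn] in x y xy0 xyn *.
  by case/orP: xyn; rewrite -padicZ_mod expn0 modz1.
have [|rxy] := boolP ((residue x, residue y) == (0, 0)); last first.
  by exists 1, x, y; rewrite oner_eq0 !mul1r.
case/eqP => /residue_eq0[x' x'E] /residue_eq0[y' y'E].
have [||l [x0 [y0 [l0 xE yE xy0']]]] := IHn x' y'.
- by apply: contra xy0 => /eqP[x0 y0]; rewrite x'E y'E x0 y0 !mulr0.
- by move: xyn; rewrite x'E y'E => /orP[] /pM ->; rewrite ?orbT.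
by exists (p%:R * l), x0, y0; rewrite mulf_neq0 // -!mulrA -xE -yE.
Qed.

Lemma frac_numden (A : idomainType) (x : {fraction A}) :
  exists n d : A, d != 0 /\ x = FracField.tofrac n / FracField.tofrac d.
Proof.
elim/quotW: x => r.
exists (frac r).1, (frac r).2; have r0 := denom_ratioP r; split=> //.
apply: (canRL (mulfK _)); first by rewrite tofrac_eq0.
apply/eqP; rewrite -[_ * _]/(FracField.mul _ _) !piE /FracField.mulf /=.
rewrite !numden_Ratio ?mulf_neq0 ?oner_neq0 //.
by rewrite FracField.equivfE !numden_Ratio ?mulf_neq0 ?oner_neq0 // !mulr1
  mulrC.
Qed.

Lemma ZtoQ_inj (p : nat) (pr : prime p) : injective (@ZtoQ p pr).
Proof. by move=> x y /eqP; rewrite /ZtoQ tofrac_eq => /eqP. Qed.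

Lemma padicQ_primitive (p : nat) (pr : prime p) (x y : padicQ pr) :
  (x, y) != (0, 0) -> exists (l : padicQ pr) (x0 y0 : padicZ pr),
    [/\ l != 0, x = l * ZtoQ x0, y = l * ZtoQ y0
      & (residue x0, residue y0) != (0, 0)].
Proof.
have [n1 [d1 [d10 ->]]] := frac_numden x.
have [n2 [d2 [d20 ->]]] := frac_numden y => nz.
rewrite -!/(ZtoQ _) in nz *.
have D10 : ZtoQ d1 != 0 by rewrite tofrac_eq0.
have D20 : ZtoQ d2 != 0 by rewrite tofrac_eq0.
have [|l [x0 [y0 [l0 xE yE xy0]]]] := @padicZ_primitive p pr (n1 * d2) (n2 *
  d1).
  apply: contra nz; rewrite !xpair_eqE !mulf_eq0 (negPf d10) (negPf d20) !orbF.
  by case/andP=> /eqP-> /eqP->; rewrite rmorph0 !eqxx.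
have quot n d : ZtoQ d != 0 -> forall d', ZtoQ d' != 0 ->
    ZtoQ n / ZtoQ d = ZtoQ (n * d') / (ZtoQ d * ZtoQ d') :> padicQ pr.
  move=> d0 d' d'0; rewrite [ZtoQ (n * d')]rmorphM -mulf_div.
  by rewrite [ZtoQ d' / _]divff ?mulr1.
exists (ZtoQ l / (ZtoQ d1 * ZtoQ d2)), x0, y0; split.
- by rewrite mulf_neq0 ?invr_eq0 ?mulf_neq0 ?tofrac_eq0.
- by rewrite (quot _ _ D10 _ D20) xE [ZtoQ (l * x0)]rmorphM mulrAC.
- by rewrite (quot _ _ D20 _ D10) yE [ZtoQ (l * y0)]rmorphM mulrAC [_ * ZtoQ
    d1]mulrC.
- exact: xy0.
Qed.

Lemma residue_nonsquare (p : nat) (pr : prime p) (xi : padicZ pr) (c : 'F_p) :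
  odd p -> xi \is a GRing.unit -> (forall y : padicZ pr, y ^+ 2 != xi) ->
  c ^+ 2 != residue xi.
Proof.
move=> p_odd xi_unit xi_ns; apply/eqP => /esym xic.
by have [y /eqP] := residue_square p_odd xi_unit xic; apply/negP/xi_ns.
Qed.

(** An equation [x^2 = xi y^2] between p-adic numbers can be cleared of common
    powers of [p]; modulo [p] it would then make [xi] a square. *)
Lemma padicQ_anisotropic (p : nat) (pr : prime p) (xi : padicZ pr)
    (x y : padicQ pr) :
  (forall c : 'F_p, c ^+ 2 != residue xi) ->
  x ^+ 2 = ZtoQ xi * y ^+ 2 -> (x, y) = (0, 0).
Proof.
move=> xi_ns xy; apply/eqP; apply: contraT => /padicQ_primitive.
move=> [l [x0 [y0 [l0 xE yE]]]]; apply: contraNT => _.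
have: ZtoQ (x0 ^+ 2) = ZtoQ (xi * y0 ^+ 2).
  rewrite [RHS]rmorphM !rmorphXn; apply: (mulfI (expf_neq0 2 l0)).
  by rewrite -exprMn -xE xy yE exprMn mulrCA.
move=> /ZtoQ_inj.
move/(congr1 (@residue p pr)); rewrite rmorphXn [RHS]rmorphM rmorphXn /= => xy0.
have y00 : residue y0 == 0.
  apply: contraT => ry; case/negP: (xi_ns (residue x0 / residue y0)).
  by rewrite expr_div_n xy0 mulfK ?expf_neq0.
move: xy0; rewrite (eqP y00) expr0n mulr0 => /eqP.
by rewrite expf_eq0 /= => /eqP ->.
Qed.

Lemma Kelt_inj (p : nat) (pr : prime p) (xi : padicZ pr)
    (K : fieldExtType (padicQ pr)) (sK : K) (x y : padicQ pr) :
  (forall c : 'F_p, c ^+ 2 != residue xi) -> sK ^+ 2 = (ZtoQ xi)%:A ->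
  Kelt sK x y = 0 -> (x, y) = (0, 0).
Proof.
move=> xi_ns sK2 /eqP; rewrite /Kelt addr_eq0 -scaleNr => /eqP xy.
apply: (padicQ_anisotropic xi_ns); apply: (fmorph_inj (in_alg K)) => /=.
have -> : (x ^+ 2)%:A = x%:A ^+ 2 :> K by rewrite exprZn expr1n.
by rewrite xy exprZn sK2 scalerA sqrrN mulrC.
Qed.

Lemma Kelt_onto (p : nat) (pr : prime p) (xi : padicZ pr)
    (K : fieldExtType (padicQ pr)) (sK z : K) :
  (forall c : 'F_p, c ^+ 2 != residue xi) -> sK ^+ 2 = (ZtoQ xi)%:A ->
  \dim {: K} = 2%N -> exists x y, z = Kelt sK x y.
Proof.
move=> xi_ns sK2 dimK.
have sK0 : sK != 0.
  apply/eqP => sK0; have k0 : Kelt sK 0 1 = 0.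
    by rewrite /Kelt sK0 scaler0 scale0r addr0.
  by have /eqP := Kelt_inj xi_ns sK2 k0; rewrite xpair_eqE oner_eq0 andbF.
have free1 : free [:: 1; sK].
  rewrite free_cons seq1_free sK0 andbT span_seq1; apply/vlineP => -[k k1].
  have k0 : Kelt sK 1 (- k) = 0 by rewrite /Kelt scale1r scaleNr -k1 subrr.
  by have /eqP := Kelt_inj xi_ns sK2 k0; rewrite xpair_eqE oner_eq0.
have : z \in <<[:: 1%R; sK]>>%VS.
  have -> : <<[:: 1%R; sK]>>%VS = fullv; last exact: memvf.
  by apply/eqP; rewrite eqEdim subvf dimK (eqnP free1).
rewrite span_cons span_seq1 => /memv_addP[u /vlineP[x ->] [v /vlineP[y ->] ->]].
by exists x, y.
Qed.

(** * Finite fields *)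

Lemma card_pred_gt0 (F : finFieldType) : (0 < #|F|.-1)%N.
Proof. by rewrite -ltnS prednK ?finNzRing_gt1 // ltnW // finNzRing_gt1. Qed.

Lemma expf_card_pred (F : finFieldType) (x : F) : x != 0 -> x ^+ #|F|.-1 = 1.
Proof.
move=> x0; apply: (mulfI x0); rewrite mulr1 -exprS prednK ?expf_card //.
by rewrite ltnW // finNzRing_gt1.
Qed.

Lemma finField_generator (F : finFieldType) :
  exists g : F, #|F|.-1.-primitive_root g.
Proof.
have /hasP[g _ pg] : has #|F|.-1.-primitive_root (rem 0 (enum F)).
  apply: has_prim_root; first exact: card_pred_gt0.
  - apply/allP => x; rewrite mem_rem_uniq ?enum_uniq // !inE => /andP[x0 _].
    by apply/unity_rootP/expf_card_pred.
  - exact/rem_uniq/enum_uniq.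
  - by rewrite size_rem ?mem_enum // -cardE.
by exists g.
Qed.

Lemma generator_neq0 (F : finFieldType) (g : F) :
  #|F|.-1.-primitive_root g -> g != 0.
Proof.
move=> pg; apply/eqP => g0; have := prim_expr_order pg.
by rewrite g0 expr0n gtn_eqF ?card_pred_gt0 // => /eqP; rewrite eq_sym oner_eq0.
Qed.

Lemma generatorP (F : finFieldType) (g x : F) :
  #|F|.-1.-primitive_root g -> x != 0 ->
  exists2 k, (k < #|F|.-1)%N & x = g ^+ k.
Proof.
by move=> pg /expf_card_pred/(prim_rootP pg)[k ->]; exists k.
Qed.

(** Multiplying the variable by a generator [g] multiplies the sum by [g^m],
    which forces it to vanish unless [g^m = 1]. *)
Lemma finField_power_sum (F : finFieldType) m :
  \sum_(x : F | x != 0) x ^+ m = if (#|F|.-1 %| m)%N then -1 else 0.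
Proof.
have [dm|dm] := ifP.
  rewrite (eq_bigr (fun=> 1)) => [|x x0].
    rewrite sumr_const; apply/eqP; rewrite -addr_eq0 addrC -mulrS.
    have -> : #|[pred x : F | x != 0]|.+1 = #|F|.
      by rewrite [RHS](cardD1 (0%R : F)) inE add1n; congr _.+1;
        apply: eq_card => x; rewrite !inE andbT.
    by have /eqP := expg_cardG (in_setT (1 : F));
      rewrite cardsT FinRing.zmodXgE.
  by case/dvdnP: dm => k ->; rewrite mulnC exprM expf_card_pred ?expr1n.
have [g pg] := finField_generator F; have g0 := generator_neq0 pg.
set S := \sum_(_ | _) _; have gS : g ^+ m * S = S.
  rewrite mulr_sumr [RHS](reindex_onto (fun x => g * x) (fun x => g^-1 * x)) /=.
    apply: eq_big => x; last by rewrite exprMn.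
    by rewrite mulf_eq0 (negPf g0) mulKf // eqxx andbT.
  by move=> x _; rewrite mulVKf.
apply/eqP; have /eqP := gS; rewrite -subr_eq0 -{2}(mul1r S) -mulrBl mulf_eq0.
by rewrite subr_eq0 -(prim_order_dvd pg) dm.
Qed.

(** The map [Fp_in] is additive only in characteristic [p]; carrying that
    hypothesis as an argument lets it be a ring morphism. *)
Definition Fp_emb (p : nat) (F : finFieldType) of p \in [pchar F] : 'F_p -> F :=
  @Fp_in p F.

Lemma Fp_in_nat (p : nat) (F : finFieldType) n :
  p \in [pchar F] -> Fp_in F (n%:R : 'F_p) = n%:R.
Proof.
by move=> pF; rewrite /Fp_in val_Fp_nat ?(pcharf_prime pF) //
  GRing.natr_mod_pchar.
Qed.

Fact Fp_emb_zmod (p : nat) (F : finFieldType) (pF : p \in [pchar F]) :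
  zmod_morphism (Fp_emb pF).
Proof.
have embD (c d : 'F_p) : Fp_emb pF (c + d) = Fp_emb pF c + Fp_emb pF d.
  by rewrite /Fp_emb -[c in LHS]natr_Zp -[d in LHS]natr_Zp -natrD Fp_in_nat //
    natrD.
by move=> c d; apply/eqP; rewrite -subr_eq opprK -embD subrK.
Qed.

Fact Fp_emb_monoid (p : nat) (F : finFieldType) (pF : p \in [pchar F]) :
  monoid_morphism (Fp_emb pF).
Proof.
split=> [|c d]; first by rewrite /Fp_emb -[1]/(1%:R) Fp_in_nat.
by rewrite /Fp_emb -[c in LHS]natr_Zp -[d in LHS]natr_Zp -natrM Fp_in_nat //
  natrM.
Qed.

HB.instance Definition _ (p : nat) (F : finFieldType) (pF : p \in [pchar F]) :=
  GRing.isZmodMorphism.Build 'F_p F (Fp_emb pF) (Fp_emb_zmod pF).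
HB.instance Definition _ (p : nat) (F : finFieldType) (pF : p \in [pchar F]) :=
  GRing.isMonoidMorphism.Build 'F_p F (Fp_emb pF) (Fp_emb_monoid pF).

Lemma Fp_in_exp (p : nat) (F : finFieldType) (c : 'F_p) :
  p \in [pchar F] -> Fp_in F c ^+ p = Fp_in F c.
Proof.
move=> pF; have pr := pcharf_prime pF; rewrite -/(Fp_emb pF c) -rmorphXn /=.
by have := expf_card c; rewrite card_Fp // => ->.
Qed.

(** The polynomial [X^p - X] already has the [p] elements of the prime field
    as roots. *)
Lemma Fp_in_fixed (p : nat) (F : finFieldType) (z : F) :
  p \in [pchar F] -> z ^+ p = z -> exists c : 'F_p, z = Fp_in F c.
Proof.
move=> pF zp; have pr := pcharf_prime pF.
have sz : size ('X^p - 'X : {poly F}) = p.+1.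
  by rewrite size_polyDl ?size_polyXn // size_polyN size_polyX ltnS prime_gt1.
have pol0 : 'X^p - 'X != 0 :> {poly F} by rewrite -size_poly_eq0 sz.
pose s := [seq Fp_emb pF c | c <- enum 'F_p].
have [/mapP[c _ ->]|zs] := boolP (z \in s); first by exists c.
have /(max_poly_roots pol0) : all (root ('X^p - 'X)) (z :: s).
  rewrite /= rootE !hornerE zp subrr eqxx; apply/allP => _ /mapP[c _ ->].
  by rewrite rootE !hornerE Fp_in_exp ?subrr.
rewrite /= zs map_inj_uniq ?enum_uniq //; last exact: fmorph_inj.
by move/(_ isT); rewrite size_map -cardE card_Fp // sz ltnn.
Qed.

Lemma exprD_pchar (p : nat) (F : finFieldType) (x y : F) :
  p \in [pchar F] -> (x + y) ^+ p = x ^+ p + y ^+ p.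
Proof. by move=> pF; rewrite -!(pFrobenius_autE pF) rmorphD. Qed.

Lemma exprN_pchar (p : nat) (F : finFieldType) (x : F) :
  p \in [pchar F] -> (- x) ^+ p = - x ^+ p.
Proof. by move=> pF; rewrite -!(pFrobenius_autE pF) rmorphN. Qed.

Lemma Fp_in_Fnorm (p : nat) (F : finFieldType) (z : F) :
  p \in [pchar F] -> #|F| = (p ^ 2)%N -> Fp_in F (Fnorm p z) = z ^+ p.+1.
Proof.
move=> pF F_card; rewrite /Fnorm exprS; case: pickP => [c /eqP //|none].
have [|c cE] := @Fp_in_fixed p F (z * z ^+ p) pF.
  by rewrite exprMn -exprM mulnn -F_card expf_card mulrC.
by have := none c; rewrite -cE eqxx.
Qed.

Section QuadraticExtension.
Variables (p : nat) (F : finFieldType).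
Hypotheses (pF : p \in [pchar F]) (p_odd : odd p) (F_card : #|F| = (p ^ 2)%N).

Local Notation "c %:F" := (Fp_emb pF c).

Lemma pchar_two_neq0 : 2%:R != 0 :> F.
Proof.
rewrite -(dvdn_pcharf pF) dvdn_prime2 ?(pcharf_prime pF) //.
by apply: contraL p_odd => /eqP ->.
Qed.

Lemma card_pred_quadratic : #|F|.-1 = (p.-1 * p.+1)%N.
Proof.
rewrite F_card; have := prime_gt0 (pcharf_prime pF).
by case: (p) => // n _; rewrite -pred_Sn; clear; lia.
Qed.

(** An element of the prime field is a power of the generator whose exponent is
    a multiple of the even number [p + 1]. *)
Lemma prime_field_square (c : 'F_p) : exists w : F, w ^+ 2 = c%:F.
Proof.
have [c0|c0] := eqVneq (c%:F) 0; first by exists 0; rewrite expr0n c0.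
have [g pg] := finField_generator F.
have [k _ ck] := generatorP pg c0.
have pr := pcharf_prime pF.
have : c%:F ^+ p.-1 == 1.
  apply/eqP/(mulfI c0); rewrite mulr1 -exprS prednK ?prime_gt0 //.
  exact: Fp_in_exp.
rewrite ck -exprM -(prim_order_dvd pg) card_pred_quadratic mulnC.
rewrite dvdn_pmul2r; last by have := prime_gt1 pr; lia.
move=> /(dvdn_trans _) dk; exists (g ^+ k./2); rewrite -exprM muln2 halfK.
by rewrite (_ : odd k = false) ?subn0 //; have := dk 2;
  rewrite !dvdn2 /= p_odd => /(_ isT)/negbTE.
Qed.

(** The discriminant has a square root, so every quadratic equation over the
    prime field is solvable in [F]. *)
Lemma prime_field_quadratic (t d : 'F_p) :
  exists w : F, w ^+ 2 = t%:F * w - d%:F.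
Proof.
have [r rE] := prime_field_square (t ^+ 2 - 4%:R * d).
exists ((t%:F + r) / 2%:R); have := pchar_two_neq0.
move: rE; rewrite rmorphB rmorphXn rmorphM rmorph_nat /= => rE two0.
have four0 : 4%:R != 0 :> F by rewrite (natrM _ 2 2) mulf_neq0.
have -> : d%:F = (t%:F ^+ 2 - r ^+ 2) / 2%:R ^+ 2 by rewrite rE; field.
by field; rewrite two0 four0.
Qed.

Variables (r : 'F_p) (s : F).
Hypotheses (r_nonsquare : forall c : 'F_p, c ^+ 2 != r) (s2 : s ^+ 2 = r%:F).

Lemma nonsquare_root_neq0 : s != 0.
Proof.
apply: contra (r_nonsquare 0) => /eqP s0; rewrite expr0n /= eq_sym.
by rewrite -(fmorph_eq0 (Fp_emb pF)) /= -s2 s0 expr0n.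
Qed.

Lemma nonsquare_root_frobenius : s ^+ p = - s.
Proof.
have: (s ^+ p) ^+ 2 == s ^+ 2.
  by rewrite -exprM mulnC exprM s2 [_ ^+ p]Fp_in_exp.
rewrite eqf_sqr => /orP[/eqP/(Fp_in_fixed pF)[c sc]|/eqP //].
case/negP: (r_nonsquare c); rewrite -(inj_eq (fmorph_inj (Fp_emb pF))).
by rewrite rmorphXn /= /Fp_emb -sc s2.
Qed.

Lemma frobenius_coords (x y : 'F_p) :
  (x%:F + y%:F * s) ^+ p = x%:F - y%:F * s.
Proof.
by rewrite exprD_pchar // exprMn nonsquare_root_frobenius !Fp_in_exp // mulrN.
Qed.

Lemma coords_onto (z : F) : exists x y : 'F_p, z = x%:F + y%:F * s.
Proof.
have two0 := pchar_two_neq0; have s0 := nonsquare_root_neq0.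
have zpp : z ^+ p ^+ p = z by rewrite -exprM mulnn -F_card expf_card.
have two_p : (2%:R : F) ^+ p = 2%:R.
  by have := Fp_in_exp (2%:R) pF; rewrite Fp_in_nat.
have [x xE] : exists x : 'F_p, (z + z ^+ p) / 2%:R = x%:F.
  apply: Fp_in_fixed => //.
  by rewrite exprMn exprVn two_p exprD_pchar // zpp addrC.
have [y yE] : exists y : 'F_p, (z - z ^+ p) / (2%:R * s) = y%:F.
  apply: Fp_in_fixed => //.
  rewrite exprMn exprVn exprMn two_p nonsquare_root_frobenius.
  by rewrite exprD_pchar // exprN_pchar // zpp; field; rewrite oppr_eq0 two0 s0.
by exists x, y; rewrite -xE -yE; field; rewrite two0 s0.
Qed.

Lemma coords_eq0 (x y : 'F_p) : x%:F + y%:F * s = 0 -> (x, y) = (0, 0).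
Proof.
have two0 := pchar_two_neq0; have s0 := nonsquare_root_neq0 => xy0.
have xy1 : x%:F - y%:F * s = 0.
  by rewrite -frobenius_coords xy0 expr0n gtn_eqF // prime_gt0 ?(pcharf_prime
    pF).
have x0 : 2%:R * x%:F = 0.
  by rewrite -[RHS](addr0 0) -{1}xy0 -xy1; ring.
have /eqP := x0; rewrite mulf_eq0 (negPf two0) fmorph_eq0 /= => /eqP x00.
move: xy0; rewrite x00 rmorph0 add0r => /eqP.
by rewrite mulf_eq0 (negPf s0) orbF fmorph_eq0 => /eqP ->.
Qed.

End QuadraticExtension.

(** * Reduction modulo the prime above p *)

Lemma eq_charP (F : finFieldType) (C : fieldType) (f g : F -> C) :
  reflect (forall x, x != 0 -> f x = g x) (eq_char f g).
Proof.
apply: (iffP forallP) => h x; last by apply/implyP => x0; rewrite h.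
by move=> x0; have /implyP/(_ x0)/eqP := h x.
Qed.

Lemma is_charX (F C : fieldType) (f : F -> C) x n :
  is_char f -> x != 0 -> f (x ^+ n) = f x ^+ n.
Proof.
case=> f1 fM x0; elim: n => [|n IHn]; first by rewrite !expr0.
by rewrite !exprS fM ?IHn // expf_neq0.
Qed.

Section Teichmuller.
Variables (p : nat) (F : finFieldType) (C : numFieldType).
Variables (P : C -> Prop) (tau : F -> C).
Hypotheses (P_prime : prime_over p P) (tauP : teichmuller P tau).

Let tau_char := teichmuller_char tauP.

Lemma tau1 : tau 1 = 1. Proof. by case: tau_char. Qed.

Lemma tauM x y : tau (x * y) = tau x * tau y.
Proof.
have [->|x0] := eqVneq x 0; first by rewrite mul0r (teichmuller_0 tauP) mul0r.
have [->|y0] := eqVneq y 0; first by rewrite mulr0 (teichmuller_0 tauP) mulr0.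
by case: tau_char => _ ->.
Qed.

Lemma tauX x n : tau (x ^+ n) = tau x ^+ n.
Proof. by elim: n => [|n IHn]; rewrite ?tau1 // !exprS tauM IHn. Qed.

Lemma tau_unity x : x != 0 -> tau x ^+ #|F|.-1 = 1.
Proof. by move=> x0; rewrite -tauX expf_card_pred // tau1. Qed.

Lemma tau_neq0 x : x != 0 -> tau x != 0.
Proof.
move=> /tau_unity tx; apply/eqP => t0; move/eqP: tx.
by rewrite t0 expr0n gtn_eqF ?card_pred_gt0 // eq_sym oner_eq0.
Qed.

Lemma algint_tau x : algint (tau x).
Proof.
have [->|x0] := eqVneq x 0.
  by rewrite (teichmuller_0 tauP); exact: integral0.
apply: (@integral_root_monic _ _ _ _ ('X^(#|F|.-1) - 1%:P)).
- by rewrite monicXnsubC // card_pred_gt0.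
- by rewrite rootE !hornerE tau_unity // subrr.
- apply/integral_poly => i; rewrite coefB coefXn coefC; apply: integral_sub.
    exact: integral_nat.
  by case: ifP => _; [apply: integral1|apply: integral0].
Qed.

Lemma prime_over0 : P 0.
Proof. by rewrite -(subrr p%:R); apply: (prime_over_sub P_prime);
  exact: (prime_over_p P_prime). Qed.

Lemma prime_overN x : P x -> P (- x).
Proof. by move=> Px; rewrite -sub0r;
  exact: (prime_over_sub P_prime prime_over0 Px). Qed.

Lemma prime_overD x y : P x -> P y -> P (x + y).
Proof.
by move=> Px Py; rewrite -[y]opprK;
  exact: (prime_over_sub P_prime Px (prime_overN Py)).
Qed.

(** [x] is an algebraic integer whose residue class is [f]. *)
Definition reduces (x : C) (f : F) : Prop := P (x - tau f).

Lemma reduces_tau f : reduces (tau f) f.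
Proof. by rewrite /reduces subrr; exact: prime_over0. Qed.

Lemma reduces_algint x f : reduces x f -> algint x.
Proof.
move=> xf; rewrite -(subrK (tau f) x); apply: integral_add.
  exact: (prime_over_int P_prime xf).
exact: algint_tau.
Qed.

Lemma reducesD x y f g : reduces x f -> reduces y g -> reduces (x + y) (f + g).
Proof.
move=> xf yg; have := prime_over_sub P_prime (prime_overD xf yg)
  (teichmuller_add tauP f g).
by rewrite /reduces; congr P; ring.
Qed.

Lemma reducesN x f : reduces x f -> reduces (- x) (- f).
Proof.
move=> xf; have := teichmuller_add tauP f (- f).
rewrite subrr (teichmuller_0 tauP) sub0r => d.
have := prime_over_sub P_prime d xf; rewrite /reduces; congr P; ring.
Qed.

Lemma reducesM x y f g : reduces x f -> reduces y g -> reduces (x * y) (f * g).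
Proof.
move=> xf yg; rewrite /reduces tauM.
have -> : x * y - tau f * tau g = y * (x - tau f) + tau f * (y - tau g) by ring.
apply: prime_overD; apply: (prime_over_mul P_prime) => //.
- exact: reduces_algint yg.
- exact: algint_tau.
Qed.

Lemma reduces0 : reduces 0 0.
Proof. by rewrite /reduces (teichmuller_0 tauP) subr0; exact: prime_over0. Qed.

Lemma reduces1 : reduces 1 1.
Proof. by rewrite -tau1; exact: reduces_tau. Qed.

Lemma reducesX x f n : reduces x f -> reduces (x ^+ n) (f ^+ n).
Proof.
by move=> xf; elim: n => [|n IHn]; [exact: reduces1|rewrite !exprS;
  exact: reducesM].
Qed.

Lemma reduces_nat n : reduces n%:R n%:R.
Proof.
elim: n => [|n IHn]; first exact: reduces0.
by rewrite !mulrS; apply: reducesD; [exact: reduces1|].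
Qed.

Lemma reduces_sum (I : Type) (rr : seq I) (Q : pred I) (x : I -> C) (f : I ->
  F) :
  (forall i, Q i -> reduces (x i) (f i)) ->
  reduces (\sum_(i <- rr | Q i) x i) (\sum_(i <- rr | Q i) f i).
Proof.
by move=> h; elim/big_ind2: _ => //; [exact: reduces0|move=> *;
  exact: reducesD].
Qed.

Lemma reduces_neq0 x f : reduces x f -> f != 0 -> x != 0.
Proof.
move=> xf f0; apply/eqP => x0; apply: (prime_over_neq1 P_prime).
have := prime_overN xf; rewrite x0 sub0r opprK => Pf.
have := prime_over_mul P_prime (algint_tau f^-1) Pf.
by rewrite -tauM mulVf // tau1.
Qed.

(** Modulo [P], [tau] is additive, so equal values at [x] and [y] make
    [x - y] reduce to zero, whereas the reduction of a nonzero element is a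
    unit. *)
Lemma tau_inj : injective tau.
Proof.
move=> x y xy; apply/eqP; rewrite -subr_eq0; apply: contraT => xy0.
have := reducesD (reduces_tau x) (reducesN (reduces_tau y)).
by move/reduces_neq0 => /(_ xy0); rewrite xy subrr eqxx.
Qed.

Lemma tauN1 : 2%:R != 0 :> F -> tau (- 1) = -1.
Proof.
move=> two0; have : tau (- 1) ^+ 2 == 1 ^+ 2.
  by rewrite -tauX sqrrN !expr1n tau1.
rewrite eqf_sqr => /orP[e|/eqP //]; case/negP: two0.
move: e; rewrite -[X in _ == X]tau1 (inj_eq tau_inj) => e.
by rewrite -[2%:R]/(1 + 1) addr_eq0 eq_sym.
Qed.

(** Injectivity preserves the order of a generator; this is the reason why the
    powers of [tau] exhaust the characters of [F^*]. *)
Lemma tau_generator g : #|F|.-1.-primitive_root g ->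
  #|F|.-1.-primitive_root (tau g).
Proof.
move=> pg; have g0 := generator_neq0 pg.
have [m pm dm] := prim_order_exists (card_pred_gt0 F) (tau_unity g0).
have : tau (g ^+ m) == tau 1 by rewrite tauX (prim_expr_order pm) tau1.
rewrite (inj_eq tau_inj) -(prim_order_dvd pg) => dm'.
by have /eqP <- : m == #|F|.-1; rewrite ?eqn_dvd ?dm.
Qed.

Lemma eq_tau_exp k l :
  (forall x, x != 0 -> tau x ^+ k = tau x ^+ l) <-> k = l %[mod #|F|.-1].
Proof.
have [g pg] := finField_generator F; have ptg := tau_generator pg.
split=> [h|kl x x0].
  by apply/eqP; rewrite -(eq_prim_root_expr ptg) h ?(generator_neq0 pg).
have [j _ ->] := generatorP pg x0;
  rewrite tauX -!exprM ![(j * _)%N]mulnC !exprM.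
by congr (_ ^+ j); apply/eqP; rewrite (eq_prim_root_expr ptg) kl.
Qed.

Lemma char_tau_exp (chi : F -> C) : is_char chi ->
  exists2 k, (k < #|F|.-1)%N & forall x, x != 0 -> chi x = tau x ^+ k.
Proof.
move=> chiP; have [g pg] := finField_generator F.
have g0 := generator_neq0 pg.
have : chi g ^+ #|F|.-1 = 1.
  by rewrite -is_charX // (prim_expr_order pg); case: chiP.
case/(prim_rootP (tau_generator pg)) => k chig; exists k => // x x0.
have [j _ ->] := generatorP pg x0.
by rewrite is_charX // chig tauX -!exprM mulnC.
Qed.

Lemma tau_char_sum (x : F) : x != 0 ->
  \sum_(k < #|F|.-1) tau x ^+ k = if x == 1 then #|F|.-1%:R else 0.
Proof.
move=> x0; case: eqP => [->|/eqP x1].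
  rewrite tau1 (eq_bigr (fun=> 1)); first by rewrite sumr_const card_ord.
  by move=> k _; rewrite expr1n.
have /eqP := subrX1 (tau x) #|F|.-1.
rewrite tau_unity // subrr eq_sym mulf_eq0 subr_eq0 -tau1 (inj_eq tau_inj).
by rewrite (negPf x1) => /eqP.
Qed.

End Teichmuller.

(** * The Brauer character of the cuspidal representation *)

Lemma mx2_unit (A : fieldType) (a b c d : A) :
  (mx2 a b c d \in unitmx) = (a * d - b * c != 0).
Proof. by rewrite unitmxE det_mx2E !mx2E unitfE. Qed.

Lemma mulmx2 (A : pzRingType) (a b c d a' b' c' d' : A) :
  mx2 a b c d *m mx2 a' b' c' d' =
  mx2 (a * a' + b * c') (a * b' + b * d') (c * a' + d * c') (c * b' + d * d').
Proof. by apply: mx2P; rewrite mul_mx2 !mx2E. Qed.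

Lemma scalar_mx2 (A : pzRingType) (a : A) : a%:M = mx2 a 0 0 a :> 'M_2.
Proof. by apply: mx2P; rewrite !mxE. Qed.

Lemma map_mx2 (A B : Type) (f : A -> B) a b c d :
  map_mx f (mx2 a b c d) = mx2 (f a) (f b) (f c) (f d).
Proof. by apply: mx2P; rewrite !mxE. Qed.

Lemma mx2_eta (A : Type) (M : 'M[A]_2) :
  M = mx2 (M 0 0) (M 0 1) (M 1 0) (M 1 1).
Proof. by apply: mx2P; rewrite !mxE. Qed.

(** The first column of [X] is an eigenvector, which can be read off from a
    nonzero off-diagonal entry of [M]. *)
Lemma mx2_trigonal (A : fieldType) (M : 'M[A]_2) (x : A) :
  x ^+ 2 = (M 0 0 + M 1 1) * x - \det M ->
  exists (X : 'M[A]_2) (y : A), X \in unitmx /\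
    M *m X = X *m mx2 x y 0 (M 0 0 + M 1 1 - x).
Proof.
rewrite det_mx2E [M]mx2_eta !mx2E.
move: (M 0 0) (M 0 1) (M 1 0) (M 1 1) => a b c d xE.
have xE0 : (x - a) * (x - d) = b * c.
  have -> : (x - a) * (x - d) = x ^+ 2 - (a + d) * x + a * d by ring.
  by rewrite xE; ring.
have [b0|b0] := eqVneq b 0; last first.
  exists (mx2 b 0 (x - a) 1), 1; split;
    first by rewrite mx2_unit mulr1 mul0r subr0.
  rewrite !mulmx2; apply: mx2P; rewrite !mx2E; try ring.
  by rewrite -[c * b]mulrC -xE0; ring.
have [c0|c0] := eqVneq c 0; last first.
  exists (mx2 (x - d) 1 c 0), 1; split.
    by rewrite mx2_unit mulr0 mul1r sub0r oppr_eq0.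
  rewrite !mulmx2; apply: mx2P; rewrite !mx2E; try ring.
  by rewrite -xE0; ring.
move: xE0 => /eqP; rewrite b0 c0 mulr0 mulf_eq0 !subr_eq0 => /orP[] /eqP->.
  exists 1%:M, 0; rewrite unitmx1 mulmx1 mul1mx; split=> //.
  by apply: mx2P; rewrite !mx2E //; ring.
exists (mx2 0 1 1 0), 0; split.
  by rewrite mx2_unit mul0r mul1r sub0r oppr_eq0 oner_eq0.
by rewrite !mulmx2; apply: mx2P; rewrite !mx2E; ring.
Qed.

Section Brauer.
Variables (F : fieldType) (p : nat).
Variables (a b n1 n2 : nat).
Hypotheses (n1E : (n1 + b).+2 = a) (n2E : (n2 + a).+1 = (p + b)%N).

(** The character of the reduction modulo [p], a sum of two twisted symmetric
    powers. *)
Definition brauer (M : 'M[F]_2) : F :=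
  \tr (symmx n1 M) * \det M ^+ b.+1 + \tr (symmx n2 M) * \det M ^+ a.

Lemma symmx1 n : symmx n (1%:M : 'M[F]_2) = 1%:M.
Proof.
rewrite scalar_mx2 symmx_diag; apply/matrixP => i j; rewrite !mxE.
by rewrite !expr1n mulr1.
Qed.

Lemma brauer_conj (M N X : 'M[F]_2) :
  X \in unitmx -> M *m X = X *m N -> brauer M = brauer N.
Proof.
move=> uX MX; have -> : M = X *m N *m invmx X by rewrite -MX mulmxK.
have dE : \det (X *m N *m invmx X) = \det N.
  by rewrite !det_mulmx mulrAC -det_mulmx mulmxV // det1 mul1r.
have tE n : \tr (symmx n (X *m N *m invmx X)) = \tr (symmx n N).
  by rewrite !symmxM mxtrace_mulC mulmxA -symmxM mulVmx // symmx1 mul1mx.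
by rewrite /brauer dE !tE.
Qed.

(** Geometric sums turn the two traces into differences of powers; since
    [n2 + a + 1 = p + b], the Frobenius [x^p] appears in the second one. *)
Lemma brauer_utri (x y z : F) : (x - z) * brauer (mx2 x y 0 z) =
  x ^+ a * z ^+ b * z - x * x ^+ b * z ^+ a
  + (x ^+ p * x ^+ b * z ^+ a - x ^+ a * (z ^+ p * z ^+ b)).
Proof.
rewrite /brauer !tr_symmx_utri det_mx2E !mx2E mulr0 subr0.
have h n : (x - z) * \sum_(i < n.+1) x ^+ i * z ^+ (n - i) = x ^+ n.+1 - z ^+
  n.+1.
  rewrite -[RHS]opprB subrXX -mulNr opprB; congr (_ * _).
  by apply: eq_bigr => i _; rewrite mulrC.
have comb n k l : (n.+1 + k)%N = l ->
    (x ^+ n.+1 - z ^+ n.+1) * (x * z) ^+ k = x ^+ l * z ^+ k - x ^+ k * z ^+ l.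
  by move=> <-; rewrite exprMn !exprD; ring.
rewrite mulrDr !mulrA !h (comb n1 b.+1 a) ?(comb n2 a (p + b)%N); try lia.
by rewrite !exprS !exprD; ring.
Qed.

Lemma brauer_split (x y z : F) : x != z -> x ^+ p = x -> z ^+ p = z ->
  brauer (mx2 x y 0 z) = 0.
Proof.
move=> xz xp zp; have xz0 : x - z != 0 by rewrite subr_eq0.
by apply: (mulfI xz0); rewrite brauer_utri xp zp mulr0; ring.
Qed.

Lemma brauer_elliptic (x y : F) : x ^+ p != x -> x ^+ p ^+ p = x ->
  brauer (mx2 x y 0 (x ^+ p)) =
  - (x ^+ (a + p * b) + (x ^+ p) ^+ (a + p * b)).
Proof.
move=> xz zp; have xz0 : x - x ^+ p != 0 by rewrite subr_eq0 eq_sym.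
apply: (mulfI xz0); rewrite brauer_utri !exprD !exprM zp; ring.
Qed.

Lemma brauer_scalar (x y : F) : p \in [pchar F] -> x != 0 -> x ^+ p = x ->
  brauer (mx2 x y 0 x) = - x ^+ (a + p * b).
Proof.
move=> pF x0 xp; rewrite /brauer !tr_symmx_utri det_mx2E !mx2E mulr0 subr0.
have h n : \sum_(i < n.+1) x ^+ i * x ^+ (n - i) = x ^+ n *+ n.+1.
  rewrite -[in RHS](card_ord n.+1) -sumr_const; apply: eq_bigr => i _.
  by rewrite -exprD subnKC // leq_ord.
have xx k : (x * x) ^+ k = x ^+ (k + k) by rewrite exprMn exprD.
have -> : x ^+ (a + p * b) = x ^+ (a + b) by rewrite !exprD exprM xp.
rewrite !h !xx !mulrnAl -!exprD.
have -> : (n1 + (b.+1 + b.+1) = a + b)%N by lia.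
have -> : x ^+ (n2 + (a + a)) = x ^+ (a + b).
  apply: (mulfI x0); rewrite -exprS (_ : (n2 + (a + a)).+1 = p + (a + b))%N;
    last lia.
  by rewrite exprD xp.
rewrite -mulrnDr (_ : n1.+1 + n2.+1 = p.-1)%N;
  last by have := prime_gt0 (pcharf_prime pF); lia.
apply/eqP; rewrite -addr_eq0 addrC -mulrS prednK ?(prime_gt0 (pcharf_prime
  pF)) //.
by rewrite -mulr_natr (pcharf0 pF) mulr0.
Qed.

End Brauer.

(** * The character of a cuspidal representation *)

Section GLmatrices.
Variables (K : finFieldType) (C : fieldType) (n : nat).
Variable rho : mx_representation C [set: {'GL_2[K]}] n.

Definition GLmx (M : 'M[K]_2) : {'GL_2[K]} := insubd (1%g : {'GL_2[K]}) M.

Lemma GLmxK M : M \in unitmx -> GLval (GLmx M) = M.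
Proof. by move=> uM; exact: insubdK. Qed.

Lemma GLvalK (g : {'GL_2[K]}) : GLmx (GLval g) = g.
Proof. exact: valKd. Qed.

Definition rhomx (M : 'M[K]_2) : 'M[C]_n := rho (GLmx M).

Lemma rhomxM M N : M \in unitmx -> N \in unitmx ->
  rhomx (M *m N) = rhomx M *m rhomx N.
Proof.
move=> uM uN; rewrite /rhomx -repr_mxM ?inE //; congr (rho _).
apply: val_inj; rewrite -[RHS]/(GLval (GLmx M) *m GLval (GLmx N)) !GLmxK //.
by apply: GLmxK; rewrite unitmx_mul uM.
Qed.

Lemma rhomx1 : rhomx 1%:M = 1%:M.
Proof.
rewrite /rhomx -(repr_mx1 rho); congr (rho _).
by apply: val_inj; apply: GLmxK; rewrite unitmx1.
Qed.

Lemma tr_rhomx_conj M N X : M \in unitmx -> N \in unitmx -> X \in unitmx ->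
  M *m X = X *m N -> \tr (rhomx M) = \tr (rhomx N).
Proof.
move=> uM uN uX MX; have uX' : invmx X \in unitmx by rewrite unitmx_inv.
have -> : M = X *m N *m invmx X by rewrite -MX mulmxK.
rewrite !rhomxM ?unitmx_mul ?uX // mxtrace_mulC mulmxA -rhomxM //.
by rewrite mulVmx // rhomx1 mul1mx.
Qed.

End GLmatrices.

Section CuspidalTrace.
Variables (K : finFieldType) (C : fieldType) (n : nat) (omega : K -> C).
Variable rho : mx_representation C [set: {'GL_2[K]}] n.

Local Notation rhoM := (rhomx rho).
Local Notation unip x := (mx2 1 x 0 1).

Hypotheses (nE : n = #|K|.-1) (C_pchar0 : [pchar C] =i pred0).
Hypothesis rho_unip :
  forall u : 'cV[C]_n, (forall x : K, rhoM (unip x) *m u = u) -> u = 0.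
Hypothesis rho_central : forall c, c != 0 -> rhoM c%:M = (omega c)%:M.

Let natrC_eq0 m : (m%:R == 0 :> C) = (m == 0)%N.
Proof. by have /pcharf0P -> := C_pchar0. Qed.

Lemma unip_unit (x : K) : unip x \in unitmx.
Proof. by rewrite mx2_unit mulr1 mulr0 subr0 oner_eq0. Qed.

Lemma unipM (x y : K) : unip x *m unip y = unip (x + y).
Proof.
rewrite mulmx2 !(mul1r, mulr1, mulr0, mul0r, addr0, add0r); congr (mx2 _ _ _ _).
by rewrite addrC.
Qed.

Lemma diag_unit (c d : K) : c != 0 -> d != 0 -> mx2 c 0 0 d \in unitmx.
Proof. by move=> c0 d0; rewrite mx2_unit mul0r subr0 mulf_neq0. Qed.

(** The average over the unipotent subgroup projects to its fixed vectors, of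
    which a cuspidal representation has none. *)
Lemma sum_unip0 : \sum_(x : K) rhoM (unip x) = 0.
Proof.
set S := \sum_x _; have S0 (v : 'cV_n) : S *m v = 0.
  apply: rho_unip => y; rewrite mulmxA; congr (_ *m v).
  rewrite mulmx_sumr /S [RHS](reindex_inj (addrI y)).
  apply: eq_bigr => x _; rewrite -rhomxM ?unip_unit //.
  by rewrite unipM.
by apply/row_matrixP => i; apply/rowP => j; have := S0 (delta_mx j 0);
  rewrite -colE => /matrixP/(_ i 0); rewrite !mxE.
Qed.

(** When [c != d], the matrices [diag(c, d) unip(y)] are all conjugate, so the
    trace is an average that contains the vanishing unipotent sum. *)
Lemma tr_split (c d x : K) : c != 0 -> d != 0 -> c != d ->
  \tr (rhoM (mx2 c x 0 d)) = 0.
Proof.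
move=> c0 d0 cd; have dc0 : d - c != 0 by rewrite subr_eq0 eq_sym.
have utri_unit y : mx2 c y 0 d \in unitmx.
  by rewrite mx2_unit mulr0 subr0 mulf_neq0.
have to_diag y : \tr (rhoM (mx2 c y 0 d)) = \tr (rhoM (mx2 c 0 0 d)).
  apply: (@tr_rhomx_conj _ _ _ rho _ _ (unip (y / (d - c))));
    rewrite ?utri_unit ?unip_unit //.
  by rewrite !mulmx2; apply: mx2P; rewrite !mx2E; field.
have : \tr (rhoM (mx2 c 0 0 d) *m \sum_(y : K) rhoM (unip y)) = 0.
  by rewrite sum_unip0 mulmx0 mxtrace0.
rewrite mulmx_sumr raddf_sum /= (eq_bigr (fun=> \tr (rhoM (mx2 c 0 0 d)))).
  rewrite sumr_const -mulr_natr => /eqP; rewrite mulf_eq0 natrC_eq0.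
  by rewrite gtn_eqF ?orbF ?to_diag => [/eqP|] //; apply/card_gt0P; exists 0.
move=> y _; rewrite -rhomxM ?unip_unit ?utri_unit // mulmx2.
by rewrite !(mul1r, mulr1, mulr0, mul0r, addr0, add0r) to_diag.
Qed.

(** The nontrivial unipotents are conjugate and their traces, together with
    the dimension [n = #|K| - 1], add up to zero. *)
Lemma tr_unip (x : K) : x != 0 -> \tr (rhoM (unip x)) = -1.
Proof.
move=> x0; have to1 y : y != 0 -> \tr (rhoM (unip y)) = \tr (rhoM (unip 1)).
  move=> y0; apply: (@tr_rhomx_conj _ _ _ rho _ _ (mx2 y 0 0 1));
    rewrite ?unip_unit //.
    by rewrite diag_unit // oner_eq0.
  by rewrite !mulmx2; apply: mx2P; rewrite !mx2E; ring.
have : \tr (\sum_(y : K) rhoM (unip y)) = 0 by rewrite sum_unip0 mxtrace0.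
rewrite raddf_sum /= (bigD1 0) //= -[unip 0]scalar_mx2 rhomx1 mxtrace1.
rewrite (eq_bigr (fun=> \tr (rhoM (unip 1)))) => [|y y0]; last exact: to1.
rewrite sumr_const (_ : #|_| = n); last first.
  apply/eqP; rewrite nE -eqSS prednK; last by apply/card_gt0P; exists 0.
  rewrite [X in _ == X](cardD1 (0 : K)) inE add1n eqSS; apply/eqP.
  by apply: eq_card => y; rewrite !inE andbT.
rewrite -[\tr _ *+ _]mulr_natl -{1}[n%:R]mulr1 -mulrDr => /eqP.
have n0 : (n == 0)%N = false by rewrite nE gtn_eqF ?card_pred_gt0.
rewrite mulf_eq0 natrC_eq0 n0 /=.
by rewrite addrC addr_eq0 (to1 x) // => /eqP.
Qed.

Lemma tr_scalar_utri (c x : K) : c != 0 ->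
  \tr (rhoM (mx2 c x 0 c)) =
  omega c * (if x == 0 then n%:R else -1).
Proof.
move=> c0; have -> : mx2 c x 0 c = c%:M *m unip (x / c).
  rewrite scalar_mx2 mulmx2; apply: mx2P; rewrite !mx2E; field => //.
have uc : (c%:M : 'M_2) \in unitmx by rewrite scalar_mx2 diag_unit.
rewrite rhomxM ?unip_unit // rho_central // mul_scalar_mx mxtraceZ;
  congr (_ * _); case: eqP => [->|/eqP x0].
  by rewrite mul0r -scalar_mx2 rhomx1 mxtrace1.
by rewrite tr_unip // mulf_neq0 ?invr_eq0.
Qed.

End CuspidalTrace.

(** * Comparison of the two characters modulo p *)

Section CuspidalReduction.
Variables (K F : finFieldType) (C : numFieldType) (p : nat).
Variables (P : C -> Prop) (tau : F -> C) (iota : {rmorphism K -> F}).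
Hypotheses (P_prime : prime_over p P) (tauP : teichmuller P tau).
Hypotheses (pF : p \in [pchar F]) (F_card : #|F| = (p ^ 2)%N) (K_card : #|K| =
  p).
Hypothesis iota_fixed : forall z, z ^+ p = z -> exists c, z = iota c.
Hypothesis iota_quadratic :
  forall t d : K, exists w : F, w ^+ 2 = iota t * w - iota d.

Variables (a b n1 n2 : nat).
Hypotheses (n1E : (n1 + b).+2 = a) (n2E : (n2 + a).+1 = (p + b)%N).

Variable rho : mx_representation C [set: {'GL_2[K]}] p.-1.
Local Notation rhoM := (rhomx rho).

Hypothesis rho_unip :
  forall u : 'cV[C]_(p.-1), (forall x : K, rhoM (mx2 1 x 0 1) *m u = u) -> u =
    0.
Hypothesis rho_central :
  forall c, c != 0 -> rhoM c%:M = (tau (iota c) ^+ (a + p * b))%:M.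
Hypothesis rho_elliptic : forall (M : 'M[K]_2) (z : F), M \in unitmx ->
  (forall c, z != iota c) ->
  z ^+ 2 = iota (M 0 0 + M 1 1) * z - iota (\det M) ->
  \tr (rhoM M) = - (tau z ^+ (a + p * b) + (tau z ^+ (a + p * b)) ^+ p).

Lemma iota_exp c : iota c ^+ p = iota c.
Proof. by rewrite -rmorphXn; have := expf_card c; rewrite K_card => ->. Qed.

Let C_pchar0 : [pchar C] =i pred0. Proof. exact: pchar_num. Qed.
Let dimE : p.-1 = #|K|.-1. Proof. by rewrite K_card. Qed.
Let p_gt0 : (0 < p)%N. Proof. exact: prime_gt0 (pcharf_prime pF). Qed.

(** A scalar has trace [p - 1] times its central value, which is [-1] times it
    modulo [p], like for the other elements with a double eigenvalue; the
    symmetric powers do not distinguish them either. *)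
Lemma tr_reduces_trigonal (c d y : K) : c != 0 -> d != 0 ->
  reduces P tau (\tr (rhoM (mx2 c y 0 d)))
    (brauer a b n1 n2 (mx2 (iota c) (iota y) 0 (iota d))).
Proof.
move=> c0 d0; have [<-|cd] := eqVneq c d; last first.
  rewrite (tr_split C_pchar0 rho_unip) //.
  rewrite (brauer_split n1E n2E) ?(inj_eq (fmorph_inj iota)) ?iota_exp //.
  exact: (reduces0 P_prime tauP).
rewrite (tr_scalar_utri dimE C_pchar0 rho_unip rho_central) //.
rewrite (brauer_scalar n1E n2E) ?fmorph_eq0 ?iota_exp // -[- (_ ^+ _)]mulrN1.
apply: (reducesM P_prime tauP).
  by apply: (reducesX P_prime tauP); exact: (reduces_tau tau P_prime).
case: ifP => _; last by apply: (reducesN P_prime tauP);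
  exact: (reduces1 P_prime tauP).
have <- : p.-1%:R = -1 :> F.
  by apply/eqP; rewrite -addr_eq0 addrC -mulrS prednK // (pcharf0 pF).
exact: (reduces_nat P_prime tauP).
Qed.

(** Either an eigenvalue lies in the prime field, and the matrix is
    triangularised there, or the eigenvalues are conjugate under Frobenius and
    the matrix is triangularised over [F]. *)
Lemma tr_reduces (M : 'M[K]_2) : M \in unitmx ->
  reduces P tau (\tr (rhoM M)) (brauer a b n1 n2 (map_mx iota M)).
Proof.
move=> uM; have dM : \det M != 0 by rewrite -unitfE -unitmxE.
have [w wE] := iota_quadratic (M 0 0 + M 1 1) (\det M).
have [[c wc]|w_out] := pselect (exists c, w = iota c).
  have cE : c ^+ 2 = (M 0 0 + M 1 1) * c - \det M.
    apply: (fmorph_inj iota);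
      rewrite rmorphXn [RHS]rmorphB [iota (_ * _)]rmorphM.
    by rewrite /= -wc.
  have [X [y [uX MX]]] := mx2_trigonal cE.
  set d := _ - c in MX;
    have cd : c * d = \det M by rewrite /d mulrBr -expr2 cE; ring.
  have /andP[c0 d0] : (c != 0) && (d != 0) by rewrite -negb_or -mulf_eq0 cd.
  have uT : mx2 c y 0 d \in unitmx by rewrite mx2_unit mulr0 subr0 cd.
  rewrite (tr_rhomx_conj rho uM uT uX MX).
  have -> : brauer a b n1 n2 (map_mx iota M) =
      brauer a b n1 n2 (map_mx iota (mx2 c y 0 d)).
    by apply: brauer_conj (_ : map_mx iota X \in unitmx) _;
      rewrite ?map_unitmx // -!map_mxM MX.
  by rewrite map_mx2 rmorph0; exact: tr_reduces_trigonal.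
have w_notin c : w != iota c by apply/eqP => wc; apply: w_out; exists c.
have wp : w ^+ p != w by apply/eqP => /iota_fixed.
have wpE : w ^+ p ^+ 2 = iota (M 0 0 + M 1 1) * w ^+ p - iota (\det M).
  rewrite exprAC wE exprD_pchar // exprN_pchar // exprMn;
    do !rewrite iota_exp //.
have other : iota (M 0 0 + M 1 1) - w = w ^+ p.
  have : (w ^+ p - w) * (w ^+ p - (iota (M 0 0 + M 1 1) - w)) = 0.
    transitivity (w ^+ p ^+ 2 - w ^+ 2 - iota (M 0 0 + M 1 1) * (w ^+ p - w)).
      by ring.
    by rewrite wpE wE; ring.
  by move/eqP; rewrite mulf_eq0 !subr_eq0 (negPf wp) /= => /eqP.
have [|X [y [uX MX]]] := @mx2_trigonal _ (map_mx iota M) w.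
  by rewrite wE det_map_mx !mxE rmorphD.
rewrite (brauer_conj _ _ _ _ uX MX) !mxE -rmorphD other.
rewrite (brauer_elliptic n1E n2E) //; last first.
  by rewrite -exprM mulnn -F_card expf_card.
rewrite (rho_elliptic uM w_notin wE).
apply/(reducesN P_prime tauP)/(reducesD P_prime tauP).
  by apply: (reducesX P_prime tauP); exact: (reduces_tau tau P_prime).
rewrite exprAC; apply/(reducesX P_prime tauP)/(reducesX P_prime tauP).
exact: (reduces_tau tau P_prime).
Qed.

End CuspidalReduction.

(** * Character sums over the two tori *)
Lemma finField_shifted_power_sum (F : finFieldType) u k :
  \sum_(x : F | x != 0) x ^+ u * x^-1 ^+ k =
  if u == k %[mod #|F|.-1] then -1 else 0.
Proof.
have [m qE] : exists m, (#|F|.-1 = m.+1)%N.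
  by exists #|F|.-1.-1; rewrite prednK // card_pred_gt0.
rewrite (eq_bigr (fun x => x ^+ (u + m * k))) => [|x x0]; last first.
  rewrite exprD exprM; congr (_ * _ ^+ _); apply: (mulfI x0).
  by rewrite divff // -exprS -qE expf_card_pred.
rewrite finField_power_sum qE; congr (if _ then _ else _).
by rewrite -(eqn_modDr (m * k)%N u k) -mulSn modnMr.
Qed.

Section NonsplitTorus.
Variables (K F : finFieldType) (p : nat) (iota : {rmorphism K -> F}).
Variables (r : K) (s : F).
Hypotheses (pF : p \in [pchar F]) (K_card : #|K| = p).
Hypotheses (two_neq0 : 2%:R != 0 :> F).
Hypotheses (s2 : s ^+ 2 = iota r) (sp : s ^+ p = - s) (s_neq0 : s != 0).
Hypothesis coords_ex : forall z, exists x y, z = iota x + iota y * s.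
Hypothesis coords_free :
  forall x y, iota x + iota y * s = 0 -> (x, y) = (0, 0).

(** The coordinates of [z] on the basis [1, s] of [F] over [K]; the default
    value is never reached. *)
Definition coords (z : F) : K * K :=
  odflt (0, 0) [pick c : K * K | z == iota c.1 + iota c.2 * s].

Lemma coordsE z : z = iota (coords z).1 + iota (coords z).2 * s.
Proof.
rewrite /coords; case: pickP => [c /eqP //|none].
by have [x [y zE]] := coords_ex z; have := none (x, y); rewrite /= zE eqxx.
Qed.

Lemma coordsK x y : coords (iota x + iota y * s) = (x, y).
Proof.
set z := _ + _; have /eqP := coordsE z; rewrite {1}/z -subr_eq0 => /eqP zE.
have /coords_free/eqP : iota (x - (coords z).1) + iota (y - (coords z).2) * s
  = 0.
  by rewrite !rmorphB -zE; ring.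
rewrite xpair_eqE !subr_eq0 => /andP[/eqP-> /eqP->].
by case: (coords z).
Qed.

(** The matrix of multiplication by [z] on [F], in the coordinates used for
    the p-adic torus. *)
Definition torus_mx (z : F) : 'M[K]_2 :=
  mx2 (coords z).1 (coords z).2 ((coords z).2 * r) (coords z).1.

Lemma torus_mxE x y : torus_mx (iota x + iota y * s) = mx2 x y (y * r) x.
Proof. by rewrite /torus_mx coordsK. Qed.

Lemma torus_mxM z w : torus_mx (z * w) = torus_mx z *m torus_mx w.
Proof.
rewrite [z in LHS]coordsE [w in LHS]coordsE /torus_mx mulmx2.
set x := (coords z).1; set y := (coords z).2.
set x' := (coords w).1; set y' := (coords w).2.
have -> : (iota x + iota y * s) * (iota x' + iota y' * s) =
  iota (x * x' + y * (y' * r)) + iota (x * y' + y * x') * s.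
  by rewrite !(rmorphD, rmorphM) /= -s2; ring.
by rewrite coordsK /=; apply: mx2P; rewrite !mx2E; ring.
Qed.

Lemma torus_mx_scalar c : torus_mx (iota c) = c%:M.
Proof.
have -> : iota c = iota c + iota 0 * s by rewrite rmorph0 mul0r addr0.
by rewrite torus_mxE mul0r scalar_mx2.
Qed.

Lemma torus_mx1 : torus_mx 1 = 1%:M.
Proof. by rewrite -(rmorph1 iota) torus_mx_scalar. Qed.

Lemma torus_mx_unit z : z != 0 -> torus_mx z \in unitmx.
Proof.
move=> z0; have : torus_mx z *m torus_mx z^-1 = 1%:M by rewrite -torus_mxM
  divff ?torus_mx1.
by case/mulmx1_unit.
Qed.

Lemma torus_mx_root : torus_mx s = mx2 0 1 r 0.
Proof.
have {1}-> : s = iota 0 + iota 1 * s by rewrite rmorph0 rmorph1 add0r mul1r.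
by rewrite torus_mxE mul1r.
Qed.

(** The columns are eigenvectors of all the [torus_mx z], for [z] and its
    conjugate [z^p]. *)
Definition eigenbasis : 'M[F]_2 := mx2 1 1 s (- s).
Definition eigenbasis_inv : 'M[F]_2 :=
  mx2 2%:R^-1 (2%:R * s)^-1 2%:R^-1 (- (2%:R * s)^-1).

Lemma map_torus_mx z : map_mx iota (torus_mx z) = eigenbasis *m mx2 z 0 0 (z
  ^+ p) *m eigenbasis_inv.
Proof.
have iota_p c : iota c ^+ p = iota c.
  by rewrite -rmorphXn; have := expf_card c; rewrite K_card => ->.
rewrite [z in RHS]coordsE /torus_mx map_mx2 rmorphM /= -s2.
move: (coords z).1 (coords z).2 => x y.
rewrite exprD_pchar // exprMn sp !iota_p !mulmx2; apply: mx2P; rewrite !mx2E;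
  field; by rewrite ?two_neq0 ?s_neq0.
Qed.

Lemma eigenbasisK : eigenbasis *m eigenbasis_inv = 1%:M.
Proof.
rewrite mulmx2 scalar_mx2; apply: mx2P; rewrite !mx2E; field;
  by rewrite ?two_neq0 ?s_neq0.
Qed.

Lemma det_map_torus_mx z c :
  \det (map_mx iota (torus_mx z *m mx2 c 0 0 1)) = z ^+ p.+1 * iota c.
Proof.
have dK : \det eigenbasis * \det eigenbasis_inv = 1 by rewrite -det_mulmx
  eigenbasisK det1.
rewrite map_mxM !det_mulmx map_torus_mx !det_mulmx [\det eigenbasis * _ *
  _]mulrAC dK mul1r map_mx2.
by rewrite !det_mx2E !mx2E rmorph0 rmorph1 !mul0r !subr0 mulr1 exprS.
Qed.

Lemma tr_symmx_torus_mx n z c :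
  \tr (symmx n (map_mx iota (torus_mx z *m mx2 c 0 0 1))) =
  \sum_(i < n.+1) \sum_(j < n.+1)
    symmx n eigenbasis i j * symmx n eigenbasis_inv j i * z ^+ (j + p * (n -
      j)) * iota c ^+ i.
Proof.
rewrite map_mxM map_torus_mx map_mx2 rmorph0 rmorph1 !symmxM !symmx_diag.
apply: eq_bigr => i _; rewrite mul_mx_diag mxE [X in X * _]mxE mulr_suml.
apply: eq_bigr => j _; rewrite mul_mx_diag !mxE expr1n mulr1 exprD exprM.
ring.
Qed.

(** The value of a power sum over the nonzero elements: [-1], and not [q - 1],
    since sums are taken in characteristic [p]. *)
Definition neg_indic (x y q : nat) : F := if x == y %[mod q] then -1 else 0.

(** Each average over a torus selects the indices whose exponent matches that
    of the character. *)
Lemma constituent_sum n m k e :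
  \sum_(z : F | z != 0) \sum_(c : K | c != 0) z^-1 ^+ k * iota c^-1 ^+ e *
    (\tr (symmx n (map_mx iota (torus_mx z *m mx2 c 0 0 1))) *
     \det (map_mx iota (torus_mx z *m mx2 c 0 0 1)) ^+ m) =
  \sum_(i < n.+1) \sum_(j < n.+1) symmx n eigenbasis i j * symmx n
    eigenbasis_inv j i *
    neg_indic (j + p * (n - j) + p.+1 * m) k #|F|.-1 * neg_indic (i + m) e
      #|K|.-1.
Proof.
pose U (j : 'I_n.+1) z : F := z ^+ (j + p * (n - j) + p.+1 * m) * z^-1 ^+ k.
pose V (i : 'I_n.+1) c : F := iota (c ^+ (i + m) * c^-1 ^+ e).
pose A (i j : 'I_n.+1) : F := symmx n eigenbasis i j * symmx n eigenbasis_inv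
  j i.
have sumU j : \sum_(z : F | z != 0) U j z =
    neg_indic (j + p * (n - j) + p.+1 * m) k #|F|.-1.
  exact: finField_shifted_power_sum.
have sumV i : \sum_(c : K | c != 0) V i c = neg_indic (i + m) e #|K|.-1.
  rewrite -rmorph_sum finField_shifted_power_sum /neg_indic.
  by case: ifP => _; rewrite ?rmorphN ?rmorph1 ?rmorph0.
transitivity (\sum_(z : F | z != 0) \sum_(c : K | c != 0)
    \sum_(i < n.+1) \sum_(j < n.+1) A i j * U j z * V i c).
  apply: eq_bigr => z _; apply: eq_bigr => c _.
  rewrite tr_symmx_torus_mx det_map_torus_mx mulr_suml mulr_sumr;
    apply: eq_bigr => i _.
  rewrite mulr_suml mulr_sumr; apply: eq_bigr => j _.
  rewrite /A /U /V rmorphM !rmorphXn exprMn -exprM !exprD; ring.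
rewrite (eq_bigr (fun z => \sum_(i < n.+1) \sum_(j < n.+1)
    A i j * U j z * \sum_(c : K | c != 0) V i c)) => [|z _]; last first.
  rewrite exchange_big; apply: eq_bigr => i _; rewrite exchange_big.
  by apply: eq_bigr => j _; rewrite mulr_sumr.
rewrite exchange_big; apply: eq_bigr => i _; rewrite exchange_big.
apply: eq_bigr => j _; rewrite -mulr_suml -mulr_sumr.
by rewrite sumU sumV.
Qed.

End NonsplitTorus.

(** * Characters carried by the two symmetric powers *)

(** The torus exponents in each symmetric power form an arithmetic progression
    of step [p - 1], counted from the exponent [a + p b] of [nu]. *)
Lemma exponent1 a b n p j : (n + b).+2 = a -> (0 < p)%N -> (j <= n)%N ->
  (j + p * (n - j) + p.+1 * b.+1 = a + p * b + p.-1 * (n.+1 - j))%N.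
Proof.
move=> <-; case: p => // p _ jn; rewrite subSn // -[in LHS](subnKC jn) addKn.
rewrite -{2}(subnKC jn) /=; move: (n - j)%N => l; lia.
Qed.

Lemma exponent2 a b n p j : (n + a).+1 = (p + b)%N -> (b <= a)%N ->
  (0 < p)%N -> (j <= n)%N ->
  (j + p * (n - j) + p.+1 * a = a + p * b + p.-1 * (p - j))%N.
Proof.
move=> nE ba p0 jn; have jp : (j <= p)%N by lia.
case: p p0 nE jp => // p _ nE jp /=.
have {nE} nE : (n + a = p + b)%N by lia.
have [l nl] : exists l, n = (j + l)%N by exists (n - j)%N; rewrite subnKC.
have [d ad] : exists d, a = (b + d)%N by exists (a - b)%N; rewrite subnKC.
have -> : (p.+1 - j = (l + d).+1)%N by lia.
have -> : p = (j + l + d)%N by lia.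
rewrite nl ad addKn; nia.
Qed.

Lemma exponent_inj u p t t' : (0 < p.-1)%N -> (t <= p)%N -> (t' <= p)%N ->
  u + p.-1 * t == u + p.-1 * t' %[mod p.-1 * p.+1] -> t = t'.
Proof.
move=> p0 tp tp'; rewrite eqn_modDl -!muln_modr eqn_pmul2l //.
by rewrite !modn_small ?ltnS // => /eqP.
Qed.

(** The pairs of a weight and a label whose matrix entry is shown to be nonzero:
    the symmetric power is the one that carries the label [t], and [e] is its
    middle weight for [t] odd and the weight below for [t] even. *)
Definition detected (p a b h1 h2 e t : nat) : Prop :=
  ((0 < t < a - b /\ (odd t /\ e = b.+1 + h1 \/ ~~ odd t /\ e.+1 = b.+1 + h1))
  \/ (a - b < t <= p /\ (odd t /\ e = a + h2 \/ ~~ odd t /\ e.+1 = a + h2)))%N.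

Section Nonvanishing.
Variables (K F : finFieldType) (p : nat) (iota : {rmorphism K -> F}).
Variables (r : K) (s : F).
Hypotheses (pF : p \in [pchar F]) (K_card : #|K| = p).
Hypothesis F_card : #|F|.-1 = (p.-1 * p.+1)%N.
Hypotheses (two_neq0 : 2%:R != 0 :> F).
Hypotheses (s2 : s ^+ 2 = iota r) (sp : s ^+ p = - s) (s_neq0 : s != 0).
Hypothesis coords_ex : forall z, exists x y, z = iota x + iota y * s.

Local Notation tm := (torus_mx iota r s).

Definition twisted_sum n m k e : F :=
  \sum_(z : F | z != 0) \sum_(c : K | c != 0) z^-1 ^+ k * iota c^-1 ^+ e *
    (\tr (symmx n (map_mx iota (tm z *m mx2 c 0 0 1))) *
     \det (map_mx iota (tm z *m mx2 c 0 0 1)) ^+ m).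

Let twisted_sumE n m k e : twisted_sum n m k e = _ :=
  constituent_sum pF K_card two_neq0 s2 sp s_neq0 coords_ex n m k e.

Lemma twisted_sum_miss n m k e :
  (forall j : 'I_n.+1,
     (j + p * (n - j) + p.+1 * m == k %[mod #|F|.-1])%N = false) ->
  twisted_sum n m k e = 0.
Proof.
move=> miss; rewrite twisted_sumE big1 // => i _; rewrite big1 // => j _.
by rewrite /neg_indic miss mulr0 mul0r.
Qed.

(** Only one weight [i] and one torus character [j] survive the averages. *)
Lemma twisted_sum_hit h m k e (j0 : 'I_h.*2.+1) : (h.*2 < p.-1)%N ->
  (forall j : 'I_h.*2.+1,
     (j + p * (h.*2 - j) + p.+1 * m == k %[mod #|F|.-1])%N = (j == j0)) ->
  (~~ odd j0 /\ e = (m + h)%N) \/ (odd j0 /\ e.+1 = (m + h)%N) ->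
  twisted_sum h.*2 m k e != 0.
Proof.
move=> hp hit parity; have h_p : (h.*2 < p)%N by lia.
have [i0 [ei0]] : exists i0 : 'I_h.*2.+1, e = (i0 + m)%N /\
    (symmx h.*2 (eigenbasis s) i0 j0 != 0 /\ symmx h.*2 (eigenbasis_inv s) j0
      i0 != 0).
  have c0 : 2%:R^-1 != 0 :> F by rewrite invr_eq0.
  have s'0 : (2%:R * s)^-1 != 0 by rewrite invr_eq0 mulf_neq0.
  case: parity => -[oj eE].
    have hh : (h < h.*2.+1)%N by lia.
    exists (Ordinal hh); split; first by rewrite eE addnC.
    split; first exact: (symmx_middle_neq0 pF) (oner_neq0 _) s_neq0 _ oj.
    by apply: (symmx_nonsplit_tr pF) => //; exact: (symmx_middle_neq0 pF).
  case: h => [|h] in j0 hp hit h_p oj eE *.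
    by move: (ltn_ord j0) oj; rewrite ltnS leqn0 => /eqP ->.
  have hh : (h < h.+1.*2.+1)%N by lia.
  exists (Ordinal hh); split; first by rewrite /=; lia.
  split; first exact: (symmx_next_neq0 pF) (oner_neq0 _) s_neq0 _ oj.
  by apply: (symmx_nonsplit_tr pF) => //; exact: (symmx_next_neq0 pF).
case=> Q0 Q'0; rewrite twisted_sumE (bigD1 i0) //= [X in _ + X]big1 => [|i ii0].
  rewrite addr0 (bigD1 j0) //= big1 => [|j jj0]; last first.
    by rewrite /neg_indic hit (negPf jj0) mulr0 mul0r.
  rewrite addr0 /neg_indic hit eqxx ei0 eqxx mulrN1 mulrN1 opprK.
  by rewrite mulf_neq0.
rewrite big1 // => j _; rewrite {2}/neg_indic ei0 eqn_modDr !modn_small;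
  try lia.
  by rewrite val_eqE (negPf ii0) mulr0.
all: by rewrite K_card; apply: leq_ltn_trans hp; rewrite -ltnS ltn_ord.
Qed.

Variables (a b h1 h2 : nat).
Hypotheses (h1E : (h1.*2 + b).+2 = a) (h2E : (h2.*2 + a).+1 = (p + b)%N).

(** The two symmetric powers account for the exponents [t] strictly between
    [0] and [a - b], and strictly between [a - b] and [p + 1]. *)
Lemma brauer_twisted_sum_neq0 k e t :
  k = (a + p * b + p.-1 * t)%N %[mod #|F|.-1] ->
  detected p a b h1 h2 e t ->
  twisted_sum h1.*2 b.+1 k e + twisted_sum h2.*2 a k e != 0.
Proof.
move=> kE cases.
have p_gt0 : (0 < p)%N by exact: prime_gt0 (pcharf_prime pF).
have p_odd : odd p by clear -h1E h2E; lia.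
have p1 : (0 < p.-1)%N by rewrite -subn1 subn_gt0 prime_gt1 ?(pcharf_prime pF).
have h1p : (h1.*2.+1 <= p)%N by clear -h1E h2E; lia.
have ba : (b <= a)%N by clear -h1E; lia.
have tp : (t <= p)%N by clear -cases h1E h2E; case: cases => -[]; lia.
have hit1 (j : 'I_h1.*2.+1) :
    (j + p * (h1.*2 - j) + p.+1 * b.+1 == k %[mod #|F|.-1])%N =
    (t == h1.*2.+1 - j)%N :> bool.
  rewrite (exponent1 h1E p_gt0 (leq_ord j)) kE F_card.
  apply/idP/eqP => [/exponent_inj h|-> //]; rewrite h //.
  exact: leq_trans (leq_subr _ _) h1p.
have hit2 (j : 'I_h2.*2.+1) :
    (j + p * (h2.*2 - j) + p.+1 * a == k %[mod #|F|.-1])%N = (t == p - j)%N :>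
      bool.
  rewrite (exponent2 h2E ba p_gt0 (leq_ord j)) kE F_card.
  apply/idP/eqP => [/exponent_inj h|-> //]; rewrite h //.
  exact: leq_subr.
move: kE => _; case: cases => -[tI parity].
  rewrite [twisted_sum h2.*2 _ _ _]twisted_sum_miss ?addr0; last first.
    by move=> j; rewrite hit2; have := ltn_ord j; clear -tI h1E h2E; lia.
  have jh : (h1.*2.+1 - t < h1.*2.+1)%N by clear -tI h1E h2E; lia.
  apply: (@twisted_sum_hit _ _ _ _ (Ordinal jh)); first by clear -tI h1E h2E;
    lia.
    by move=> j; rewrite hit1 -val_eqE /=; have := ltn_ord j;
      clear -tI h1E h2E; lia.
  by case: parity => -[ot eE]; [left|right]; split=> //=;
    clear -tI h1E h2E ot eE p_odd; lia.
rewrite [twisted_sum h1.*2 _ _ _]twisted_sum_miss ?add0r; last first.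
  by move=> j; rewrite hit1; have := ltn_ord j; clear -tI h1E h2E; lia.
have jh : (p - t < h2.*2.+1)%N by clear -tI h1E h2E; lia.
apply: (@twisted_sum_hit _ _ _ _ (Ordinal jh)); first by clear -tI h1E h2E; lia.
  by move=> j; rewrite hit2 -val_eqE /=; have := ltn_ord j; clear -tI h1E h2E;
    lia.
by case: parity => -[ot eE]; [left|right]; split=> //=;
  clear -tI h1E h2E ot eE p_odd; lia.
Qed.

End Nonvanishing.

(** * Projections of weight vectors *)

(** The trace of an idempotent is its rank, so in characteristic zero trace
    one means rank one. *)
Lemma idempotent_tr1 (C : fieldType) n (f : 'M[C]_n) (u : 'cV[C]_n) :
  [pchar C] =i pred0 -> f *m f = f -> \tr f = 1 -> f *m u = u -> u != 0 ->
  forall w : 'cV[C]_n, exists a, f *m w = a *: u.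
Proof.
move=> C0 ff tf fu u0.
move: (row_base f) (col_base f) (mulmx_base f) (row_base_free f)
  (col_base_full f) => R Cf fE /row_freeP[B RB] /row_fullP[B' BC].
have RC : R *m Cf = 1%:M.
  have : Cf *m (R *m Cf) *m R = Cf *m R by rewrite !mulmxA fE -mulmxA fE ff.
  move/(congr1 (fun M => B' *m M *m B)).
  by rewrite !mulmxA BC mul1mx -!mulmxA RB mulmx1.
have r1 : \rank f = 1%N.
  have nat1 m : m%:R = 1 :> C -> m = 1%N.
    have /pcharf0P natr0 := C0.
    case: m => [|m] /eqP; first by rewrite eq_sym oner_eq0.
    by rewrite mulrS -subr_eq0 [1 + _]addrC addrK natr0 => /eqP ->.
  by apply: nat1; rewrite -(mxtrace1 C) -RC mxtrace_mulC fE.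
move: R Cf fE {B RB B' BC RC}; rewrite r1 => R Cf fE w.
have scal (x : 'M[C]_1) : Cf *m x = x 0 0 *: Cf.
  by rewrite {1}[x]mx11_scalar mul_mx_scalar.
have fx x : f *m x = (R *m x) 0 0 *: Cf by rewrite -fE -mulmxA scal.
have Ru0 : (R *m u) 0 0 != 0.
  by apply: contra u0 => /eqP Ru; rewrite -fu fx Ru scale0r.
exists ((R *m w) 0 0 / (R *m u) 0 0).
have CfE : Cf = ((R *m u) 0 0)^-1 *: u.
  by rewrite -{2}fu fx scalerA mulVf // scale1r.
by rewrite fx {1}CfE scalerA.
Qed.

Section Projectors.
Variables (K F : finFieldType) (C : numFieldType) (p : nat).
Variables (P : C -> Prop) (tau : F -> C) (iota : {rmorphism K -> F}).
Hypotheses (P_prime : prime_over p P) (tauP : teichmuller P tau).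
Variables (r : K) (s : F).
Hypotheses (pF : p \in [pchar F]) (K_card : #|K| = p).
Hypothesis F_card : #|F|.-1 = (p.-1 * p.+1)%N.
Hypotheses (two_neq0 : 2%:R != 0 :> F).
Hypotheses (s2 : s ^+ 2 = iota r) (sp : s ^+ p = - s) (s_neq0 : s != 0).
Hypothesis coords_ex : forall z, exists x y, z = iota x + iota y * s.
Hypothesis coords_free :
  forall x y, iota x + iota y * s = 0 -> (x, y) = (0, 0).

Variables (a b h1 h2 : nat).
Hypotheses (h1E : (h1.*2 + b).+2 = a) (h2E : (h2.*2 + a).+1 = (p + b)%N).

Variable rho : mx_representation C [set: {'GL_2[K]}] p.-1.
Local Notation rhoM := (rhomx rho).
Local Notation tm := (torus_mx iota r s).

Hypothesis rho_central :
  forall c, c != 0 -> rhoM c%:M = (tau (iota c) ^+ (a + p * b))%:M.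
Hypothesis rho_split : forall c, c != 0 -> c != 1 ->
  \tr (rhoM (mx2 c 0 0 1)) = 0.
Hypothesis rho_reduces : forall M : 'M[K]_2, M \in unitmx ->
  reduces P tau (\tr (rhoM M)) (brauer a b h1.*2 h2.*2 (map_mx iota M)).

Definition torus_sum k : 'M[C]_(p.-1) :=
  \sum_(z : F | z != 0) tau z^-1 ^+ k *: rhoM (tm z).

Definition weight_sum e : 'M[C]_(p.-1) :=
  \sum_(c : K | c != 0) tau (iota c^-1) ^+ e *: rhoM (mx2 c 0 0 1).

Let tm_unit z : z != 0 -> tm z \in unitmx :=
  torus_mx_unit s2 coords_ex coords_free (z := z).
Let tm_mul z w : tm (z * w) = tm z *m tm w := torus_mxM s2 coords_ex
  coords_free z w.
Let tau_mul := tauM tauP.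

Lemma split_unit (c : K) : c != 0 -> mx2 c 0 0 1 \in unitmx.
Proof. by move=> c0; rewrite diag_unit ?oner_eq0. Qed.

Lemma tau_expV x k : x != 0 -> tau x ^+ k * tau x^-1 ^+ k = 1.
Proof. by move=> x0; rewrite -exprMn -tau_mul divff // (tau1 tauP) expr1n. Qed.

Lemma torus_sum_eigen z k : z != 0 ->
  rhoM (tm z) *m torus_sum k = tau z ^+ k *: torus_sum k.
Proof.
move=> z0; rewrite mulmx_sumr scaler_sumr.
rewrite [RHS](reindex_onto (fun w => z * w) (fun w => z^-1 * w)) /= => [|w _];
  last by rewrite mulVKf.
apply: eq_big => w; first by rewrite mulf_eq0 (negPf z0) mulKf // eqxx andbT.
move=> w0; rewrite tm_mul rhomxM ?tm_unit // -scalemxAr scalerA.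
by rewrite invfM tau_mul exprMn mulrA tau_expV // mul1r.
Qed.

Lemma torus_sum_comm z k : z != 0 ->
  torus_sum k *m rhoM (tm z) = rhoM (tm z) *m torus_sum k.
Proof.
move=> z0; rewrite mulmx_sumr mulmx_suml; apply: eq_bigr => w w0.
by rewrite -scalemxAl -scalemxAr -!rhomxM ?tm_unit // -!tm_mul mulrC.
Qed.

Lemma torus_sum_total : \sum_(k < #|F|.-1) torus_sum k = #|F|.-1%:R%:M.
Proof.
rewrite exchange_big /= (bigD1 1) ?oner_neq0 //= [X in _ + X]big1 => [|z].
  rewrite addr0 invr1 (tau1 tauP) (eq_bigr (fun=> 1%:M)) => [|k _].
    by rewrite sumr_const card_ord -scaler_nat scalemx1.
  by rewrite expr1n scale1r (torus_mx1 r coords_ex coords_free) rhomx1.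
case/andP=> z0 z1; rewrite -scaler_suml (tau_char_sum P_prime tauP) ?invr_eq0
  //.
by rewrite invr_eq1 (negPf z1) scale0r.
Qed.

(** The trace of the product of the two averages, expanded over pairs of torus
    elements, reduces term by term to the sum of the two constituents. *)
Lemma tr_torus_weight k e :
  reduces P tau (\tr (torus_sum k *m weight_sum e))
    (twisted_sum iota r s h1.*2 b.+1 k e + twisted_sum iota r s h2.*2 a k e).
Proof.
rewrite /twisted_sum -big_split mulmx_suml raddf_sum /=.
apply: (reduces_sum P_prime tauP) => z z0; rewrite -big_split.
rewrite mulmx_sumr raddf_sum /=; apply: (reduces_sum P_prime tauP) => c c0.
rewrite -scalemxAl -scalemxAr scalerA mxtraceZ -mulrDr.
apply: (reducesM P_prime tauP).
  by apply: (reducesM P_prime tauP); apply: (reducesX P_prime tauP);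
     exact: (reduces_tau tau P_prime).
by rewrite -rhomxM ?tm_unit ?split_unit //; apply: rho_reduces;
   rewrite unitmx_mul tm_unit ?split_unit.
Qed.

Lemma tr_weight e : \tr (weight_sum e) = p.-1%:R.
Proof.
rewrite raddf_sum /= (bigD1 1) ?oner_neq0 //= big1 => [|c /andP[c0 c1]].
  by rewrite addr0 invr1 rmorph1 (tau1 tauP) expr1n scale1r -scalar_mx2 rhomx1
    mxtrace1.
by rewrite mxtraceZ rho_split ?mulr0.
Qed.

Lemma weight_sum_eigen c e : c != 0 ->
  rhoM (mx2 c 0 0 1) *m weight_sum e = tau (iota c) ^+ e *: weight_sum e.
Proof.
move=> c0; rewrite mulmx_sumr scaler_sumr.
rewrite [RHS](reindex_onto (fun w => c * w) (fun w => c^-1 * w)) /= => [|w _];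
  last by rewrite mulVKf.
apply: eq_big => w; first by rewrite mulf_eq0 (negPf c0) mulKf // eqxx andbT.
move=> w0; rewrite -scalemxAr -rhomxM ?split_unit // mulmx2 scalerA.
rewrite !(mul0r, mulr0, addr0, add0r, mulr1, mul1r) invfM rmorphM tau_mul.
by rewrite exprMn mulrA [iota c^-1]fmorphV tau_expV ?fmorph_eq0 // mul1r.
Qed.

Let p1_neq0 : p.-1%:R != 0 :> C.
Proof.
rewrite pnatr_eq0 -lt0n -subn1 subn_gt0.
exact: prime_gt1 (pcharf_prime pF).
Qed.

Let card_K_neq0 : #|[pred c : K | c != 0]| = p.-1.
Proof.
rewrite -K_card [in RHS](cardD1 (0 : K)) inE /=.
by apply: eq_card => y; rewrite !inE andbT.
Qed.

Section WeightVector.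
Variables (e : nat) (u : 'cV[C]_(p.-1)).
Hypotheses (u_neq0 : u != 0).
Hypothesis u_weight : forall c, c != 0 ->
  rhoM (mx2 c 0 0 1) *m u = tau (iota c) ^+ e *: u.

Lemma weight_sum_vector (w : 'cV[C]_(p.-1)) :
  (forall c, c != 0 -> rhoM (mx2 c 0 0 1) *m w = tau (iota c) ^+ e *: w) ->
  weight_sum e *m w = p.-1%:R *: w.
Proof.
move=> w_weight; rewrite mulmx_suml (eq_bigr (fun=> w)) => [|c c0].
  by rewrite sumr_const card_K_neq0 scaler_nat.
rewrite -scalemxAl w_weight // scalerA mulrC fmorphV.
by rewrite tau_expV ?fmorph_eq0 // scale1r.
Qed.

Lemma weight_line w : exists l, weight_sum e *m w = l *: u.
Proof.
pose f := p.-1%:R^-1 *: weight_sum e.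
have ff : f *m f = f.
  rewrite /f -scalemxAl -scalemxAr mulmx_suml (eq_bigr (fun=> weight_sum e)).
    by rewrite sumr_const card_K_neq0 -scaler_nat !scalerA -mulrA mulVf //
      mulr1.
  move=> c c0; rewrite -scalemxAl weight_sum_eigen // scalerA mulrC.
  by rewrite fmorphV tau_expV ?fmorph_eq0 // scale1r.
have tf : \tr f = 1 by rewrite mxtraceZ tr_weight mulVf.
have fu : f *m u = u by rewrite -scalemxAl weight_sum_vector // scalerA mulVf
  // scale1r.
have [l fl] := idempotent_tr1 (pchar_num C) ff tf fu u_neq0 w.
exists (p.-1%:R * l); rewrite -scalerA -fl -scalemxAl scalerA mulfV //.
by rewrite scale1r.
Qed.

(** A weight vector spans the image of the rank one operator [weight_sum e], so
    it is killed by [torus_sum k] only when the trace of the product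
    vanishes. *)
Lemma torus_sum_neq0 k t :
  k = (a + p * b + p.-1 * t)%N %[mod #|F|.-1] ->
  detected p a b h1 h2 e t ->
  torus_sum k *m u != 0.
Proof.
move=> kE cases; have := brauer_twisted_sum_neq0 pF K_card F_card two_neq0 s2
  sp s_neq0
  coords_ex h1E h2E kE cases.
move/(reduces_neq0 P_prime tauP (tr_torus_weight k e));
  apply: contra => /eqP ku0.
apply/eqP; suff -> : torus_sum k *m weight_sum e = 0 by rewrite mxtrace0.
apply/matrixP => i j; pose w : 'cV[C]_(p.-1) := delta_mx j 0.
have [l wl] := weight_line w.
have : torus_sum k *m (weight_sum e *m w) = 0.
  by rewrite wl -scalemxAr ku0 scaler0.
by rewrite mulmxA -colE => /matrixP/(_ i 0); rewrite !mxE.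
Qed.

(** The element [s] of the torus is antidiagonal, so it normalises the split
    torus; it preserves the weight line when the weight is self-dual with
    respect to the central character. *)
Lemma root_preserves_line :
  (forall c : K, c != 0 -> tau (iota c) ^+ (e + e) = tau (iota c) ^+ (a + p *
    b)) ->
  exists l, rhoM (tm s) *m u = l *: u.
Proof.
move=> self_dual; have us := tm_unit s_neq0.
have [l wl] := weight_line (rhoM (tm s) *m u).
exists (p.-1%:R^-1 * l); rewrite -scalerA -wl weight_sum_vector; last first.
  move=> c c0; have c'0 : c^-1 != 0 by rewrite invr_eq0.
  have uc : (c%:M : 'M[K]_2) \in unitmx by rewrite scalar_mx2 diag_unit.
  rewrite mulmxA -rhomxM ?split_unit //.
  have -> : mx2 c 0 0 1 *m tm s = tm s *m (c%:M *m mx2 c^-1 0 0 1).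
    rewrite torus_mx_root // scalar_mx2 !mulmx2.
    by apply: mx2P; rewrite !mx2E; field.
  rewrite !rhomxM ?unitmx_mul ?uc ?split_unit // rho_central // mul_scalar_mx.
  rewrite -mulmxA -scalemxAl u_weight // scalerA -scalemxAr; congr (_ *: _).
  rewrite -self_dual // exprD -mulrA fmorphV.
  by rewrite tau_expV ?fmorph_eq0 // mulr1.
by rewrite scalerA mulVf // scale1r.
Qed.

(** A nonzero projection is an eigenvector for the same scalar, since the torus
    is commutative. *)
Lemma root_eigenvalue k l :
  rhoM (tm s) *m u = l *: u -> torus_sum k *m u != 0 -> l = tau s ^+ k.
Proof.
move=> su ku0; apply/eqP; rewrite -subr_eq0; apply: contraR ku0 => l0.
have : torus_sum k *m (rhoM (tm s) *m u) = tau s ^+ k *: (torus_sum k *m u).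
  by rewrite mulmxA torus_sum_comm // torus_sum_eigen // -scalemxAl.
rewrite su -scalemxAr => /eqP; rewrite -subr_eq0 -scalerBl scaler_eq0.
by rewrite (negPf l0).
Qed.

End WeightVector.
End Projectors.

(** * Labels of characters *)

Section Labels.
Variables (p : nat) (F : finFieldType) (C : numFieldType).
Variables (P : C -> Prop) (tau : F -> C).
Hypotheses (P_prime : prime_over p P) (tauP : teichmuller P tau).
Hypotheses (pr : prime p) (F_card : #|F|.-1 = (p.-1 * p.+1)%N).

Lemma k_of_tau (chi : F -> C) k : (k < #|F|.-1)%N ->
  (forall x, x != 0 -> chi x = tau x ^+ k) -> k_of p tau chi = k.
Proof.
move=> kq chiE; have p0 : (0 < p)%N := prime_gt0 pr.
rewrite /k_of; case: pickP => [[r s] /= /andP[rs /eq_charP chi_rsE]|none].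
  have : (r + p * s = k %[mod #|F|.-1])%N.
    by apply/(eq_tau_exp P_prime tauP) => x x0; rewrite -chiE // chi_rsE.
  rewrite !modn_small // F_card.
  move: rs (ltn_ord r) (ltn_ord s); move: (r : nat) (s : nat) => i j.
  by clear -p0; case: p p0 => // q _ /=; nia.
have sp : (k %/ p < p)%N by rewrite ltn_divLR //; rewrite F_card in kq;
  clear -kq p0; nia.
have rp : (k %% p < p)%N by rewrite ltn_mod.
have := none (Ordinal rp, Ordinal sp); rewrite /= -[RHS]/false => /negbT/negP[].
have kE : (k %% p + p * (k %/ p) = k)%N by rewrite addnC mulnC -divn_eq.
apply/andP; split; last by apply/eq_charP => x x0; rewrite /chi_rs kE chiE.
apply: contraL kq => /andP[/eqP r1 /eqP s1]; rewrite -leqNgt F_card -kE r1 s1.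
by clear -p0; nia.
Qed.

Variables (nu : F -> C) (a b : nat).
Hypotheses (p_odd : odd p) (a_lt : (a < p)%N) (b_lt : (b < a)%N).
Hypothesis nuE : forall x, x != 0 -> nu x = tau x ^+ (a + p * b).

Lemma k_of_nu : k_of p tau nu = (a + p * b)%N.
Proof.
apply: k_of_tau nuE; rewrite F_card; clear -a_lt b_lt.
by case: p a_lt => // q; nia.
Qed.

Lemma nu_conj x : x != 0 -> nu x ^+ p = tau x ^+ (b + p * a).
Proof.
move=> x0; rewrite nuE // -exprM; move: x x0; apply/(eq_tau_exp P_prime tauP).
rewrite F_card.
have [q pE] : exists q, p = q.+1 by exists p.-1; rewrite prednK ?prime_gt0.
have -> : ((a + p * b) * p = b * (p.-1 * p.+1) + (b + p * a))%N.
  by rewrite pE /=; clear; nia.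
by rewrite modnMDl.
Qed.

Lemma k_of_nu_conj : k_of p tau (fun x => nu x ^+ p) = (b + p * a)%N.
Proof.
apply: k_of_tau nu_conj; rewrite F_card; clear -a_lt b_lt.
by case: p a_lt => // q; nia.
Qed.

(** The label [t] is normalised to [0 <= t <= p]; adding the even number
    [p + 1] changes neither its parity nor its type. *)
Lemma char_label (chi : F -> C) k : (k < #|F|.-1)%N ->
  (forall x, x != 0 -> chi x = tau x ^+ k) ->
  k = (a + p * b)%N %[mod p.-1] ->
  exists t, [/\ (t <= p)%N, k = (a + p * b + p.-1 * t)%N %[mod #|F|.-1],
    oddz (t_of p tau nu chi) = odd t
    & type1 p tau nu chi = (0 < t < a - b)%N].
Proof.
move=> kq chiE kmod; rewrite /t_of /type1 k_of_nu k_of_nu_conj.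
rewrite (k_of_tau kq chiE) {chiE}.
have [q pE] : exists q, p = q.+2.
  exists p.-2; have := prime_gt1 pr; clear; case: p => [|[|]] //.
have kE : (b + p * a = a + p * b + p.-1 * (a - b))%N.
  have [d aE] : exists d, a = (b + d)%N by exists (a - b)%N;
    rewrite subnKC // ltnW.
  by rewrite aE addKn pE /=; clear; nia.
have p1 : (0 < p.-1)%N by rewrite pE.
have p10 : p.-1%:Z != 0 by rewrite eqz_nat -lt0n.
have [lek|ltk] := leqP (a + p * b) k.
  have /dvdnP[t tE] : (p.-1 %| k - (a + p * b))%N by rewrite -eqn_mod_dvd //
    kmod.
  have {tE} tE : k = (a + p * b + p.-1 * t)%N by rewrite [(p.-1 * _)%N]mulnC
    -tE subnKC.
  exists t; split.
  - move: kq; rewrite tE F_card => /(leq_ltn_trans (leq_addl _ _)).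
    by rewrite ltn_pmul2l.
  - by rewrite tE.
  - by rewrite tE PoszD addrC addKr PoszM mulrC mulzK // /oddz dvdzE dvdn2
      negbK.
  - rewrite kE tE -[X in (X < _)%N]addn0 !ltn_add2l muln_gt0 p1 /=.
    by rewrite ltn_pmul2l.
have /dvdnP[m mE] : (p.-1 %| a + p * b - k)%N.
  by rewrite -eqn_mod_dvd ?(ltnW ltk) // eq_sym kmod.
have {mE} mE : (a + p * b = k + p.-1 * m)%N by rewrite [(p.-1 * _)%N]mulnC -mE
  subnKC // ltnW.
have m0 : (0 < m)%N.
  by rewrite lt0n; apply: contraTneq ltk => m0; rewrite mE m0 muln0 addn0 ltnn.
have mp : (m + (a - b) <= p.+1)%N.
  have [d aE] : exists d, a = (b + d)%N by exists (a - b)%N;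
    rewrite subnKC // ltnW.
  rewrite leqNgt; apply/negP => h; move: mE a_lt h; rewrite aE addKn pE /=;
    clear.
  by move=> mE bd h; nia.
exists (p.+1 - m)%N; split.
- by rewrite leq_subLR -add1n leq_add2r.
- rewrite F_card -[LHS](modnMDl 1) mul1n mE -addnA -mulnDr subnKC; last first.
    by apply: leq_trans mp; apply: leq_addr.
  by rewrite addnC.
- rewrite mE PoszD opprD addrA subrr sub0r PoszM mulrC -mulNr mulzK //.
  rewrite /oddz dvdzE abszN dvdn2 negbK oddB /= ?p_odd //.
  by apply: leq_trans mp; apply: leq_addr.
- rewrite mE ltnNge leq_addr /=; apply/esym/negbTE; rewrite negb_and -!leqNgt.
  by rewrite leq_subRL ?mp ?orbT //; apply: leq_trans mp; apply: leq_addr.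
Qed.

End Labels.

(** * Cuspidal representations over the prime field *)
Lemma eigenvalue_mx2 (A : fieldType) (M : 'M[A]_2) (z : A) :
  z ^+ 2 = (M 0 0 + M 1 1) * z - \det M -> eigenvalue M z.
Proof.
move=> zE; rewrite /eigenvalue /eigenspace kermx_eq0 row_free_unit unitmxE.
rewrite unitfE negbK det_mx2E !mxE /= !mulr1n !mulr0n !subr0; apply/eqP.
rewrite det_mx2E in zE.
transitivity (z ^+ 2 - ((M 0 0 + M 1 1) * z - (M 0 0 * M 1 1 - M 0 1 * M 1 0))).
  by ring.
by rewrite zE subrr.
Qed.

Section CuspidalPrimeField.
Variables (p : nat) (F : finFieldType) (C : numFieldType).
Variables (P : C -> Prop) (tau nu : F -> C).
Hypotheses (P_prime : prime_over p P) (tauP : teichmuller P tau).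
Hypotheses (pF : p \in [pchar F]) (F_card : #|F| = (p ^ 2)%N).
Variables (a b : nat).
Hypothesis nuE : forall x, x != 0 -> nu x = tau x ^+ (a + p * b).
Variable rho : mx_representation C [set: {'GL_2['F_p]}] p.-1.
Hypothesis rhoP : cuspidal_rep nu rho.

Local Notation iota := (Fp_emb pF).

Lemma cuspidal_no_fixed (u : 'cV[C]_(p.-1)) :
  (forall x : 'F_p, rhomx rho (mx2 1 x 0 1) *m u = u) -> u = 0.
Proof.
move=> fixu; apply: (cuspidal_unip rhoP) => g x gE.
by rewrite -{2}(fixu x) -gE /rhomx GLvalK.
Qed.

Lemma cuspidal_scalar c : c != 0 ->
  rhomx rho c%:M = (tau (iota c) ^+ (a + p * b))%:M.
Proof.
move=> c0; rewrite -nuE ?fmorph_eq0 //.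
rewrite /rhomx (cuspidal_central rhoP (c := c)) //.
by rewrite GLmxK // scalar_mx2 diag_unit.
Qed.

Lemma cuspidal_elliptic (M : 'M['F_p]_2) (z : F) : M \in unitmx ->
  (forall c, z != iota c) ->
  z ^+ 2 = iota (M 0 0 + M 1 1) * z - iota (\det M) ->
  \tr (rhomx rho M) = - (tau z ^+ (a + p * b) + (tau z ^+ (a + p * b)) ^+ p).
Proof.
move=> uM z_out zE; have z0 : z != 0 by rewrite -(rmorph0 iota); exact: z_out.
rewrite -nuE // /rhomx (cuspidal_trace rhoP (z := z)) // GLmxK //.
  by apply: eigenvalue_mx2; rewrite zE (det_map_mx iota) !mxE rmorphD.
apply: eigenvalue_mx2; rewrite (det_map_mx iota) !mxE -(rmorphD iota).
have iota_p c : iota c ^+ p = iota c by exact: Fp_in_exp.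
by rewrite exprAC zE exprD_pchar // exprN_pchar // exprMn !iota_p.
Qed.

End CuspidalPrimeField.

(** * The nonsplit torus acting on the representation *)

Lemma mulmx2_nonsplit (A : comNzRingType) (x y x' y' d : A) :
  mx2 x y (y * d) x *m mx2 x' y' (y' * d) x' =
  mx2 (x * x' + y * y' * d) (x * y' + y * x') ((x * y' + y * x') * d)
    (x * x' + y * y' * d).
Proof. by rewrite mulmx2; apply: mx2P; rewrite !mx2E; ring. Qed.

Lemma mul_quadratic (A : comNzRingType) (x y x' y' d s : A) : s ^+ 2 = d ->
  (x + y * s) * (x' + y' * s) = x * x' + y * y' * d + (x * y' + y * x') * s.
Proof. by move=> <-; ring. Qed.

Section PadicTorus.
Variables (p : nat) (pr : prime p) (xi : padicZ pr).
Variables (K : fieldExtType (padicQ pr)) (sK : K).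
Hypothesis xi_ns : forall c : 'F_p, c ^+ 2 != residue xi.
Hypotheses (dimK : \dim {: K} = 2%N) (sK2 : sK ^+ 2 = (ZtoQ xi)%:A).
Variables (C : fieldType) (V : lmodType C) (pi : 'M[padicQ pr]_2 -> V -> V).
Hypothesis piP : GL2_rep pi.

Lemma torus_unit x y : (x, y) != (0, 0) -> torus xi x y \in unitmx.
Proof.
apply: contraR; rewrite mx2_unit negbK subr_eq0 => /eqP xy.
apply/eqP/(padicQ_anisotropic xi_ns).
by rewrite expr2 xy mulrA mulrC expr2.
Qed.

Lemma torusM x y x' y' : torus xi x y *m torus xi x' y' =
  torus xi (x * x' + y * y' * ZtoQ xi) (x * y' + y * x').
Proof.
exact: mulmx2_nonsplit.
Qed.

Lemma KeltM x y x' y' : Kelt sK x y * Kelt sK x' y' =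
  Kelt sK (x * x' + y * y' * ZtoQ xi) (x * y' + y * x').
Proof.
rewrite /Kelt -!(mulr_algl _ sK) (mul_quadratic _ _ _ _ sK2).
by rewrite -!(rmorphM (in_alg K)) -!(rmorphD (in_alg K)).
Qed.

Lemma pi_lin g a u v : g \in unitmx -> pi g (a *: u + v) = a *: pi g u + pi g v.
Proof. by move=> ug; apply: (GL2_rep_linear piP). Qed.

Lemma pi0 g : g \in unitmx -> pi g 0 = 0.
Proof.
move=> ug; have := pi_lin 1 0 0 ug; rewrite scale1r addr0 scale1r => h.
by apply: (addrI (pi g 0)); rewrite -h addr0.
Qed.

Lemma piZ g a u : g \in unitmx -> pi g (a *: u) = a *: pi g u.
Proof. by move=> ug; rewrite -[a *: u]addr0 pi_lin // pi0 // addr0. Qed.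

Lemma piD g u v : g \in unitmx -> pi g (u + v) = pi g u + pi g v.
Proof. by move=> ug; rewrite -[u]scale1r pi_lin // !scale1r. Qed.

Lemma pi_sum g (s : seq V) : g \in unitmx ->
  pi g (\sum_(u <- s) u) = \sum_(u <- s) pi g u.
Proof.
move=> ug; elim: s => [|u s IHs]; first by rewrite !big_nil pi0.
by rewrite !big_cons piD // IHs.
Qed.

Lemma eigenvectorZ chi a u : eigenvector xi sK pi chi u ->
  eigenvector xi sK pi chi (a *: u).
Proof.
move=> eu x y xy; rewrite piZ ?torus_unit // eu //.
by rewrite !scalerA mulrC.
Qed.

(** An eigenvector for a character different from [chi], as in the definition
    of an eigenprojection. *)
Definition foreign chi u := exists chi' : K -> C,
  (exists2 z, z != 0 & chi' z != chi z) /\ eigenvector xi sK pi chi' u.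

Lemma foreignZ chi a u : foreign chi u -> foreign chi (a *: u).
Proof. by case=> chi' [z eu]; exists chi'; split=> //; exact: eigenvectorZ. Qed.

Lemma torus_coords z : z != 0 ->
  exists x y, z = Kelt sK x y /\ (x, y) != (0, 0).
Proof.
move=> z0; have [x [y zE]] := Kelt_onto z xi_ns sK2 dimK.
exists x, y; split=> //; apply: contra z0 => /eqP[x0 y0].
by rewrite zE x0 y0 /Kelt !scale0r addr0.
Qed.

(** Eigenvectors for other characters cannot add up to one for [chi]: applying
    the difference of an operator and one of its eigenvalues shortens the
    sum. *)
Lemma eigenvectors_independent chi (s : seq V) w :
  eigenvector xi sK pi chi w -> (forall u, u \in s -> foreign chi u) ->
  w = \sum_(u <- s) u -> w = 0.
Proof.
have [n] := ubnP (size s); elim: n s w => // n IHn [|u s] w sn ew fs wE.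
  by rewrite wE big_nil.
have [chi' [[z z0 ne] eu]] := fs u (mem_head _ _).
have [x [y [zE xy]]] := torus_coords z0.
have ut := torus_unit xy; set g := torus xi x y in ut.
pose D v := pi g v - chi' z *: v.
have D0 : D w = 0.
  apply: (IHn [seq D v | v <- s]); first by rewrite size_map.
  - by rewrite /D ew // -scalerBl; apply: eigenvectorZ.
  - move=> _ /mapP[v vs ->]; have fv : foreign chi v.
      by apply: fs; rewrite inE vs orbT.
    have [chi'' [ne'' ev]] := fv.
    by rewrite /D ev // -scalerBl; apply: foreignZ.
  rewrite {1}/D wE pi_sum // scaler_sumr -sumrB !big_cons big_map.
  by rewrite eu // -zE subrr add0r.
move: D0; rewrite /D ew // -zE -scalerBl => /eqP; rewrite scaler_eq0 subr_eq0.
by rewrite eq_sym (negPf ne) => /eqP.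
Qed.

(** Subtracting [l] from the operator kills [v] but multiplies its
    [chi]-component by a nonzero scalar, so independence applies. *)
Lemma not_test_vector chi v l x y : (x, y) != (0, 0) ->
  pi (torus xi x y) v = l *: v -> chi (Kelt sK x y) != l ->
  ~ test_vector xi sK pi chi v.
Proof.
move=> xy vl ne [w [ew [s vE fs]]] /negP[]; apply/eqP.
have ut := torus_unit xy; set g := torus xi x y in ut vl.
pose D u := pi g u - l *: u.
have Dw : D w = (chi (Kelt sK x y) - l) *: w by rewrite /D ew // scalerBl.
have : - D w = 0.
  apply: (@eigenvectors_independent chi [seq D u | u <- s]).
  - by rewrite Dw -scaleNr; exact: eigenvectorZ.
  - move=> _ /mapP[u us ->]; have [chi' [_ ne' eu]] := fs u us.
    rewrite /D eu // -scalerBl; apply: foreignZ; exists chi'; by split.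
  apply/eqP; rewrite eqr_oppLR -addr_eq0 big_map.
  have : D v = 0 by rewrite /D vl subrr.
  rewrite {1}vE /D piD // pi_sum // scalerDr scaler_sumr sumrB opprD addrACA.
  by move=> ->.
move/eqP; rewrite oppr_eq0 Dw scaler_eq0 subr_eq0 (negPf ne) /=.
by move/eqP.
Qed.

(** The matrices of the torus multiply like elements of [K], so the eigenvalues
    form a character; this produces the characters that the decomposition of an
    eigenprojection requires. *)
Lemma eigenvector_char v : v != 0 ->
  (forall x y, (x, y) != (0, 0) -> exists c, pi (torus xi x y) v = c *: v) ->
  exists chi, is_char chi /\ eigenvector xi sK pi chi v.
Proof.
move=> v0 ev.
have v_inj c d : c *: v = d *: v -> c = d.
  by move/eqP; rewrite -subr_eq0 -scalerBl scaler_eq0 (negPf v0) orbF subr_eq0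
    => /eqP.
have /boolp.choice[chi chiE] (z : K) : exists c, forall x y, z = Kelt sK x y ->
    (x, y) != (0, 0) -> pi (torus xi x y) v = c *: v.
  have [x [y zE]] := Kelt_onto z xi_ns sK2 dimK.
  have uniq x' y' : z = Kelt sK x' y' -> (x', y') = (x, y).
    move=> zE'; have : Kelt sK (x' - x) (y' - y) = 0.
      rewrite /Kelt !scalerBl addrACA -opprD.
      by rewrite -/(Kelt sK x' y') -zE' -/(Kelt sK x y) -zE subrr.
    move/(Kelt_inj xi_ns sK2)/eqP; rewrite xpair_eqE !subr_eq0.
    by case/andP=> /eqP-> /eqP->.
  have [xy0|/ev[c cE]] := eqVneq (x, y) (0, 0).
    by exists 0 => x' y' /uniq ->; rewrite xy0 eqxx.
  by exists c => x' y' /uniq[-> ->].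
have chi_ev x y : (x, y) != (0, 0) ->
  pi (torus xi x y) v = chi (Kelt sK x y) *: v by exact: chiE.
exists chi; split; last exact: chi_ev.
split=> [|z w z0 w0].
  apply: v_inj; rewrite scale1r -(chiE 1 1 0).
  - have -> : torus xi 1 0 = 1%:M by rewrite /torus mul0r scalar_mx2.
    exact: (GL2_rep_1 piP).
  - by rewrite /Kelt scale1r scale0r addr0.
  - by rewrite xpair_eqE oner_eq0.
have [x [y [zE xy]]] := torus_coords z0;
  have [x' [y' [wE xy']]] := torus_coords w0.
have zw0 : z * w != 0 by rewrite mulf_neq0.
apply: v_inj; rewrite -(chiE (z * w) (x * x' + y * y' * ZtoQ xi) (x * y' + y *
  x')).
- rewrite -torusM (GL2_rep_mul piP (torus_unit xy) (torus_unit xy')).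
  rewrite (chi_ev _ _ xy') (piZ _ _ (torus_unit xy)) (chi_ev _ _ xy) -zE -wE.
  by rewrite scalerA [chi w * _]mulrC.
- by rewrite zE wE KeltM.
apply: contra zw0 => /eqP[x0 y0].
by rewrite zE wE KeltM x0 y0 /Kelt !scale0r addr0.
Qed.

End PadicTorus.

(** * Depth zero representations *)

Section DepthZero.
Variables (p : nat) (pr : prime p) (xi : padicZ pr).
Variables (K : fieldExtType (padicQ pr)) (sK : K).
Hypothesis xi_ns : forall c : 'F_p, c ^+ 2 != residue xi.
Hypotheses (dimK : \dim {: K} = 2%N) (sK2 : sK ^+ 2 = (ZtoQ xi)%:A).
Variables (F : finFieldType) (sF : F).
Hypotheses (pF : p \in [pchar F]) (sF2 : sF ^+ 2 = Fp_emb pF (residue xi)).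
Hypothesis coords_ex : forall z, exists x y, z = Fp_emb pF x + Fp_emb pF y * sF.
Hypothesis coords_free :
  forall x y, Fp_emb pF x + Fp_emb pF y * sF = 0 -> (x, y) = (0, 0).
Variables (C : numFieldType) (P : C -> Prop) (tau : F -> C).
Hypotheses (P_prime : prime_over p P) (tauP : teichmuller P tau).
Variables (omega : padicQ pr -> C) (V : lmodType C).
Variable pi : 'M[padicQ pr]_2 -> V -> V.
Hypothesis piP : GL2_rep pi.
Hypothesis pi_central : forall (x : padicQ pr) (v : V),
  x != 0 -> pi x%:M v = omega x *: v.
Variables (rho : mx_representation C [set: {'GL_2['F_p]}] p.-1).
Variable phi : {linear 'cV[C]_(p.-1) -> V}.
Hypothesis phi_inj : injective phi.
Hypothesis phi_act :
  forall (h : 'M[padicZ pr]_2) (g : {'GL_2['F_p]}) (u : 'cV[C]_(p.-1)),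
    h \in unitmx -> GLval g = map_mx (@residue p pr) h ->
    pi (map_mx (@ZtoQ p pr) h) (phi u) = phi (rho g *m u).

Local Notation iota := (Fp_emb pF).
Local Notation tm := (torus_mx iota (residue xi) sF).
Local Notation rhoM := (rhomx rho).

Lemma residual_act (h : 'M[padicZ pr]_2) M u :
  M \in unitmx -> map_mx (@residue p pr) h = M ->
  pi (map_mx (@ZtoQ p pr) h) (phi u) = phi (rhoM M *m u).
Proof.
move=> uM hM; apply: phi_act; last by rewrite GLmxK.
by rewrite unitmxE residue_unit -det_map_mx hM -unitfE -unitmxE.
Qed.

Lemma residual_torus_neq0 (x y : padicZ pr) :
  (residue x, residue y) != (0, 0) -> iota (residue x) + iota (residue y) * sF
    != 0.
Proof. by apply: contra => /eqP/coords_free ->. Qed.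

(** The scalar [l] acts by the central character and the primitive part is an
    element of GL_2(Z_p), which acts through its reduction. *)
Lemma torus_act (l : padicQ pr) (x y : padicZ pr) u :
  l != 0 -> (residue x, residue y) != (0, 0) ->
  pi (torus xi (l * ZtoQ x) (l * ZtoQ y)) (phi u) =
  omega l *: phi (rhoM (tm (iota (residue x) + iota (residue y) * sF)) *m u).
Proof.
move=> l0 xy.
have ut := torus_mx_unit sF2 coords_ex coords_free (residual_torus_neq0 xy).
pose h := mx2 x y (y * xi) x.
have hE : map_mx (@residue p pr) h =
    tm (iota (residue x) + iota (residue y) * sF).
  by rewrite torus_mxE // map_mx2 rmorphM.
have uh : map_mx (@ZtoQ p pr) h \in unitmx.
  rewrite unitmxE det_map_mx rmorph_unit // residue_unit -det_map_mx hE.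
  by rewrite -unitfE -unitmxE.
have ul : (l%:M : 'M_2) \in unitmx by rewrite unitmxE det_scalar unitrX ?unitfE.
have -> : torus xi (l * ZtoQ x) (l * ZtoQ y) = l%:M *m map_mx (@ZtoQ p pr) h.
  rewrite mul_scalar_mx map_mx2 [ZtoQ (y * xi)]rmorphM.
  by apply: mx2P; rewrite !mxE ?mulrA.
by rewrite (GL2_rep_mul piP ul uh) pi_central // (residual_act _ ut hE).
Qed.

Lemma residual_lift z : z != 0 -> exists x y : padicZ pr,
  iota (residue x) + iota (residue y) * sF = z
  /\ (residue x, residue y) != (0, 0).
Proof.
move=> z0; have [c [d zE]] := coords_ex z.
exists ((c : nat)%:R), ((d : nat)%:R); rewrite !residue_lift -zE; split=> //.
move: z0; rewrite zE; apply: contra; rewrite xpair_eqE => /andP[/eqP-> /eqP->].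
by rewrite rmorph0 mul0r addr0.
Qed.

Lemma residual_eigenvector k u : u != 0 ->
  (forall z, z != 0 -> rhoM (tm z) *m u = tau z ^+ k *: u) ->
  exists chi, is_char chi /\ eigenvector xi sK pi chi (phi u).
Proof.
move=> u0 eu; apply: (eigenvector_char xi_ns dimK sK2 piP).
  by apply: contra u0 => /eqP pu0; apply/eqP/phi_inj; rewrite pu0 linear0.
move=> x y /padicQ_primitive[l [x0 [y0 [l0 -> -> xy0]]]].
rewrite torus_act // eu ?residual_torus_neq0 // linearZ scalerA.
by eexists.
Qed.

Section TameCharacter.
Variables (chi : K -> C) (chib : F -> C).
Hypothesis chiP : tame_char sK sF omega chi chib.

Lemma tame_value (l : padicQ pr) (x y : padicZ pr) :
  l != 0 -> (residue x, residue y) != (0, 0) ->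
  chi (Kelt sK (l * ZtoQ x) (l * ZtoQ y)) =
  omega l * chib (iota (residue x) + iota (residue y) * sF).
Proof.
move=> l0 xy; have -> : Kelt sK (l * ZtoQ x) (l * ZtoQ y) =
    l%:A * Kelt sK (ZtoQ x) (ZtoQ y).
  by rewrite mulr_algl /Kelt scalerDr !scalerA.
have lA0 : l%:A != 0 :> K by rewrite scaler_eq0 oner_eq0 orbF.
have k0 : Kelt sK (ZtoQ x) (ZtoQ y) != 0.
  apply: contra xy => /eqP/(Kelt_inj xi_ns sK2)/eqP.
  rewrite !xpair_eqE !tofrac_eq0 => /andP[/eqP-> /eqP->].
  by rewrite rmorph0 eqxx.
have [_ chiM] := tame_char_K chiP; rewrite chiM // (tame_char_omega chiP) //.
by rewrite (tame_char_red chiP) //; exact: residual_torus_neq0.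
Qed.

Variable k : nat.
Hypothesis chibE : forall z, z != 0 -> chib z = tau z ^+ k.

Lemma tame_eigenvector u :
  (forall z, z != 0 -> rhoM (tm z) *m u = tau z ^+ k *: u) ->
  eigenvector xi sK pi chi (phi u).
Proof.
move=> eu x y /padicQ_primitive[l [x0 [y0 [l0 -> -> xy0]]]].
have z0 := residual_torus_neq0 xy0.
by rewrite torus_act // tame_value // chibE // eu // linearZ scalerA.
Qed.

Lemma omega1 : omega 1 = 1.
Proof.
rewrite -(tame_char_omega chiP) ?oner_neq0 // scale1r.
by case: (tame_char_K chiP).
Qed.

Lemma tame_root_value : chi (Kelt sK 0 1) = tau sF ^+ k.
Proof.
have sF0 : sF != 0.
  apply: contra (xi_ns 0) => /eqP sF0; rewrite expr0n eq_sym.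
  by rewrite -(fmorph_eq0 iota) /= -sF2 sF0 expr0n.
have := tame_value (l := 1) (x := 0) (y := 1) (oner_neq0 _).
rewrite omega1 !mul1r !rmorph0 !rmorph1 add0r !mul1r.
by rewrite chibE // => -> //.
Qed.

Hypothesis k_lt : (k < #|F|.-1)%N.

Local Notation tsum j := (torus_sum tau iota (residue xi) sF rho j).

(** The residual eigenprojections of [u], one for each power of [tau], give the
    decomposition of [phi u] under the torus. *)
Lemma test_vector_residual u :
  tsum k *m u != 0 -> test_vector xi sK pi chi (phi u).
Proof.
move=> ku0; pose q := #|F|.-1%:R : C.
have q0 : q != 0 by rewrite pnatr_eq0 -lt0n card_pred_gt0.
have q'0 : q^-1 != 0 by rewrite invr_eq0.
pose pr_u j := q^-1 *: (tsum j *m u).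
have pr_eigen j z : z != 0 -> rhoM (tm z) *m pr_u j = tau z ^+ j *: pr_u j.
  move=> z0; rewrite -scalemxAr mulmxA.
  rewrite (torus_sum_eigen tauP sF2 coords_ex coords_free) //.
  by rewrite -scalemxAl scalerA mulrC -scalerA.
have uE : u = \sum_(j < #|F|.-1) pr_u j.
  rewrite -scaler_sumr -mulmx_suml.
  rewrite (torus_sum_total P_prime tauP _ coords_ex coords_free).
  by rewrite mul_scalar_mx scalerA mulVf // scale1r.
have phi0 x : phi x == 0 -> x == 0.
  by move/eqP => px0; apply/eqP/phi_inj; rewrite px0 linear0.
exists (phi (pr_u k)); last first.
  apply: contra ku0 => /phi0; rewrite /pr_u scaler_eq0 (negPf q'0) /=.
  by [].
split; first by apply: tame_eigenvector => z z0; exact: pr_eigen.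
pose js := [seq j <- index_enum 'I_(#|F|.-1) | (j != Ordinal k_lt) && (pr_u j
  != 0)].
exists [seq phi (pr_u (j : 'I_(#|F|.-1))) | j <- js].
  rewrite big_map big_filter {1}uE linear_sum (bigD1 (Ordinal k_lt)) //=.
  congr (_ + _); rewrite big_mkcondr /=; apply: eq_bigr => j _.
  by case: eqP => // ->; rewrite linear0.
move=> v /mapP[j]; rewrite mem_filter => /andP[/andP[jk uj0] _] ->.
have [chi' [chi'P ev']] := residual_eigenvector uj0 (pr_eigen j).
exists chi'; split=> //.
have [z z0 ne] : exists2 z, z != 0 & tau z ^+ j != tau z ^+ k.
  apply: contrapT => none; case/negP: jk; rewrite -val_eqE /=.
  have : (j = k %[mod #|F|.-1])%N.
    apply/(eq_tau_exp P_prime tauP) => z z0; apply: contrapT => /eqP ne.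
    by apply: none; exists z.
  by rewrite !modn_small // => ->.
have [x [y [zE xy0]]] := residual_lift z0.
have XY0 : (1 * ZtoQ x, 1 * ZtoQ y) != (0, 0).
  apply: contra xy0; rewrite !mul1r !xpair_eqE !tofrac_eq0.
  by move=> /andP[/eqP-> /eqP->]; rewrite rmorph0 eqxx.
exists (Kelt sK (1 * ZtoQ x) (1 * ZtoQ y)).
  by apply: contra XY0 => /eqP/(Kelt_inj xi_ns sK2) ->.
rewrite tame_value ?oner_neq0 // omega1 [1 * chib _]mul1r zE chibE //.
apply: contra ne => /eqP <-; apply/eqP.
have := ev' _ _ XY0;
  rewrite torus_act ?oner_neq0 // omega1 scale1r zE pr_eigen //.
rewrite linearZ => /eqP; rewrite -subr_eq0 -scalerBl scaler_eq0 => /orP[|/phi0].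
  by rewrite subr_eq0 => /eqP.
by rewrite (negPf uj0).
Qed.

Variables (nu : F -> C) (l : nat).
Hypothesis omega_nu : extends_residual nu omega.
Hypothesis nuE : forall z, z != 0 -> nu z = tau z ^+ l.

(** Agreement on [F_p^*] is tested on a generator of this group. *)
Lemma tame_exponent : k = l %[mod p.-1].
Proof.
have [g pg] := finField_generator 'F_p; have g0 := generator_neq0 pg.
have ig0 : iota g != 0 by rewrite fmorph_eq0.
pose x : padicZ pr := (g : nat)%:R.
have rx : residue x = g by exact: residue_lift.
have X0 : ZtoQ x != 0.
  rewrite tofrac_eq0; apply: contra g0 => /eqP x0.
  by rewrite -rx x0 rmorph0.
have := tame_value (l := 1) (x := x) (y := 0) (oner_neq0 _).
rewrite omega1 !mul1r rx !rmorph0 mul0r addr0 xpair_eqE negb_and g0.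
rewrite {1}/Kelt scale0r addr0 (tame_char_omega chiP) // => /(_ isT).
rewrite omega_nu ?residue_unit ?rx // chibE // -[Fp_in F g]/(iota g) nuE //.
rewrite -!(tauX tauP) => /(tau_inj P_prime tauP); rewrite -!rmorphXn.
move/(fmorph_inj iota)/eqP; rewrite (eq_prim_root_expr pg) card_Fp //.
by move/eqP.
Qed.

End TameCharacter.

End DepthZero.

(** * Test vectors *)

Section TestVectors.
Variables (p : nat) (pr : prime p) (p_odd : odd p).
Variables (xi : padicZ pr) (xi_unit : xi \is a GRing.unit).
Hypothesis xi_nonsquare : forall y : padicZ pr, y ^+ 2 != xi.
Variables (K : fieldExtType (padicQ pr)) (sK : K).
Hypotheses (dimK : \dim {: K} = 2%N) (sK2 : sK ^+ 2 = (ZtoQ xi)%:A).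
Variables (F : finFieldType) (sF : F).
Hypotheses (F_card : #|F| = (p ^ 2)%N) (sF2 : sF ^+ 2 = Fp_in F (residue xi)).
Variables (C : numFieldType) (P : C -> Prop) (tau nu : F -> C).
Hypotheses (P_prime : prime_over p P) (tauP : teichmuller P tau).
Variables (a b : nat) (a_lt : (a < p)%N) (b_lt : (b < a)%N).
Hypotheses (ab_even : ~~ odd (a + b)) (nu_ab : eq_char nu (chi_rs p tau a b)).
Variables (omega : padicQ pr -> C) (omega_nu : extends_residual nu omega).
Variables (V : lmodType C) (pi : 'M[padicQ pr]_2 -> V -> V).
Hypothesis piP : depth_zero_supercuspidal nu omega pi.

Let pF : p \in [pchar F] := card_finPcharP F_card pr.
Local Notation iota := (Fp_emb pF).
Local Notation r := (residue xi).
Local Notation h1 := ((a - b - 2)./2).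
Local Notation h2 := ((p - 1 - (a - b))./2).

Let q_card : #|F|.-1 = (p.-1 * p.+1)%N := card_pred_quadratic pF F_card.
Let two0 : 2%:R != 0 :> F := pchar_two_neq0 pF p_odd.
Let xi_ns c : c ^+ 2 != r := residue_nonsquare c p_odd xi_unit xi_nonsquare.
Let s2 : sF ^+ 2 = iota r := sF2.
Let s0 : sF != 0 := nonsquare_root_neq0 xi_ns s2.
Let sp : sF ^+ p = - sF := nonsquare_root_frobenius xi_ns s2.

Let coords_ex z : exists x y, z = iota x + iota y * sF :=
  coords_onto p_odd F_card xi_ns s2 z.

Let coords_free x y : iota x + iota y * sF = 0 -> (x, y) = (0, 0) :=
  coords_eq0 p_odd xi_ns s2 (x := x) (y := y).

Let nuE x : x != 0 -> nu x = tau x ^+ (a + p * b).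
Proof. by move=> x0; rewrite (eq_charP _ _ nu_ab x x0). Qed.

Let h1E : (h1.*2 + b).+2 = a.
Proof. by clear -b_lt ab_even; lia. Qed.

Let h2E : (h2.*2 + a).+1 = (p + b)%N.
Proof. by clear -a_lt b_lt ab_even p_odd; lia. Qed.

Let K_card : #|'F_p| = p := card_Fp pr.

Lemma tame_label chi chib : tame_char sK sF omega chi chib -> exists k t,
  [/\ (k < #|F|.-1)%N, forall z, z != 0 -> chib z = tau z ^+ k, (t <= p)%N &
    [/\ k = (a + p * b + p.-1 * t)%N %[mod #|F|.-1],
       oddz (t_of p tau nu chib) = odd t
      & type1 p tau nu chib = (0 < t < a - b)%N]].
Proof.
move=> chiP; have [k kq kE] := char_tau_exp P_prime tauP (tame_char_F chiP).
have kmod := tame_exponent xi_ns sK2 coords_free P_prime tauP chiP kE omega_nu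
  nuE.
have [t [tp tE ot ty]] := char_label P_prime tauP pr q_card p_odd a_lt b_lt
  nuE kq kE kmod.
by exists k, t.
Qed.

(** The weight is defined by the action of the units of Z_p; since they reduce
    onto F_p^*, it can be read on the cuspidal representation. *)
Lemma weight_model e v : torus_vector pi (mu_pow tau e) v ->
  exists (rho : mx_representation C [set: {'GL_2['F_p]}] p.-1)
    (phi : {linear 'cV[C]_(p.-1) -> V}) (u : 'cV[C]_(p.-1)),
  [/\ cuspidal_rep nu rho, injective phi
    & forall (h : 'M[padicZ pr]_2) (g : {'GL_2['F_p]}) (u : 'cV[C]_(p.-1)),
      h \in unitmx -> GLval g = map_mx (@residue p pr) h ->
      pi (map_mx (@ZtoQ p pr) h) (phi u) = phi (rho g *m u)] /\
  [/\ v = phi u, u != 0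
    & forall c, c != 0 -> rhomx rho (mx2 c 0 0 1) *m u = tau (iota c) ^+ e *:
      u].
Proof.
case=> v0 vfix vw; have [rho rhoP [phi [phi_inj phi_fix phi_act]]] := dz_type
  piP.
have [u vE] := (phi_fix v).1 vfix; exists rho, phi, u; split=> //; split=> //.
  by apply: contra v0 => /eqP u0; rewrite vE u0 linear0.
move=> c c0; pose x : padicZ pr := (c : nat)%:R.
have rx : residue x = c by exact: residue_lift.
have ux : x \is a GRing.unit by rewrite residue_unit rx.
apply: phi_inj; rewrite linearZ /=.
have uc : mx2 c 0 0 1 \in unitmx by rewrite diag_unit ?oner_neq0.
have hM : map_mx (@residue p pr) (mx2 x 0 0 1) = mx2 c 0 0 1.
  by rewrite map_mx2 rmorph0 rmorph1 rx.
rewrite -(residual_act phi_act u uc hM) map_mx2 rmorph0 rmorph1 -vE vw //.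
by rewrite rx.
Qed.

Section Weight.
Variables (e : nat) (v : V).
Hypothesis vP : torus_vector pi (mu_pow tau e) v.
Variables (chi : K -> C) (chib : F -> C) (k t : nat).
Hypotheses (chiP : tame_char sK sF omega chi chib) (kq : (k < #|F|.-1)%N).
Hypothesis chibE : forall z, z != 0 -> chib z = tau z ^+ k.
Hypothesis kE : k = (a + p * b + p.-1 * t)%N %[mod #|F|.-1].

Lemma cuspidal_torus_neq0
    (rho : mx_representation C [set: {'GL_2['F_p]}] p.-1)
    (u : 'cV[C]_(p.-1)) k' t' :
  cuspidal_rep nu rho -> u != 0 ->
  (forall c, c != 0 -> rhomx rho (mx2 c 0 0 1) *m u = tau (iota c) ^+ e *: u) ->
  k' = (a + p * b + p.-1 * t')%N %[mod #|F|.-1] -> detected p a b h1 h2 e t' ->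
  torus_sum tau iota r sF rho k' *m u != 0.
Proof.
move=> rhoP u0 uw k'E det.
have C0 : [pchar C] =i pred0 := pchar_num C.
have no_fixed := cuspidal_no_fixed rhoP.
have central := cuspidal_scalar pF nuE rhoP.
have elliptic := cuspidal_elliptic (pF := pF) nuE rhoP.
have quad := prime_field_quadratic pF p_odd F_card.
have fixed z : z ^+ p = z -> exists c, z = iota c := @Fp_in_fixed p F z pF.
have red M uM := tr_reduces P_prime tauP pF F_card K_card fixed quad h1E h2E
  no_fixed central elliptic (M := M) uM.
have split c : c != 0 -> c != 1 -> \tr (rhomx rho (mx2 c 0 0 1)) = 0.
  by move=> c0 c1; apply: (tr_split C0 no_fixed) => //; exact: oner_neq0.
exact: (torus_sum_neq0 P_prime tauP pF K_card q_card two0 s2 sp s0 coords_ex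
  coords_free h1E h2E split red u0 uw k'E det).
Qed.

Lemma detected_test : detected p a b h1 h2 e t -> test_vector xi sK pi chi v.
Proof.
move=> det; have [rho [phi [u [[rhoP phi_inj phi_act] [-> u0 uw]]]]] :=
  weight_model vP.
have ku0 := cuspidal_torus_neq0 rhoP u0 uw kE det.
exact: (test_vector_residual xi_ns dimK sK2 s2 coords_ex coords_free P_prime
  tauP
  (dz_rep piP) (dz_central piP) phi_inj phi_act chiP chibE kq ku0).
Qed.

(** The torus element [sF] acts on the weight vector by a scalar, which a
    detected label [t0] identifies; for labels of the other parity the value of
    the character on [sF] has the opposite sign. *)
Lemma undetected_not_test t0 : (e + e = a + b %[mod p.-1])%N ->
  detected p a b h1 h2 e t0 -> odd t0 -> ~~ odd t -> ~ test_vector xi sK pi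
    chi v.
Proof.
move=> self_dual det0 ot0 ot.
have [rho [phi [u [[rhoP phi_inj phi_act] [-> u0 uw]]]]] := weight_model vP.
have ku0 := cuspidal_torus_neq0 rhoP u0 uw erefl det0.
have central := cuspidal_scalar pF nuE rhoP.
have dual c : c != 0 -> tau (iota c) ^+ (e + e) = tau (iota c) ^+ (a + p * b).
  move=> c0; rewrite -!(tauX tauP) -!rmorphXn; congr (tau (iota _)).
  have cp : c ^+ p.-1 = 1 by have := expf_card_pred c0; rewrite K_card.
  rewrite -(expr_mod _ cp) self_dual (expr_mod _ cp) !exprD; congr (_ * _).
  by have cpp := expf_card c; rewrite K_card in cpp; rewrite exprM cpp.
have C0 : [pchar C] =i pred0 := pchar_num C.
have no_fixed := cuspidal_no_fixed rhoP.
have split c : c != 0 -> c != 1 -> \tr (rhomx rho (mx2 c 0 0 1)) = 0.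
  by move=> c0 c1; apply: (tr_split C0 no_fixed) => //; exact: oner_neq0.
have [l su] := root_preserves_line tauP pF K_card s2 s0 coords_ex coords_free
  central split u0 uw dual.
have lE := root_eigenvalue tauP s2 s0 coords_ex coords_free su ku0.
have XY0 : (1 * ZtoQ 0, 1 * ZtoQ 1) != (0, 0) :> padicQ pr * padicQ pr.
  by rewrite !mul1r rmorph0 rmorph1 xpair_eqE oner_eq0 andbF.
apply: (not_test_vector xi_ns dimK sK2 (dz_rep piP) (l := l) XY0).
  rewrite (torus_act s2 coords_ex coords_free (dz_rep piP) (dz_central piP)
    phi_act).
  - rewrite (omega1 chiP) scale1r !rmorph0 !rmorph1 add0r mul1r su.
    by rewrite linearZ.
  - exact: oner_neq0.
  - by rewrite xpair_eqE rmorph1 oner_eq0 andbF.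
rewrite !mul1r rmorph0 rmorph1.
rewrite (tame_root_value xi_ns sK2 s2 coords_free chiP chibE) lE.
have tq := tau_unity tauP s0.
rewrite -(expr_mod _ tq) kE (expr_mod _ tq) [in X in _ != X]exprD exprD.
have tsp : tau sF ^+ p.-1 = -1.
  rewrite -(tauX tauP) -(tauN1 P_prime tauP two0); congr tau.
  by apply: (mulfI s0); rewrite -exprS prednK ?(prime_gt0 pr) // sp mulrN1.
rewrite !exprM tsp -signr_odd (negPf ot) -[in X in _ != X]signr_odd ot0 expr0
  expr1.
rewrite mulr1 mulrN1 -addr_eq0 -mulr2n -mulr_natr.
by rewrite mulf_neq0 ?pnatr_eq0 // expf_neq0 // (tau_neq0 tauP).
Qed.

End Weight.
Local Notation norm_char e := (fun z : F => mu_pow tau e (Fnorm p z)).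

Lemma norm_charE e z : norm_char e z = tau z ^+ (p.+1 * e).
Proof. by rewrite /mu_pow Fp_in_Fnorm // (tauX tauP) exprM. Qed.

(** With [a = e + d] and [b = e - d], the exponent [(p + 1) e] of the norm
    character lies halfway between [a + p b] and [b + p a]. *)
Lemma type1_norm_char : type1 p tau nu (norm_char ((a + b) %/ 2)).
Proof.
rewrite /type1 (k_of_nu P_prime tauP pr q_card a_lt b_lt nuE).
rewrite (k_of_nu_conj P_prime tauP pr q_card a_lt b_lt nuE).
have [e [d [d0 aE bE]]] : exists e d, [/\ (0 < d)%N, a = (e + d)%N & (b + d =
  e)%N].
  by exists ((a + b)./2), ((a - b)./2); clear -ab_even b_lt; split; lia.
have -> : ((a + b) %/ 2 = e)%N by clear -aE bE; lia.
have ep : (e < p.-1)%N by clear -aE bE a_lt d0; lia.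
rewrite (k_of_tau P_prime tauP pr q_card (k := (p.+1 * e)%N)).
- rewrite aE -bE; clear -d0 ep; case: p ep => // q eq.
  have qd : (0 < q * d)%N by rewrite muln_gt0 d0 andbT; lia.
  by apply/andP; split; nia.
- by rewrite q_card mulnC ltn_pmul2r.
- by move=> z _; rewrite norm_charE.
Qed.

(** The exponent is [p + 1] times the residue of [(a + b + p - 1) / 2] modulo
    [p - 1], which is at least [a] or at most [b]. *)
Lemma type2_norm_char : type2 p tau nu (norm_char ((a + b + p - 1) %/ 2)).
Proof.
rewrite /type2 /type1 (k_of_nu P_prime tauP pr q_card a_lt b_lt nuE).
rewrite (k_of_nu_conj P_prime tauP pr q_card a_lt b_lt nuE).
set e := (_ %/ 2)%N; have eE : (e + e = a + b + p.-1)%N.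
  by rewrite /e; clear -ab_even p_odd; lia.
have p1 : (0 < p.-1)%N by have := prime_gt1 pr; clear; lia.
have kE : k_of p tau (norm_char e) = (p.+1 * (e %% p.-1))%N.
  rewrite (k_of_tau P_prime tauP pr q_card (k := (p.+1 * (e %% p.-1))%N)) //.
    by rewrite q_card mulnC ltn_pmul2r // ltn_pmod.
  move=> z z0; rewrite norm_charE; move: z z0.
  apply/(eq_tau_exp P_prime tauP); rewrite q_card [(p.-1 * _)%N]mulnC.
  by rewrite -!muln_modr modn_mod.
rewrite kE negb_and -!leqNgt; clear kE.
have [ep|pe] := ltnP e p.-1.
  have ae : (a <= e)%N by clear -eE a_lt b_lt; lia.
  rewrite modn_small //; apply/orP; right.
  by rewrite mulSn leq_add ?leq_mul2l ?ae ?orbT // (leq_trans (ltnW b_lt)).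
have -> : (e %% p.-1 = e - p.-1)%N.
  rewrite -{1}(subnK pe) modnDr modn_small //.
  by clear -eE a_lt b_lt p1; lia.
have fb : (e - p.-1 <= b)%N by clear -eE a_lt b_lt; lia.
apply/orP; left; rewrite mulSn leq_add ?leq_mul2l ?fb ?orbT //.
exact: leq_trans fb (ltnW b_lt).
Qed.

End TestVectors.

Theorem theorem1p3 (R : realType) (p : nat) (pr : prime p) (p_odd : odd p)
  (* Q_p(sqrt xi) and its residue field *)
  (xi : padicZ pr) (xi_unit : xi \is a GRing.unit)
  (xi_nonsquare : forall y : padicZ pr, y ^+ 2 != xi)
  (K : fieldExtType (padicQ pr)) (K_quadratic : \dim {: K} = 2%N)
  (sK : K) (sK2 : sK ^+ 2 = (ZtoQ xi)%:A)
  (F : finFieldType) (F_card : #|F| = (p ^ 2)%N)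
  (sF : F) (sF2 : sF ^+ 2 = Fp_in F (residue xi))
  (* the prime above p and the identification of F^* with roots of unity *)
  (P : R[i] -> Prop) (P_prime : prime_over p P)
  (tau : F -> R[i]) (tauP : teichmuller P tau)
  (* nu, omega and Pi *)
  (nu : F -> R[i]) (nu_char : is_char nu)
  (nu_regular : ~~ eq_char nu (fun x => nu x ^+ p))
  (a b : nat) (a_lt : (a < p)%N) (b_lt : (b < a)%N) (ab_even : ~~ odd (a + b))
  (nu_ab : eq_char nu (chi_rs p tau a b))
  (omega : padicQ pr -> R[i]) (omega_char : is_char omega)
  (omega_nu : extends_residual nu omega)
  (V : lmodType R[i]) (pi : 'M[padicQ pr]_2 -> V -> V)
  (piP : depth_zero_supercuspidal nu omega pi)
  (v1 v2 v3 v4 : V)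
  (v1P : torus_vector pi (mu_pow tau ((a + b) %/ 2)) v1)
  (v2P : torus_vector pi (mu_pow tau ((a + b + p - 1) %/ 2)) v2)
  (v3P : torus_vector pi (mu_pow tau ((a + b) %/ 2 - 1)) v3)
  (v4P : torus_vector pi (mu_pow tau ((a + b + p - 1) %/ 2 - 1)) v4) :
  let chi1 := fun z : F => mu_pow tau ((a + b) %/ 2) (Fnorm p z) in
  let chi2 := fun z : F => mu_pow tau ((a + b + p - 1) %/ 2) (Fnorm p z) in
  let test := test_vector xi sK pi in
  let tame := tame_char sK sF omega in
  let t := t_of p tau nu in
  let type1 := type1 p tau nu in
  let type2 := type2 p tau nu in
  ((forall chi, tame chi chi1 -> (test chi v1 <-> oddz (t chi1))) /\ type1 chi1)
  /\
  ((forall chi, tame chi chi2 -> (test chi v2 <-> oddz (t chi2))) /\ type2 chi2)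
  /\
  ((forall chi chib, tame chi chib -> type1 chib -> oddz (t chib) ->
      test chi v1) /\
   (forall chi chib, tame chi chib -> type2 chib -> oddz (t chib) ->
      test chi v2))
  /\
  (forall chi chib, tame chi chib -> ~~ oddz (t chib) ->
     ~ test chi v1 /\ ~ test chi v2)
  /\
  (forall chi chib, tame chi chib -> type1 chib -> ~~ oddz (t chib) ->
     test chi v3)
  /\
  (forall chi chib, tame chi chib ->
     ~~ eq_char chib nu -> ~~ eq_char chib (fun x => nu x ^+ p) ->
     type2 chib -> ~~ oddz (t chib) -> test chi v4).
Proof.
move=> chi1 chi2 test tame t ty1 ty2.
have nuE : forall x, x != 0 -> nu x = tau x ^+ (a + p * b) by exact/eq_charP.
have pF : p \in [pchar F] := card_finPcharP F_card pr.
have q_card := card_pred_quadratic pF F_card.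
have lab := tame_label p_odd xi_unit xi_nonsquare sK2 F_card sF2 P_prime tauP
  a_lt b_lt nu_ab omega_nu.
have yes e v (vP : torus_vector pi (mu_pow tau e) v) chi chib k u :=
  detected_test p_odd xi_unit xi_nonsquare K_quadratic sK2 F_card sF2 P_prime
    tauP a_lt b_lt ab_even nu_ab piP vP (chi := chi) (chib := chib) (k := k)
    (t := u).
have no e v (vP : torus_vector pi (mu_pow tau e) v) chi chib k u :=
  undetected_not_test p_odd xi_unit xi_nonsquare K_quadratic sK2 F_card sF2
    P_prime tauP a_lt b_lt ab_even nu_ab piP vP (chi := chi) (chib := chib)
    (k := k) (t := u).
have ty1_chi1 : ty1 chi1.
  exact: (type1_norm_char pr F_card P_prime tauP a_lt b_lt ab_even nu_ab).
have ty2_chi2 : ty2 chi2.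
  exact: (type2_norm_char pr p_odd F_card P_prime tauP a_lt b_lt ab_even nu_ab).
have det1 u : (0 < u < a - b)%N -> odd u ->
    detected p a b (a - b - 2)./2 (p - 1 - (a - b))./2 ((a + b) %/ 2) u.
  by move=> ub ou; left; split=> //; left; split=> //; clear -b_lt ab_even; lia.
have det2 u : (a - b < u <= p)%N -> odd u ->
    detected p a b (a - b - 2)./2 (p - 1 - (a - b))./2 ((a + b + p - 1) %/ 2) u.
  move=> ub ou; right; split=> //; left; split=> //.
  by clear -a_lt b_lt ab_even p_odd; lia.
have det3 u : (0 < u < a - b)%N -> ~~ odd u ->
    detected p a b (a - b - 2)./2 (p - 1 - (a - b))./2 ((a + b) %/ 2 - 1) u.
  move=> ub ou; left; split=> //; right; split=> //.
  by clear -b_lt ab_even; lia.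
have det4 u : (a - b < u <= p)%N -> ~~ odd u ->
    detected p a b (a - b - 2)./2 (p - 1 - (a - b))./2
      ((a + b + p - 1) %/ 2 - 1) u.
  move=> ub ou; right; split=> //; right; split=> //.
  by clear -a_lt b_lt ab_even p_odd; lia.
have self1 : ((a + b) %/ 2 + (a + b) %/ 2 = a + b %[mod p.-1])%N.
  by congr (_ %% _)%N; clear -ab_even; lia.
have self2 :
    ((a + b + p - 1) %/ 2 + (a + b + p - 1) %/ 2 = a + b %[mod p.-1])%N.
  rewrite -[RHS]modnDr; congr (_ %% _)%N.
  by clear -a_lt ab_even p_odd; lia.
have odd_yes1 chi chib :
    tame chi chib -> ty1 chib -> oddz (t chib) -> test chi v1.
  rewrite /ty1 /t => chiP; have [k [u [kq kE up [uE -> ->]]]] := lab _ _ chiP.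
  by move=> ub ou; apply: (yes _ _ v1P _ _ _ _ chiP kq kE uE _); exact: det1.
have odd_yes2 chi chib :
    tame chi chib -> ty2 chib -> oddz (t chib) -> test chi v2.
  rewrite /ty2 /type2 /t => chiP;
    have [k [u [kq kE up [uE -> ->]]]] := lab _ _ chiP.
  move=> ub ou; apply: (yes _ _ v2P _ _ _ _ chiP kq kE uE _); apply: det2 => //.
  by clear -ub ou up b_lt ab_even; lia.
(* The labels 1 and p are odd, and each symmetric power carries one of them, so
   they determine the scalar by which the torus element acts. *)
have even_no chi chib : tame chi chib -> ~~ oddz (t chib) ->
    ~ test chi v1 /\ ~ test chi v2.
  rewrite /t => chiP; have [k [u [kq kE up [uE -> _]]]] := lab _ _ chiP => ou;
    split.
    apply: (no _ _ v1P _ _ _ _ chiP kE uE 1%N self1 _ isT ou);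
      apply: det1 => //.
    by clear -b_lt ab_even; lia.
  apply: (no _ _ v2P _ _ _ _ chiP kE uE p self2 _ p_odd ou); apply: det2 => //.
  by clear -a_lt b_lt ab_even p_odd; lia.
split.
  split=> // chi chiP; split=> [tv|]; last exact: odd_yes1.
  by apply: contraT => /(even_no _ _ chiP)[].
split.
  split=> // chi chiP; split=> [tv|]; last exact: odd_yes2.
  by apply: contraT => /(even_no _ _ chiP)[].
split; first by split.
split=> //; split=> [chi chib chiP | chi chib chiP nu1 nu2].
  have [k [u [kq kE up [uE]]]] := lab _ _ chiP.
  rewrite /t /ty1 => -> -> ub ou.
  by apply: (yes _ _ v3P _ _ _ _ chiP kq kE uE _); exact: det3.
have [k [u [kq kE up [uE]]]] := lab _ _ chiP.
rewrite /t /ty2 /type2 => -> -> ub ou.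
apply: (yes _ _ v4P _ _ _ _ chiP kq kE uE _); apply: det4 => //;
  rewrite up andbT.
rewrite ltn_neqAle; apply/andP; split.
  apply: contra nu2 => /eqP abu; apply/eq_charP => z z0.
  rewrite kE // (nu_conj P_prime tauP pr q_card nuE) //; move: z z0.
  apply/(eq_tau_exp P_prime tauP); rewrite uE -abu; congr (_ %% _)%N.
  have [d aE] : exists d, a = (b + d)%N by exists (a - b)%N;
    rewrite subnKC // ltnW.
  have pE : (p = p.-1.+1)%N by rewrite prednK ?prime_gt0.
  by rewrite aE addKn pE /=; clear; nia.
rewrite leqNgt; apply: contra ub => ub; rewrite ub andbT lt0n.
apply: contra nu1 => /eqP u0; apply/eq_charP => z z0.
rewrite kE // nuE //; move: z z0.
by apply/(eq_tau_exp P_prime tauP); rewrite uE u0 muln0 addn0.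
Qed.
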